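(* Let $k \geq 2$ be an integer and let $\lambda \asymp 1$ as $d \to \infty$. Let $\hat{\boldsymbol V} \in \mathbb{R}^d$ denote any estimator for $k$-TPCA that can be computed using a memory bounded estimation algorithm with resource profile $(N, T, s)$ scaling with $d$ as $$N \asymp d^{\eta}/\lambda^2, \quad T \asymp d^{\tau}, \quad s \asymp d^{\mu}$$ for any constants $\eta \geq 1$, $\tau \geq 0$, $\mu \geq 0$. If $$\eta + \tau + \mu < \left\lceil \frac{k+1}{2} \right\rceil,$$ then, for any $t \in \mathbb{R}$, $$\limsup_{d \to \infty}\ \inf_{\boldsymbol V \in \mathcal{V}} \mathbb{P}_{\boldsymbol V}\left( \frac{|\langle \boldsymbol V, \hat{\boldsymbol V}\rangle|^2}{\|\boldsymbol V\|^2 \|\hat{\boldsymbol V}\|^2} \geq \frac{t^2}{d} \right) \leq 2 \exp\left(-\frac{t^2}{2}\right).$$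
   Context: **Symmetric order-$k$ Tensor PCA ($k$-TPCA).** The parameter space is $\mathcal{V} = \{\boldsymbol V \in \mathbb{R}^d : \|\boldsymbol V\| = \sqrt{d}\}$. Given $\boldsymbol V \in \mathcal{V}$ one observes $N$ i.i.d. tensors $\boldsymbol X_1, \dots, \boldsymbol X_N \in (\mathbb{R}^d)^{\otimes k}$ with $$\boldsymbol X_i = \frac{\lambda \boldsymbol V^{\otimes k}}{\sqrt{d^k}} + \boldsymbol W_i, \qquad (W_i)_{j_1,\dots,j_k} \overset{\text{i.i.d.}}{\sim} \mathcal{N}(0,1) \ \ \forall j_1,\dots,j_k \in [d],$$ where $\lambda>0$ is the signal-to-noise ratio. $\mathbb{P}_{\boldsymbol V}$ denotes probability when the data are generated with parameter $\boldsymbol V$. An estimator is a function of the dataset $\boldsymbol X_{1:N}$. **Memory bounded estimation algorithm with resource profile $(N,T,s)$.** Such an algorithm makes $T$ passes over a dataset of $N$ samples $\boldsymbol x_1, \dots, \boldsymbol x_N \in \mathcal{X}$ (here $\boldsymbol x_i=\boldsymbol X_i$) using a memory state of $s$ bits, initially all zeros. It is specified by arbitrary update functions $f_{t,i} : \{0,1\}^s \times \mathcal{X} \to \{0,1\}^s$ ($t \in [T]$, $i \in [N]$) and an arbitrary estimator function $g$ on $\{0,1\}^s$. For $t = 1,\dots,T$ in order, and within each pass for $i = 1,\dots,N$ in order, the state is updated by $\mathtt{state} \leftarrow f_{t,i}(\mathtt{state}, \boldsymbol x_i)$. After all $T$ passes the output is $\hat{\boldsymbol V} = g(\mathtt{state})$.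 **Asymptotic notation.** For non-negative sequences indexed by $d$, $a_d \lesssim b_d$ means $\limsup_{d\to\infty} a_d/b_d < \infty$; $a_d \asymp b_d$ means $a_d \lesssim b_d$ and $b_d \lesssim a_d$. $k$ is fixed as $d \to \infty$. *)

(* Defs.v *)
From HB Require Import structures.
From mathcomp Require Export all_boot all_order all_algebra.
From mathcomp Require Export all_classical all_reals all_analysis.

Set Implicit Arguments.
Unset Strict Implicit.
Unset Printing Implicit Defensive.

Export Order.TTheory GRing.Theory Num.Theory.
Export numFieldNormedType.Exports.

Local Open Scope classical_set_scope.
Local Open Scope ring_scope.

(* The library's norm on matrices is the sup norm, hence [dotv] and [norm2]. *)
Definition dotv {R : realType} {d : nat} (u v : 'rV[R]_d) : R :=
  \sum_(i < d) u 0 i * v 0 i.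

Definition norm2 {R : realType} {d : nat} (u : 'rV[R]_d) : R :=
  Num.sqrt (dotv u u).

Definition param_space (R : realType) (d : nat) : set 'rV[R]_d :=
  [set V | norm2 V = Num.sqrt d%:R].

(* The cosine squared |<V, U>|^2 / (|V|^2 |U|^2); by the convention x / 0 = 0
   it is 0 when U = 0. *)
Definition sq_corr {R : realType} {d : nat} (V U : 'rV[R]_d) : R :=
  `|dotv V U| ^+ 2 / (norm2 V ^+ 2 * norm2 U ^+ 2).

Definition coord_sets (I : Type) (R : realType) : set (set (I -> R)) :=
  \bigcup_(j in [set: I])
    preimage_set_system setT (fun x : I -> R => x j) measurable.

(* Order-k tensors over R^d, indexed by (j_1, ..., j_k) in [d]^k, with the
   product sigma-algebra, which is the Borel one of R^(d^k). *)
Definition tensor (R : realType) (d k : nat) : measurableType _ :=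
  g_sigma_algebraType (@coord_sets (k.-tuple 'I_d) R).

Definition tensor_power {R : realType} {d k : nat} (V : 'rV[R]_d) :
    tensor R d k :=
  fun j => \prod_(l < k) V 0 (tnth j l).

Definition mutually_independent {disp} {Omega : measurableType disp}
    {R : realType} (P : probability Omega R) (I : finType)
    (X : I -> {RV P >-> R}) : Prop :=
  forall (A : {set I}) (B : I -> set R), (forall i, measurable (B i)) ->
    P [set w | forall i, i \in A -> B i (X i w)] =
      (\prod_(i in A) P (X i @^-1` B i))%E.

Definition standard_gaussian {disp} {Omega : measurableType disp}
    {R : realType} (P : probability Omega R) (X : {RV P >-> R}) : Prop :=
  forall B : set R, measurable B -> distribution P X B = normal_prob 0 1 B.

Definition gaussian_noise {disp} {Omega : measurableType disp}
    {R : realType} (P : probability Omega R) (N d k : nat)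
    (W : 'I_N * k.-tuple 'I_d -> {RV P >-> R}) : Prop :=
  mutually_independent W /\ forall ij, standard_gaussian (W ij).

Definition tpca_data {disp} {Omega : measurableType disp}
    {R : realType} (P : probability Omega R) (N d k : nat)
    (W : 'I_N * k.-tuple 'I_d -> {RV P >-> R}) (lambda : R) (V : 'rV[R]_d)
    (w : Omega) : 'I_N -> tensor R d k :=
  fun i j =>
    lambda * tensor_power V j / Num.sqrt (d%:R ^+ k) + W (i, j) w.

(* Update functions are arbitrary up to measurability in the sample, without
   which the law of the output would not be defined. *)
Record mem_algorithm {disp} (X : measurableType disp) (Y : Type)
    (N T s : nat) := MemAlgorithm {
  update : 'I_T -> 'I_N -> s.-tuple bool -> X -> s.-tuple bool;
  estimate : s.-tuple bool -> Y;
  measurable_update : forall t i st, measurable_fun [set: X] (update t i st)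
}.

Section run.
Context {disp} {X : measurableType disp} {Y : Type} {N T s : nat}.
Variables (alg : mem_algorithm X Y N T s) (x : 'I_N -> X).

Definition run_pass (st : s.-tuple bool) (t : 'I_T) : s.-tuple bool :=
  foldl (fun st i => update alg t i st (x i)) st (enum 'I_N).

Definition final_state : s.-tuple bool :=
  foldl run_pass [tuple of nseq s false] (enum 'I_T).

Definition output : Y := estimate alg final_state.

End run.

Definition memory_bounded {disp} {X : measurableType disp} {Y : Type}
    {N : nat} (T s : nat) (Yhat : ('I_N -> X) -> Y) : Prop :=
  exists alg : mem_algorithm X Y N T s, forall x, Yhat x = output alg x.

(* The quotient is taken in \bar R, where a / 0 = +oo for a > 0. *)
Definition asymp_le {R : realType} (a b : nat -> R) : Prop :=
  (limn_esup (fun d => (a d)%:E / (b d)%:E) < +oo)%E.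

Definition asymp_eq {R : realType} (a b : nat -> R) : Prop :=
  asymp_le a b /\ asymp_le b a.

(* Main.v *)
From HB Require Import structures.
Require Import Defs.
From mathcomp Require Import ring lra zify measurable_realfun normal_distribution.

Set Implicit Arguments.
Unset Strict Implicit.
Unset Printing Implicit Defensive.

Local Open Scope classical_set_scope.
Local Open Scope ring_scope.

(** Put a uniform prior on the sign vectors V.  By Hoeffding's inequality
    ([sign_correlation_tail]) a guess that does not depend on V reaches the
    required correlation with probability at most 2 exp(-t^2/2), so it is
    enough that the final memory state is, on average over V, nearly
    independent of V: then some V defeats the estimator.

    Reduction to bits.  With u the signal carried by one entry, an entry is
    distributed as c u + W where the sign c = prod_l V_(j_l) depends on V.
    This is the law of a random sign times u + W, the sign having conditional
    mean c tanh(u (u + W)) ([gauss_flip], [mixture_law]).  The moduli carry no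
    information, and given them the samples are independent vectors of d^k
    bits with densities prod_j (1 + t_j chi_j(V) x_j), where |t_j| is at most
    2 u ell unless some |u + W| exceeds ell, which is very unlikely
    ([gauss_tail]).

    Reduction to one message.  View sample i as a player whose message is the
    list of the T states it produces.  Transcripts form rectangles, and
    resampling one sample changes the transcript only through the message of
    its owner.  Hence the likelihood ratio of transcripts is a product of
    ratios r_i, the divergence phi(r) = r - 1 - ln r is additive over them, and
    each term is the divergence of a single function of one sample with values
    in an alphabet of size 2^(sT) ([transcript_tv], [protocol_transfer]).

    Divergence of one message ([cell_bound], [cells_bound]).  Let a message be
    sent on a cell of probability p.  Its probability under V is a polynomial
    in V whose coefficient at chi_S collects the Walsh coefficients of the
    cell at the families A of tuples with parity S.  Cells that are too small
    are few enough to be neglected; for the others, hypercontractivity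
    ([bonami]) gives the level inequality [level_small], which bounds the
    weighted energy of the Walsh coefficients by e p^2.  Families with more
    than D tuples contribute little.  For the remaining ones everything rests
    on counting the families of parity S: a word of length kL with parity S
    can be chosen in at most (A sqrt d)^(kL) / sqrt d^|S| ways
    ([word_count_le]).  A nonempty parity has |S| >= 1 when k is odd and
    |S| >= 2 when k is even, and this extra factor turns the exponent k/2 into
    the ceiling of (k + 1)/2.

    Choosing ell a small power of d, the degree D of order ell^2 and the
    hypercontractive exponent of order sT + ell^2, the total divergence over
    N samples is N s T / d^(ceil((k+1)/2)) up to a factor that is a small power
    of d, and tends to 0 ([eventually_admissible]). *)

(** * Hypercontractivity on the cube *)

(** Comparison of coefficients in the two-point inequality: passing from j to
    j + 1 multiplies the left side by
    (2m-2j)(2m-2j-1) / ((2j+2)(2j+1)) and the right side by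
    (m-j)(2m-1)/(j+1), and the second factor is the larger one. *)
Lemma bin_double_le m j : ('C(m.*2, j.*2) <= 'C(m, j) * m.*2.-1 ^ j)%N.
Proof.
elim: j => [|j IHj]; first by rewrite !bin0.
case: (ltnP j m) => [jm|mj]; last first.
  by rewrite bin_small//; lia.
have e1 := mul_bin_left m.*2 j.*2.
have e2 := mul_bin_left m.*2 j.*2.+1.
have e3 := mul_bin_left m j.
rewrite doubleS expnS.
set c2 := 'C(m.*2, j.*2.+2) in e2 *; set c1 := 'C(m.*2, j.*2.+1) in e1 e2.
set c0 := 'C(m.*2, j.*2) in e1 IHj; set b0 := 'C(m, j) in e3 IHj.
set b1 := 'C(m, j.+1) in e3 *; set P := (_ ^ j)%N in IHj *.
have h1 : (j.*2.+2 * j.*2.+1 * c2 = (m.*2 - j.*2.+1) * (m.*2 - j.*2) * c0)%N.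
  by rewrite -[RHS]mulnA -e1 mulnCA -e2 mulnCA mulnA.
have h2 : (j.*2.+2 * j.*2.+1 * c2 <=
           (m.*2 - j.*2.+1) * 2 * (j.+1 * b1) * P)%N.
  rewrite h1 e3.
  have -> : ((m.*2 - j.*2) = 2 * (m - j))%N by lia.
  rewrite -!mulnA leq_mul2l; apply/orP; right.
  by rewrite leq_mul2l /= leq_mul2l; apply/orP; right.
have h3 : ((m.*2 - j.*2.+1) * 2 * (j.+1 * b1) * P <=
   j.*2.+2 * j.*2.+1 * (b1 * (m.*2.-1 * P)))%N.
  have -> : ((m.*2 - j.*2.+1) * 2 * (j.+1 * b1) * P =
     (j.*2.+2 * (b1 * P)) * (m.*2 - j.*2.+1))%N.
    have -> : j.*2.+2 = (2 * j.+1)%N by lia.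
    by move: (m.*2 - _)%N j.+1 => x y; ring.
  have -> : (j.*2.+2 * j.*2.+1 * (b1 * (m.*2.-1 * P)) =
     (j.*2.+2 * (b1 * P)) * (j.*2.+1 * m.*2.-1))%N.
    by move: j.*2.+2 j.*2.+1 m.*2.-1 => x y z; ring.
  rewrite leq_mul2l; apply/orP; right; nia.
have := leq_trans h2 h3.
by rewrite leq_pmul2l.
Qed.

Lemma sum_even_odd (V : zmodType) (m : nat) (F : nat -> V) :
  \sum_(i < m.*2.+1) F i =
  \sum_(j < m.+1) F j.*2 + \sum_(j < m) F j.*2.+1.
Proof.
elim: m => [|m IHm]; first by rewrite !big_ord_recr !big_ord0 addr0.
rewrite doubleS 2!big_ord_recr /= IHm [in RHS]big_ord_recr /=.
rewrite [\sum_(j < m.+1) F j.*2.+1]big_ord_recr /= doubleS.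
by rewrite -!addrA; congr (_ + _); rewrite [RHS]addrC -!addrA.
Qed.

Section Hyper.
Variable R : realType.

(** Bonami's inequality on one bit with the optimal constant.  The odd powers
    of b cancel, and the even ones are compared term by term with the binomial
    expansion of the right side. *)
Lemma two_point_ineq m (a b : R) :
  ((a + b) ^+ m.*2 + (a - b) ^+ m.*2) / 2 <=
  (a ^+ 2 + (m.*2.-1)%:R * b ^+ 2) ^+ m.
Proof.
rewrite !exprDn.
pose F (i : nat) := a ^+ (m.*2 - i) * b ^+ i *+ 'C(m.*2, i).
pose G (i : nat) := a ^+ (m.*2 - i) * (- b) ^+ i *+ 'C(m.*2, i).
rewrite (sum_even_odd m F) (sum_even_odd m G).
have -> : \sum_(j < m.+1) G j.*2 = \sum_(j < m.+1) F j.*2.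
  by apply: eq_bigr => j _; rewrite /G /F exprNn -signr_odd odd_double mul1r.
have -> : \sum_(j < m) G j.*2.+1 = - \sum_(j < m) F j.*2.+1.
  rewrite -sumrN; apply: eq_bigr => j _; rewrite /G /F exprNn -signr_odd /=.
  by rewrite odd_double/= expr1 mulN1r mulrN mulNrn.
rewrite addrACA subrr addr0 -mulr2n -[X in X / 2]mulr_natr mulfK ?pnatr_eq0//.
apply: ler_sum => -[j /= jm] _.
set A2 := a ^+ 2; set B2 := b ^+ 2.
have -> : F j.*2 = 'C(m.*2, j.*2)%:R * (A2 ^+ (m - j) * B2 ^+ j).
  by rewrite /F -doubleB -!mul2n !exprM mulr_natl.
have -> : A2 ^+ (m - j) * (m.*2.-1%:R * B2) ^+ j *+ 'C(m, j) =
    ('C(m, j) * m.*2.-1 ^ j)%:R * (A2 ^+ (m - j) * B2 ^+ j).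
  by rewrite [(_%:R * _) ^+ j]exprMn -mulr_natl natrM natrX -mulrA [X in _ * X = _]mulrCA.
apply: ler_wpM2r; last by rewrite ler_nat bin_double_le.
by apply: mulr_ge0; apply: exprn_ge0; apply: sqr_ge0.
Qed.

(** By induction: the two sides of the step differ by
    t (1 - t) (x - y) (x ^+ m - y ^+ m), a product of factors of one sign. *)
Lemma convex_expn m (t x y : R) : 0 <= t <= 1 -> 0 <= x -> 0 <= y ->
  (t * x + (1 - t) * y) ^+ m <= t * x ^+ m + (1 - t) * y ^+ m.
Proof.
move=> /andP[t0 t1] x0 y0; have s0 : 0 <= 1 - t by rewrite subr_ge0.
elim: m => [|m IHm]; first by rewrite !expr0; lra.
rewrite exprS; apply: (@le_trans _ _
  ((t * x + (1 - t) * y) * (t * x ^+ m + (1 - t) * y ^+ m))).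
  by rewrite ler_wpM2l// addr_ge0// mulr_ge0.
rewrite !exprS -subr_ge0.
have -> : t * (x * x ^+ m) + (1 - t) * (y * y ^+ m) -
  (t * x + (1 - t) * y) * (t * x ^+ m + (1 - t) * y ^+ m) =
  t * (1 - t) * ((x - y) * (x ^+ m - y ^+ m)) by ring.
apply: mulr_ge0; first exact: mulr_ge0.
have [xy|/ltW yx] := leP x y.
  by rewrite mulr_le0// subr_le0// lerXn2r ?nnegrE.
by rewrite mulr_ge0// subr_ge0// lerXn2r ?nnegrE.
Qed.

Definition avg (T : finType) (f : T -> R) : R := (\sum_x f x) / #|T|%:R.

Lemma avgD (T : finType) (f g : T -> R) :
  avg (fun x => f x + g x) = avg f + avg g.
Proof. by rewrite /avg big_split mulrDl. Qed.

Lemma avgZ (T : finType) c (f : T -> R) : avg (fun x => c * f x) = c * avg f.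
Proof. by rewrite /avg -mulr_sumr mulrA. Qed.

Lemma avg_sum (T : finType) (I : Type) (r : seq I) (Pr : pred I) (f : I -> T -> R) :
  avg (fun x => \sum_(i <- r | Pr i) f i x) = \sum_(i <- r | Pr i) avg (f i).
Proof. by rewrite /avg exchange_big mulr_suml. Qed.

Lemma eq_avg (T : finType) (f g : T -> R) : f =1 g -> avg f = avg g.
Proof. by move=> fg; rewrite /avg (eq_bigr _ (fun x _ => fg x)). Qed.

Lemma avg_ge0 (T : finType) (f : T -> R) : (forall x, 0 <= f x) -> 0 <= avg f.
Proof. by move=> f0; rewrite divr_ge0// sumr_ge0. Qed.

Lemma ler_avg (T : finType) (f g : T -> R) :
  (forall x, f x <= g x) -> avg f <= avg g.
Proof. by move=> fg; rewrite ler_wpM2r ?invr_ge0// ler_sum. Qed.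

Lemma avg_cst (T : finType) (x0 : T) c : avg (fun _ : T => c) = c.
Proof.
by rewrite /avg sumr_const -[c *+ _]mulr_natr mulfK// pnatr_eq0 -lt0n; apply/card_gt0P; exists x0.
Qed.

Lemma avg_reindex (T : finType) (h : T -> T) (f : T -> R) :
  injective h -> avg (f \o h) = avg f.
Proof. by move=> hi; rewrite /avg [in RHS](reindex_inj hi). Qed.

(** The triangle inequality of L^(m+1), from the convexity of the power
    function applied to F / al and H / be with weights al and be. *)
Lemma avg_minkowski (T : finType) m (F H : T -> R) (al be : R) :
  (forall x, 0 <= F x) -> (forall x, 0 <= H x) -> 0 <= al -> 0 <= be ->
  avg (fun x => F x ^+ m.+1) <= al ^+ m.+1 ->
  avg (fun x => H x ^+ m.+1) <= be ^+ m.+1 ->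
  avg (fun x => (F x + H x) ^+ m.+1) <= (al + be) ^+ m.+1.
Proof.
move=> F0 H0.
have zero (G : T -> R) : (forall x, 0 <= G x) ->
    avg (fun x => G x ^+ m.+1) <= 0 ^+ m.+1 -> forall x, G x = 0.
  move=> G0; rewrite expr0n /= => Gle x.
  have c0 : 0 < #|T|%:R :> R by rewrite ltr0n; apply/card_gt0P; exists x.
  have /eqP : \sum_x G x ^+ m.+1 = 0.
    apply/eqP; rewrite eq_le sumr_ge0 ?andbT => [|y _]; last exact: exprn_ge0.
    by rewrite -(pmulr_lle0 _ (x := #|T|%:R^-1)) ?invr_gt0// mulrC.
  rewrite psumr_eq0 => [|y _]; last exact: exprn_ge0.
  by move=> /allP /(_ x (mem_index_enum x)) /= /eqP /eqP; rewrite expf_eq0 /= => /eqP.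
rewrite le_eqVlt => /predU1P[<- be0 Fa Ha|al0].
  by rewrite add0r; under eq_avg => x do rewrite (zero _ F0 Fa) add0r.
rewrite le_eqVlt => /predU1P[<- Fa Ha|be0 Fa Ha].
  by rewrite addr0; under eq_avg => x do rewrite (zero _ H0 Ha) addr0.
have ab0 : 0 < al + be by rewrite addr_gt0.
pose t := al / (al + be).
have t01 : 0 <= t <= 1.
  apply/andP; split; first by apply: divr_ge0; apply: ltW.
  by rewrite ler_pdivrMr// mul1r lerDl ltW.
have t1 : 1 - t = be / (al + be) by rewrite /t; field; rewrite gt_eqF.
apply: (@le_trans _ _ (avg (fun x => (al + be) ^+ m.+1 *
   (t * (F x / al) ^+ m.+1 + (1 - t) * (H x / be) ^+ m.+1)))).
  apply: ler_avg => x.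
  have -> : F x + H x = (al + be) * (t * (F x / al) + (1 - t) * (H x / be)).
    by rewrite t1 /t; field; rewrite !gt_eqF.
  rewrite exprMn ler_wpM2l ?exprn_ge0 ?(ltW ab0)//.
  by apply: convex_expn => //; rewrite divr_ge0// ltW.
rewrite avgZ -[leRHS]mulr1 ler_wpM2l ?exprn_ge0 ?(ltW ab0)//.
rewrite avgD !avgZ.
have scale (G : T -> R) c : 0 < c -> avg (fun x => G x ^+ m.+1) <= c ^+ m.+1 ->
    avg (fun x => (G x / c) ^+ m.+1) <= 1.
  move=> c0 Gc; under eq_avg => x do rewrite expr_div_n mulrC.
  by rewrite avgZ mulrC ler_pdivrMr ?exprn_gt0// mul1r.
have := scale _ _ al0 Fa; have := scale _ _ be0 Ha.
have [t0 t1'] := andP t01.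
have : 0 <= 1 - t by rewrite subr_ge0.
nra.
Qed.

Lemma expn_tangent n (x y : R) : 0 <= x -> 0 <= y ->
  y ^+ n.+1 + n.+1%:R * y ^+ n * (x - y) <= x ^+ n.+1.
Proof.
move=> x0 y0; elim: n => [|n IHn]; first by rewrite !expr1 expr0; lra.
rewrite [leRHS]exprS; apply: le_trans (ler_wpM2l x0 IHn).
rewrite -subr_ge0 (_ : _ - _ = n.+1%:R * y ^+ n * (x - y) ^+ 2).
  by rewrite mulr_ge0 ?sqr_ge0// mulr_ge0// exprn_ge0.
rewrite !exprS -[n.+2%:R]natr1; move: (y ^+ n) (n.+1%:R : R) => z c; ring.
Qed.

(** Jensen's inequality for the power n + 1 and the average over the set c:
    the power function lies above its tangent at the conditional mean. *)
Lemma avg_power_mean (T : finType) n (c : pred T) (G : T -> R) :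
  `|avg (fun x => (c x)%:R * G x)| ^+ n.+1 <=
  avg (fun x => (c x)%:R) ^+ n * avg (fun x => `|G x| ^+ n.+1).
Proof.
set p := avg (fun x => (c x)%:R : R).
have p0 : 0 <= p by apply: avg_ge0 => x; rewrite ler0n.
apply: (@le_trans _ _ (avg (fun x => (c x)%:R * `|G x|) ^+ n.+1)).
  rewrite lerXn2r ?nnegrE ?normr_ge0//.
    by apply: avg_ge0 => x; rewrite mulr_ge0.
  rewrite /avg normrM [`|_^-1|]ger0_norm// ler_wpM2r ?invr_ge0//.
  apply: le_trans (ler_norm_sum _ _ _) _; apply: ler_sum => x _.
  by rewrite normrM [`|_%:R|]ger0_norm.
set s := avg (fun x => _ * `|G x|).
have s0 : 0 <= s by apply: avg_ge0 => x; rewrite mulr_ge0.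
have [p_eq0|p_neq0] := eqVneq p 0.
  suff -> : s = 0 by rewrite expr0n /= mulr_ge0 ?exprn_ge0// avg_ge0// => x; rewrite exprn_ge0.
  have [x0 _|T0] := pickP T; last by rewrite /s /avg big1 ?mul0r// => x; have := T0 x.
  move/eqP: p_eq0; rewrite /p /avg mulf_eq0 invr_eq0 pnatr_eq0.
  rewrite [_ == 0 :> nat]negbTE ?orbF; last by rewrite -lt0n; apply/card_gt0P; exists x0.
  rewrite psumr_eq0 => [/allP h|x _]; last by rewrite ler0n.
  rewrite /s /avg big1 ?mul0r// => x _.
  by have := h x (mem_index_enum x) => /= /eqP ->; rewrite mul0r.
have {p_neq0} p0' : 0 < p by rewrite lt_neqAle eq_sym p_neq0.
pose y := s / p.
have y0 : 0 <= y by rewrite divr_ge0.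
have sy : s = p * y by rewrite /y mulrC divfK// gt_eqF.
have h : p * y ^+ n.+1 <= avg (fun x => `|G x| ^+ n.+1).
  apply: (@le_trans _ _ (avg (fun x => (c x)%:R * (y ^+ n.+1 + n.+1%:R * y ^+ n * (`|G x| - y))))).
    under eq_avg => x.
      rewrite (_ : _ * _ = (y ^+ n.+1 - n.+1%:R * y ^+ n * y) * (c x)%:R +
         n.+1%:R * y ^+ n * ((c x)%:R * `|G x|)); last by ring.
      over.
    rewrite avgD !avgZ -/p -/s sy exprS.
    by rewrite le_eqVlt; apply/orP; left; apply/eqP; ring.
  apply: ler_avg => x; case: (c x); rewrite ?mul1r ?mul0r ?exprn_ge0//.
  exact: expn_tangent.
rewrite sy exprMn exprSr -mulrA; exact: (ler_wpM2l (exprn_ge0 _ p0) h).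
Qed.

Definition sg (b : bool) : R := (-1) ^+ b.

(** Walsh characters of the cube: [true] stands for the sign -1. *)
Definition chi (J : finType) (A : {set J}) (x : {ffun J -> bool}) : R :=
  \prod_(j in A) sg (x j).

Definition flip (J : finType) (u : J) (x : {ffun J -> bool}) : {ffun J -> bool} :=
  [ffun j => x j (+) (j == u)].

Lemma sg_sqr (b : bool) : sg b ^+ 2 = 1.
Proof. by rewrite /sg sqrr_sign. Qed.

Lemma chi_sqr (J : finType) (A : {set J}) x : chi A x ^+ 2 = 1.
Proof. by rewrite /chi -prodrXl big1// => j _; exact: sg_sqr. Qed.

Lemma flipK (J : finType) (u : J) : involutive (flip u).
Proof. by move=> x; apply/ffunP => j; rewrite !ffunE addbK. Qed.

Lemma chi_flip (J : finType) (u : J) (A : {set J}) x :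
  chi A (flip u x) = sg (u \in A) * chi A x.
Proof.
have notu (B : {set J}) : u \notin B -> chi B (flip u x) = chi B x.
  move=> uB; apply: eq_bigr => j jB; rewrite ffunE.
  by case: eqP jB uB => [->->//|_ _ _]; rewrite addbF.
case: (boolP (u \in A)) => uA; last by rewrite notu// /sg expr0 mul1r.
rewrite /chi (big_setD1 u)//= [in RHS](big_setD1 u)//= ffunE eqxx.
by rewrite -/(chi _ _) notu ?setD11// addbT mulrA /sg signrN expr1 mulN1r.
Qed.

Lemma chi_orthonormal (J : finType) (A B : {set J}) :
  avg (fun x => chi A x * chi B x) = (A == B)%:R.
Proof.
have [->|AB] := eqVneq A B.
  under eq_avg => x.
    rewrite -expr2 chi_sqr; over.
  by rewrite (avg_cst [ffun=> false]).
have [u hu] : exists u, (u \in A) != (u \in B).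
  apply/existsP; apply: contraR AB; rewrite negb_exists => /forallP h.
  by apply/eqP/setP => u; apply/eqP; have := h u; rewrite negbK.
have : avg (fun x => chi A x * chi B x) = - avg (fun x => chi A x * chi B x).
  rewrite -{1}(avg_reindex _ (inv_inj (@flipK J u))) -mulN1r -avgZ.
  apply: eq_avg => x /=; rewrite !chi_flip /sg.
  by case: (u \in A) (u \in B) hu => -[]//= _; rewrite !expr1 !expr0; ring.
by move/eqP; rewrite -subr_eq0 opprK -mulr2n mulrn_eq0 => /orP[//|/eqP].
Qed.

Lemma sum_subset_split (J : finType) (u : J) (U : {set J}) (F : {set J} -> R) :
  u \in U ->
  \sum_(A : {set J} | A \subset U) F A =
  \sum_(A : {set J} | A \subset U :\ u) (F A + F (u |: A)).
Proof.
move=> uU; rewrite big_split /= (bigID (fun A : {set J} => u \in A)) /= addrC.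
congr (_ + _); first by apply: eq_bigl => A; rewrite subsetD1.
rewrite (reindex_onto (fun A => u |: A) (fun A => A :\ u)); last first.
  by move=> A /andP[_ uA]; rewrite finset.setD1K.
apply: eq_bigl => A; rewrite subsetD1 setU11 andbT finset.subUset finset.sub1set uU /=.
congr (_ && _); apply/eqP/idP => [<-|uA]; first by rewrite setD11.
by rewrite finset.setU1K.
Qed.

(** Hypercontractivity for an even exponent.  Splitting off one coordinate u
    writes the polynomial as G0 + x_u G1.  Averaging over x_u alone gives, by
    [two_point_ineq], the (m+1)-st power of G0^2 + K G1^2, and Minkowski's
    inequality reduces to the two polynomials G0 and G1 in one variable less. *)
Lemma bonami (J : finType) m (U : {set J}) (g : {set J} -> R) :
  avg (fun x => (\sum_(A : {set J} | A \subset U) g A * chi A x) ^+ m.+1.*2) <=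
  (\sum_(A : {set J} | A \subset U) g A ^+ 2 * (m.+1.*2.-1)%:R ^+ #|A|) ^+ m.+1.
Proof.
set K : R := _%:R; have K0 : 0 <= K by rewrite ler0n.
have e2 (y : R) : y ^+ m.+1.*2 = (y ^+ 2) ^+ m.+1 by rewrite -exprM mul2n.
elim: {U}#|U| {-2}U (erefl #|U|) g => [|n IHn] U cU g.
  have {cU}-> : U = finset.set0 by apply/eqP; rewrite -cards_eq0 cU.
  under eq_avg => x.
    under eq_bigl do rewrite finset.subset0.
    rewrite big_pred1_eq /chi big_set0 mulr1; over.
  under eq_bigl do rewrite finset.subset0.
  by rewrite big_pred1_eq cards0 expr0 mulr1 (avg_cst [ffun=> false]) e2.
have /card_gt0P[u uU] : (0 < #|U|)%N by rewrite cU.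
have cU' : #|U :\ u| = n by move: cU; rewrite (cardsD1 u U) uU => -[].
pose G0 x := \sum_(A : {set J} | A \subset U :\ u) g A * chi A x.
pose G1 x := \sum_(A : {set J} | A \subset U :\ u) g (u |: A) * chi A x.
have notu (A : {set J}) : A \subset U :\ u -> u \notin A.
  by rewrite subsetD1 => /andP[].
have GE x : \sum_(A : {set J} | A \subset U) g A * chi A x = G0 x + sg (x u) * G1 x.
  rewrite (sum_subset_split _ uU) big_split /=; congr (_ + _).
  rewrite /G1 mulr_sumr; apply: eq_bigr => A /notu uA.
  by rewrite /chi big_setU1//= mulrCA.
have Gf x : G0 (flip u x) = G0 x /\ G1 (flip u x) = G1 x.
  by split; apply: eq_bigr => A /notu /negbTE uA; rewrite chi_flip uA /sg mul1r.
under eq_avg => x do rewrite GE.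
apply: (@le_trans _ _ (avg (fun x => (G0 x ^+ 2 + K * G1 x ^+ 2) ^+ m.+1))).
  set f := fun x => _ ^+ _.
  have -> : avg f = avg (fun x => (f x + f (flip u x)) / 2).
    under [RHS]eq_avg => x do rewrite mulrC.
    rewrite avgZ avgD -[avg (fun x => f (flip u x))](avg_reindex _ (inv_inj (@flipK J u))).
    under [X in _ = _ * (_ + X)]eq_avg => x do rewrite /= flipK.
    by field.
  apply: ler_avg => x; rewrite /f.
  have [-> ->] := Gf x; rewrite ffunE eqxx addbT /sg signrN mulNr.
  apply: le_trans (two_point_ineq _ _ _) _.
  by rewrite exprMn sqrr_sign mul1r.
rewrite (sum_subset_split _ uU) big_split /=.
apply: avg_minkowski.
- by move=> x; rewrite sqr_ge0.
- by move=> x; rewrite mulr_ge0// sqr_ge0.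
- by apply: sumr_ge0 => A _; rewrite mulr_ge0 ?sqr_ge0 ?exprn_ge0.
- by apply: sumr_ge0 => A _; rewrite mulr_ge0 ?sqr_ge0 ?exprn_ge0.
- by under eq_avg => x do rewrite -e2; exact: IHn.
- under eq_avg => x do rewrite exprMn -e2.
  rewrite avgZ; have := IHn _ cU' (fun A => g (u |: A)).
  move=> /(ler_wpM2l (exprn_ge0 m.+1 K0)) /le_trans; apply.
  rewrite -exprMn mulr_sumr le_eqVlt; apply/orP; left; apply/eqP; congr (_ ^+ _).
  by apply: eq_bigr => A /notu uA; rewrite cardsU1 uA add1n [K ^+ _.+1]exprS mulrCA.
Qed.

Lemma cauchy_schwarz_sum (T : finType) (Pr : pred T) (a b : T -> R) :
  (\sum_(i | Pr i) a i * b i) ^+ 2 <=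
  (\sum_(i | Pr i) a i ^+ 2) * (\sum_(i | Pr i) b i ^+ 2).
Proof.
set X := \sum_(i | _) a i ^+ 2; set Y := \sum_(i | _) b i ^+ 2.
set Z := \sum_(i | _) _.
have X0 : 0 <= X by apply: sumr_ge0 => i _; rewrite sqr_ge0.
have Y0 : 0 <= Y by apply: sumr_ge0 => i _; rewrite sqr_ge0.
have key (t : R) : 0 <= X * t ^+ 2 - 2 * t * Z + Y.
  have -> : X * t ^+ 2 - 2 * t * Z + Y = \sum_(i | Pr i) (a i * t - b i) ^+ 2.
    rewrite /X /Z /Y mulr_suml mulr_sumr -sumrB -big_split /=.
    by apply: eq_bigr => i _; ring.
  by apply: sumr_ge0 => i _; rewrite sqr_ge0.
have [X_eq0|Xn0] := eqVneq X 0.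
  rewrite X_eq0 mul0r; have [->|Zn0] := eqVneq Z 0; first by rewrite expr0n.
  have := key (Y / Z); have := key Z.
  rewrite X_eq0 !mul0r !add0r -!mulrA mulVf// mulr1 -expr2; nra.
have Xp : 0 < X by rewrite lt_neqAle eq_sym Xn0.
have := key (Z / X); rewrite -(pmulr_rge0 _ Xp) => h.
rewrite -subr_ge0 (_ : X * Y - Z ^+ 2 = X * (X * (Z / X) ^+ 2 - 2 * (Z / X) * Z + Y))//.
by field.
Qed.

(** * The level inequality *)
Section Level.
Variables (J : finType) (c : pred {ffun J -> bool}) (m : nat).

Definition fcoef (A : {set J}) : R := avg (fun x => (c x)%:R * chi A x).
Definition mass : R := avg (fun x => (c x)%:R).
Let K : R := (m.+1.*2.-1)%:R.
(** Energy of the indicator of c after damping the coefficients of degree i by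
    K^(-i/2), the largest noise for which [bonami] controls the moment of order
    2(m+1). *)
Definition level : R := \sum_(A : {set J}) K^-1 ^+ #|A| * fcoef A ^+ 2.

Lemma mass_ge0 : 0 <= mass.
Proof. by apply: avg_ge0 => x; rewrite ler0n. Qed.

Let K_gt0 : 0 < K. Proof. by rewrite ltr0n doubleS. Qed.

Lemma level_ge0 : 0 <= level.
Proof. by apply: sumr_ge0 => A _; rewrite mulr_ge0 ?sqr_ge0 ?exprn_ge0 ?invr_ge0 ?ler0n. Qed.

(** Duality: level is the average over c of a damped polynomial G, hence is
    at most p^(1 - 1/(2m+2)) times the norm of G of order 2(m+1), and [bonami]
    bounds that norm by the square root of level. *)
Lemma level_le : level ^+ m.+1 <= mass ^+ m.*2.+1.
Proof.
pose G x := \sum_(A : {set J}) K^-1 ^+ #|A| * fcoef A * chi A x.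
have levE : level = avg (fun x => (c x)%:R * G x).
  under eq_avg => x do rewrite mulr_sumr.
  rewrite avg_sum; apply: eq_bigr => A _.
  under eq_avg => x do rewrite mulrCA.
  by rewrite avgZ -mulrA -expr2.
have h := avg_power_mean m.*2.+1 c G.
rewrite -levE -/mass ger0_norm ?level_ge0// -doubleS in h.
have h2 : avg (fun x => `|G x| ^+ m.+1.*2) <= level ^+ m.+1.
  under eq_avg => x do rewrite -mul2n exprM real_normK ?num_real// -exprM mul2n.
  have := bonami m (finset.setT : {set J}) (fun A => K^-1 ^+ #|A| * fcoef A).
  under eq_avg => x do under eq_bigl do rewrite finset.subsetT.
  under [X in _ <= X ^+ _]eq_bigl do rewrite finset.subsetT.
  move/le_trans; apply.
  rewrite le_eqVlt; apply/orP; left; apply/eqP; congr (_ ^+ _).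
  apply: eq_bigr => A _; rewrite exprMn mulrAC -/K; congr (_ * _).
  by rewrite expr2 -mulrA exprVn mulVf ?mulr1// expf_neq0// gt_eqF.
have {h2} := le_trans h (ler_wpM2l (exprn_ge0 m.*2.+1 mass_ge0) h2).
have := level_ge0; rewrite le_eqVlt => /predU1P[<- _|l0].
  by rewrite expr0n exprn_ge0// mass_ge0.
by rewrite -mul2n mulSn mul1n exprD ler_pM2r// exprn_gt0.
Qed.

(** [level_le] reads level <= p^2 p^(-1/(m+1)), and the last factor is at most
    e as soon as p >= exp(-(m+1)). *)
Lemma level_small : expR (- m.+1%:R) <= mass -> level <= expR 1 * mass ^+ 2.
Proof.
move=> hm; have m0 : 0 < mass by apply: lt_le_trans hm; rewrite expR_gt0.
rewrite -(@ler_pXn2r _ m.+1)// ?nnegrE ?level_ge0//; last first.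
  by rewrite mulr_ge0 ?expR_ge0 ?sqr_ge0.
apply: le_trans level_le _.
rewrite [(_ * _) ^+ m.+1]exprMn -expRM_natl mulr1 -exprM.
rewrite mul2n doubleS [mass ^+ _.+2]exprS mulrA; set X := mass ^+ _.
have X0 : 0 <= X by rewrite exprn_ge0// ltW.
rewrite -[leLHS]mul1r ler_wpM2r// -[leLHS](expRxMexpNx_1 m.+1%:R).
by rewrite ler_wpM2l// expR_ge0.
Qed.

End Level.

(** * Divergence of a single message *)

(** The integrand of the divergence of a reference law from another law whose
    density with respect to it is r: nonnegative, and additive over products
    up to a term of mean zero. *)
Definition phi (r : R) : R := r - 1 - ln r.

Lemma ler_expn_tangent_ln (r : R) : 0 < r -> 1 - r^-1 <= ln r.
Proof.
move=> r0; have h : -1 < r^-1 - 1 by rewrite ltrBrDr addrC subrr invr_gt0.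
have := le_ln1Dx h; rewrite addrCA subrr addr0 lnV ?posrE//; lra.
Qed.

(** Quadratic near 1; the logarithmic singularity at 0 is cut off by the lower
    bound on r, at the price of the factor linear in ell. *)
Lemma phi_le_sqr (r ell : R) : 0 <= ell -> expR (- ell) <= r ->
  phi r <= (2 + 4 * ell) * (r - 1) ^+ 2.
Proof.
move=> l0 lr; have r0 : 0 < r by apply: lt_le_trans lr; exact: expR_gt0.
have l1 := ler_expn_tangent_ln r0.
have [r2|r2] := leP 2^-1 r.
  have h : phi r <= (r - 1) ^+ 2 / r.
    rewrite (_ : (r - 1) ^+ 2 / r = r - 1 - (1 - r^-1)); last by field; rewrite gt_eqF.
    by rewrite /phi; lra.
  apply: le_trans h _; rewrite mulrC; apply: ler_wpM2r; first exact: sqr_ge0.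
  have : r^-1 <= 2 by rewrite -[2]invrK lef_pV2 ?posrE ?invr_gt0.
  lra.
have h : - ell <= ln r by rewrite -[leLHS]expRK ler_ln ?posrE ?expR_gt0.
rewrite /phi; have : 4^-1 <= (r - 1) ^+ 2 by nra.
move: (_ ^+ 2) => q hq; nra.
Qed.

Lemma phi_le_lin (r ell : R) : expR (- ell) <= r -> phi r <= r - 1 + ell.
Proof.
move=> lr; have r0 : 0 < r by apply: lt_le_trans lr; exact: expR_gt0.
have h : - ell <= ln r by rewrite -[leLHS]expRK ler_ln ?posrE ?expR_gt0.
rewrite /phi; lra.
Qed.

(** In this section a sample is a vector x of bits indexed by J, of density
    [dens V x] given the parameter V, and [par A] is the set S such that the
    product over A of the signs of the entries is chi_S.  For the tensor model
    J is the set of k-tuples and [par] is [family_parity] below. *)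
Section Cell.
Variables (J I : finType) (sj : J -> {ffun I -> bool} -> bool).
Variables (par : {set J} -> {set I}) (t : J -> R) (tau0 : R) (m D : nat).
Variables (eps0 eps1 ell : R).
Hypothesis hpar : forall (A : {set J}) V, \prod_(j in A) sg (sj j V) = chi (par A) V.
Hypothesis hpar0 : par finset.set0 = finset.set0.
Hypothesis tau0_ge0 : 0 <= tau0.
Hypothesis t_tau0 : forall j, `|t j| <= tau0.
Hypothesis t_le1 : forall j, `|t j| <= 1.
Let K : R := (m.+1.*2.-1)%:R.
Let zeta := K * tau0 ^+ 2.
Hypothesis heps1 : forall S : {set I}, S != finset.set0 ->
  \sum_(A : {set J} | (#|A| <= D)%N && (par A == S)) zeta ^+ #|A| <= eps1.
Hypothesis heps0 :
  \sum_(A : {set J} | ((#|A| <= D)%N && (par A == finset.set0)) && (A != finset.set0))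
     zeta ^+ #|A| <= eps0.
Hypothesis eps1_ge0 : 0 <= eps1.
Hypothesis eps0_small : 16 * expR 1 * eps0 <= 1.
Hypothesis ell_ge0 : 0 <= ell.

Let V_ := {ffun I -> bool}.
Let X_ := {ffun J -> bool}.

Definition dens (V : V_) (x : X_) : R := \prod_j (1 + t j * sg (sj j V) * sg (x j)).
Definition coef_prod (A : {set J}) : R := \prod_(j in A) t j.

Lemma densE V x : dens V x = \sum_(A : {set J}) coef_prod A * chi (par A) V * chi A x.
Proof.
transitivity (\prod_j (t j * sg (sj j V) * sg (x j) + 1)).
  by apply: eq_bigr => j _; rewrite addrC.
rewrite bigA_distr; apply: eq_bigr => A _.
rewrite -big_mkcond /= !big_split /=; congr (_ * _ * _).
exact: hpar.
Qed.

Lemma dens_ge0 V x : 0 <= dens V x.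
Proof.
apply: prodr_ge0 => j _; have /ler_normlP[h1 h2] := t_le1 j.
by rewrite /sg; case: (sj j V); case: (x j); rewrite ?expr1 ?expr0; lra.
Qed.

Lemma avg_chiI (S : {set I}) : avg (chi S) = (S == finset.set0)%:R.
Proof.
rewrite -chi_orthonormal; apply: eq_avg => V.
by rewrite /chi big_set0 mulr1.
Qed.

Lemma parseval (T : finType) (b : {set T} -> R) :
  avg (fun V => (\sum_(S : {set T}) b S * chi S V) ^+ 2) = \sum_(S : {set T}) b S ^+ 2.
Proof.
under eq_avg => V.
  rewrite expr2 mulr_suml.
  under eq_bigr do rewrite mulr_sumr.
  over.
rewrite avg_sum; apply: eq_bigr => S _.
rewrite avg_sum (bigD1 S)//= big1 ?addr0 => [|S' S'S].
  under eq_avg => V do rewrite mulrACA -expr2.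
  by rewrite avgZ chi_orthonormal eqxx mulr1.
under eq_avg => V do rewrite mulrACA.
by rewrite avgZ chi_orthonormal eq_sym (negbTE S'S) mulr0.
Qed.

Section OneCell.
Variable c : pred X_.
Let p := mass c.
Let fc := fcoef c.

(** The probability, given V, that the sample falls in the cell c. *)
Definition cell_mass V : R := avg (fun x => (c x)%:R * dens V x).

Lemma cell_mass_ge0 V : 0 <= cell_mass V.
Proof. by apply: avg_ge0 => x; rewrite mulr_ge0 ?dens_ge0// ler0n. Qed.

(** The expansion [densE] is cut at degree D. *)
Definition low_dens V x : R := \sum_(A : {set J} | (#|A| <= D)%N) coef_prod A * chi (par A) V * chi A x.
Definition high_dens V x : R := \sum_(A : {set J} | ~~ (#|A| <= D)%N) coef_prod A * chi (par A) V * chi A x.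
Definition low_mass V : R := avg (fun x => (c x)%:R * low_dens V x).
Definition high_mass V : R := avg (fun x => (c x)%:R * high_dens V x).

Lemma cell_mass_split V : cell_mass V = low_mass V + high_mass V.
Proof.
rewrite /cell_mass /low_mass /high_mass -avgD; apply: eq_avg => x.
by rewrite densE (bigID (fun A : {set J} => (#|A| <= D)%N)) /= mulrDr.
Qed.

Definition low_coef (S : {set I}) : R :=
  \sum_(A : {set J} | (#|A| <= D)%N && (par A == S)) coef_prod A * fc A.

Lemma low_massE V : low_mass V = \sum_(S : {set I}) low_coef S * chi S V.
Proof.
rewrite /low_mass /low_dens; under eq_avg => x do rewrite mulr_sumr.
rewrite avg_sum (partition_big par xpredT) //=; apply: eq_bigr => S _.
rewrite /low_coef mulr_suml; apply: eq_bigr => A /andP[_ /eqP <-].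
under eq_avg => x do rewrite mulrCA.
by rewrite avgZ /fc /fcoef; ring.
Qed.

Lemma coef_prod_sqr_le (A : {set J}) : K ^+ #|A| * coef_prod A ^+ 2 <= zeta ^+ #|A|.
Proof.
rewrite /zeta exprMn; apply: ler_wpM2l; first by rewrite exprn_ge0// ler0n.
rewrite -exprM -real_normK ?num_real// mulnC exprM ler_pXn2r ?nnegrE ?exprn_ge0//.
rewrite /coef_prod normr_prod -prodr_const; apply: ler_prod => j _.
by rewrite normr_ge0 t_tau0.
Qed.

Lemma K_gt0 : 0 < K. Proof. by rewrite ltr0n doubleS. Qed.

(** Cauchy-Schwarz with the weights that make one factor the noisy energy of
    the cell and the other a count of sets, of weight zeta = K tau0^2 per
    element. *)
Lemma cs_level (Pr : pred {set J}) (e : R) :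
  \sum_(A : {set J} | Pr A) zeta ^+ #|A| <= e ->
  (\sum_(A : {set J} | Pr A) coef_prod A * fc A) ^+ 2 <=
  e * (\sum_(A : {set J} | Pr A) K^-1 ^+ #|A| * fc A ^+ 2).
Proof.
move=> he; pose sK : R := Num.sqrt K.
have sKn (A : {set J}) : sK ^+ #|A| * sK^-1 ^+ #|A| = 1.
  by rewrite -exprMn divff ?expr1n// gt_eqF// sqrtr_gt0 K_gt0.
have sK2 n : (sK ^+ n) ^+ 2 = K ^+ n by rewrite exprAC sqr_sqrtr// ltW// K_gt0.
have sKV2 n : (sK^-1 ^+ n) ^+ 2 = K^-1 ^+ n by rewrite !exprVn sK2.
have -> : \sum_(A : {set J} | Pr A) coef_prod A * fc A =
   \sum_(A : {set J} | Pr A) (sK ^+ #|A| * coef_prod A) * (sK^-1 ^+ #|A| * fc A).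
  by apply: eq_bigr => A _; rewrite mulrACA sKn mul1r.
apply: le_trans (cauchy_schwarz_sum _ _ _) _.
have -> : \sum_(A : {set J} | Pr A) (sK^-1 ^+ #|A| * fc A) ^+ 2 =
   \sum_(A : {set J} | Pr A) K^-1 ^+ #|A| * fc A ^+ 2.
  by apply: eq_bigr => A _; rewrite [LHS]exprMn sKV2.
apply: ler_wpM2r.
  by apply: sumr_ge0 => A _; rewrite mulr_ge0 ?sqr_ge0 ?exprn_ge0 ?invr_ge0 ?ler0n.
apply: le_trans he; apply: ler_sum => A _.
by rewrite [leLHS]exprMn sK2 coef_prod_sqr_le.
Qed.

Lemma level_part (Pr : pred {set J}) :
  \sum_(A : {set J} | Pr A) K^-1 ^+ #|A| * fc A ^+ 2 <= level c m.
Proof.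
rewrite /level [leRHS](bigID Pr) /= lerDl.
by apply: sumr_ge0 => A _; rewrite mulr_ge0 ?sqr_ge0 ?exprn_ge0 ?invr_ge0 ?ler0n.
Qed.

(** Only the empty parity survives averaging over V. *)
Lemma avg_low_mass : avg low_mass = low_coef finset.set0.
Proof.
under eq_avg => V do rewrite low_massE.
rewrite avg_sum (bigD1 finset.set0)//= avgZ avg_chiI eqxx mulr1.
rewrite big1 ?addr0// => S S0; by rewrite avgZ avg_chiI (negbTE S0) mulr0.
Qed.

Lemma var_low_mass : avg (fun V => (low_mass V - low_coef finset.set0) ^+ 2) <= eps1 * level c m.
Proof.
pose b S := if S == finset.set0 then 0 else low_coef S.
have -> : avg (fun V => (low_mass V - low_coef finset.set0) ^+ 2) =
   avg (fun V => (\sum_(S : {set I}) b S * chi S V) ^+ 2).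
  apply: eq_avg => V; congr (_ ^+ 2).
  rewrite low_massE (bigD1 finset.set0)//= [RHS](bigD1 finset.set0)//= /b eqxx mul0r add0r.
  rewrite /chi big_set0 mulr1 addrAC subrr add0r.
  by apply: eq_bigr => S /negbTE ->.
rewrite parseval (bigD1 finset.set0)//= {1}/b eqxx expr0n add0r.
apply: (@le_trans _ _ (\sum_(S : {set I} | S != finset.set0)
  eps1 * \sum_(A : {set J} | (#|A| <= D)%N && (par A == S)) K^-1 ^+ #|A| * fc A ^+ 2)).
  apply: ler_sum => S S0; rewrite /b (negbTE S0).
  exact: (cs_level (heps1 S0)).
rewrite -mulr_sumr; apply: ler_wpM2l; first exact: eps1_ge0.
apply: le_trans (level_part (fun A => (#|A| <= D)%N && (par A != finset.set0))).
rewrite [leRHS](partition_big par (fun S => S != finset.set0)) /=; last by move=> A /andP[].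
apply: ler_sum => S S0; rewrite le_eqVlt; apply/orP; left; apply/eqP.
apply: eq_bigl => A; case: eqP => [->|_]; by rewrite ?S0 ?andbT ?andbF.
Qed.

(** The term A = set0 of the coefficient is the mass p itself; the other sets
    of empty parity are few by the hypothesis on eps0. *)
Lemma low_coef0_bound : (low_coef finset.set0 - p) ^+ 2 <= eps0 * level c m.
Proof.
rewrite /low_coef (bigD1 finset.set0) /=; last by rewrite cards0 hpar0 eqxx.
rewrite /coef_prod big_set0 mul1r {1}/fc /fcoef.
under [X in X + _ - _]eq_avg => x do rewrite /chi big_set0 mulr1.
rewrite -/p [p + _]addrC addrK.
apply: le_trans (cs_level heps0) _; apply: ler_wpM2l; last exact: level_part.
apply: le_trans heps0; apply: sumr_ge0 => A _.
by rewrite exprn_ge0// mulr_ge0 ?ler0n ?sqr_ge0.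
Qed.

(** The square of the high-degree part is kept restricted to the cell, so that
    its sum over the cells of a partition is the global high-degree energy. *)
Definition high_energy := avg (fun V => avg (fun x => (c x)%:R * high_dens V x ^+ 2)).

Lemma high_energy_ge0 : 0 <= high_energy.
Proof. by apply: avg_ge0 => V; apply: avg_ge0 => x; rewrite mulr_ge0 ?sqr_ge0. Qed.

Lemma avg_high_mass_sqr : avg (fun V => high_mass V ^+ 2) <= p * high_energy.
Proof.
rewrite /high_energy -avgZ; apply: ler_avg => V.
have := avg_power_mean 1 c (fun x => (c x)%:R * high_dens V x).
under [X in `|X| ^+ _]eq_avg => x do rewrite mulrA -natrM mulnb andbb.
rewrite -/(high_mass V) real_normK ?num_real// expr1 -/p => /le_trans; apply.
rewrite le_eqVlt; apply/orP; left; apply/eqP; congr (_ * _); apply: eq_avg => x.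
by rewrite real_normK ?num_real// exprMn -natrX; case: (c x).
Qed.

Lemma avg_sqr_le (T : finType) (f : T -> R) : avg f ^+ 2 <= avg (fun x => f x ^+ 2).
Proof.
have := avg_power_mean 1 xpredT f.
rewrite real_normK ?num_real// expr1.
under [X in X ^+ 2]eq_avg => x do rewrite mul1r.
under [X in _ * X]eq_avg => x do rewrite real_normK ?num_real//.
move/le_trans; apply; rewrite -[leRHS]mul1r; apply: ler_wpM2r.
  by apply: avg_ge0 => x; rewrite sqr_ge0.
have [x0 _|T0] := pickP T; first by rewrite (avg_cst x0).
by rewrite /avg big1 ?mul0r// => x; have := T0 x.
Qed.

Let n : R := #|J|%:R.
Definition tiny_mass : R := expR ((n * tau0 ^+ 2 - m.+1%:R) / 2).
Definition mean_mass := avg cell_mass.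

Lemma mean_mass_ge0 : 0 <= mean_mass. Proof. by apply: avg_ge0 => V; exact: cell_mass_ge0. Qed.

Lemma prod_1Dsqr_le a : 0 <= a ->
  \prod_j (1 + a * t j ^+ 2) <= expR (a * (n * tau0 ^+ 2)).
Proof.
move=> a0; apply: (@le_trans _ _ (\prod_(j : J) expR (a * tau0 ^+ 2))).
  apply: ler_prod => j _.
  have -> /= : 0 <= 1 + a * t j ^+ 2 by apply: addr_ge0 => //; apply: mulr_ge0 => //; exact: sqr_ge0.
  apply: le_trans (expR_ge1Dx _); rewrite lerD2l ler_wpM2l//.
  by rewrite -(real_normK (num_real (t j))) ler_pXn2r ?nnegrE.
by rewrite prodr_const -expRM_natl mulrCA.
Qed.

Lemma avg_dens_sqr V : avg (fun x => dens V x ^+ 2) = \prod_j (1 + t j ^+ 2).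
Proof.
transitivity (\sum_(A : {set J}) coef_prod A ^+ 2).
  transitivity (\sum_(A : {set J}) (coef_prod A * chi (par A) V) ^+ 2).
    by rewrite -parseval; apply: eq_avg => x; rewrite densE.
  by apply: eq_bigr => A _; rewrite exprMn chi_sqr mulr1.
transitivity (\prod_j (t j ^+ 2 + 1)); last by apply: eq_bigr => j _; rewrite addrC.
rewrite bigA_distr; apply: eq_bigr => A _.
by rewrite -big_mkcond /= prodrXl.
Qed.

(** Cauchy-Schwarz: a cell of mass p has mean mass at most the square root of
    p times the second moment of the density. *)
Lemma mean_mass_small : p <= expR (- m.+1%:R) -> mean_mass <= tiny_mass.
Proof.
move=> pm; rewrite -(@ler_pXn2r _ 2)// ?nnegrE ?mean_mass_ge0 ?expR_ge0//.
apply: le_trans (avg_sqr_le _) _.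
rewrite -expRM_natl mulrC divfK ?pnatr_eq0// addrC expRD.
apply: (@le_trans _ _ (avg (fun _ : V_ => p * expR (n * tau0 ^+ 2)))); last first.
  rewrite (avg_cst [ffun=> false]).
  by rewrite ler_wpM2r ?expR_ge0.
apply: ler_avg => V.
have := avg_power_mean 1 c (dens V).
rewrite real_normK ?num_real// expr1 => /le_trans; apply.
rewrite ler_wpM2l ?mass_ge0//.
under eq_avg => x do rewrite real_normK ?num_real//.
rewrite avg_dens_sqr -[X in expR X]mul1r.
by apply: le_trans (prod_1Dsqr_le ler01); apply: ler_prod => j _; rewrite mul1r addr_ge0 ?sqr_ge0 ?lexx.
Qed.

Let del := expR (- ell).
(** The likelihood ratio of the cell after mixing the law given V with a
    fraction exp(-ell) of the averaged law, which keeps phi bounded. *)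
Definition smoothed_ratio V := (1 - del) * (cell_mass V / mean_mass) + del.
Definition phi_const : R := 2 + 4 * ell.

Let del01 : 0 < del <= 1.
Proof. by rewrite expR_gt0 expR_le1 oppr_le0. Qed.

Lemma smoothed_ratio_ge V : del <= smoothed_ratio V.
Proof.
have /andP[d0 d1] := del01.
by rewrite /smoothed_ratio lerDr mulr_ge0 ?subr_ge0// divr_ge0 ?cell_mass_ge0 ?mean_mass_ge0.
Qed.

Lemma avg_smoothed_ratio : 0 < mean_mass -> avg smoothed_ratio = 1.
Proof.
move=> Q0; rewrite /smoothed_ratio avgD avgZ (avg_cst [ffun=> false]).
under [X in _ * X]eq_avg => V do rewrite mulrC.
by rewrite avgZ -/mean_mass mulVf ?gt_eqF// mulr1 subrK.
Qed.

Lemma cell_lin : avg (fun V => mean_mass * phi (smoothed_ratio V)) <= mean_mass * ell.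
Proof.
have := mean_mass_ge0; rewrite le_eqVlt => /predU1P[<-|Q0].
  by rewrite mul0r; under eq_avg => V do rewrite mul0r; rewrite (avg_cst [ffun=> false]).
rewrite avgZ ler_wpM2l ?(ltW Q0)//.
apply: (@le_trans _ _ (avg (fun V => smoothed_ratio V + (ell - 1)))).
  by apply: ler_avg => V; apply: le_trans (phi_le_lin (smoothed_ratio_ge V)) _; rewrite addrA addrAC.
by rewrite avgD avg_smoothed_ratio// (avg_cst [ffun=> false]); lra.
Qed.

Lemma cell_sqr : 0 < mean_mass -> avg (fun V => mean_mass * phi (smoothed_ratio V)) <=
  phi_const * (avg (fun V => (cell_mass V - mean_mass) ^+ 2) / mean_mass).
Proof.
move=> Q0; rewrite [_ / mean_mass]mulrC -avgZ -avgZ; apply: ler_avg => V.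
have /andP[d0 d1] := del01.
have := phi_le_sqr ell_ge0 (smoothed_ratio_ge V); move/(ler_wpM2l (ltW Q0)) => /le_trans; apply.
rewrite mulrCA ler_wpM2l//; first by rewrite addr_ge0// mulr_ge0.
have -> : smoothed_ratio V - 1 = (1 - del) * ((cell_mass V - mean_mass) / mean_mass).
  by rewrite /smoothed_ratio; field; rewrite gt_eqF.
rewrite exprMn [((_ - _) / _) ^+ 2]exprMn.
rewrite (_ : mean_mass * _ = (1 - del) ^+ 2 * (mean_mass^-1 * (cell_mass V - mean_mass) ^+ 2)); last by field; rewrite gt_eqF.
rewrite ler_piMl//; first by apply: mulr_ge0; [rewrite invr_ge0 ltW|exact: sqr_ge0].
by rewrite expr_le1// ?subr_ge0// gerBl ltW.
Qed.

Lemma cell_mass_var : avg (fun V => (cell_mass V - mean_mass) ^+ 2) <=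
  2 * avg (fun V => (low_mass V - low_coef finset.set0) ^+ 2) + 2 * avg (fun V => high_mass V ^+ 2).
Proof.
apply: (@le_trans _ _ (avg (fun V => (cell_mass V - low_coef finset.set0) ^+ 2))).
  have -> : avg (fun V => (cell_mass V - low_coef finset.set0) ^+ 2) =
    avg (fun V => (cell_mass V - mean_mass) ^+ 2 + (2 * (mean_mass - low_coef finset.set0) * (cell_mass V - mean_mass) + (mean_mass - low_coef finset.set0) ^+ 2)).
    by apply: eq_avg => V; ring.
  rewrite avgD lerDl avgD avgZ avgD !(avg_cst [ffun=> false]) -/mean_mass subrr mulr0 add0r.
  exact: sqr_ge0.
rewrite -!avgZ -avgD; apply: ler_avg => V; rewrite cell_mass_split.
rewrite -subr_ge0 (_ : _ - _ = (low_mass V - low_coef finset.set0 - high_mass V) ^+ 2) ?sqr_ge0//.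
by ring.
Qed.

(** Three cases.  If p < exp(-(m+1)) then even the mean mass is tiny, and the
    linear bound on phi is enough.  Otherwise [level_small] makes the low-degree
    coefficient of the empty parity at least 3p/4.  If the mean mass is at least
    p/2, phi is bounded by its quadratic upper bound, that is by a chi-squared
    distance, split into low and high degrees.  If the mean mass is below p/2,
    the high-degree part must have mean below -p/4, so that p is itself bounded
    by the high-degree energy. *)
Lemma cell_bound : avg (fun V => mean_mass * phi (smoothed_ratio V)) <=
  phi_const * (4 * expR 1 * eps1 * p + 8 * high_energy + tiny_mass).
Proof.
have Kp : 0 <= phi_const by rewrite addr_ge0// mulr_ge0.
have lK : ell <= phi_const by rewrite /phi_const; have := ell_ge0; lra.
have p0 : 0 <= p := mass_ge0 _.
have hh0 := high_energy_ge0; have q00 : 0 <= tiny_mass := expR_ge0 _.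
have e0 : 0 <= 4 * expR 1 * eps1 * p by do 3!apply: mulr_ge0 => //; exact: expR_ge0.
have [pm|pm] := leP p (expR (- m.+1%:R)).
  apply: le_trans cell_lin _; rewrite [leLHS]mulrC.
  apply: ler_pM => //; first exact: mean_mass_ge0.
  apply: le_trans (mean_mass_small pm) _; rewrite lerDr; lra.
have pp : 0 < p by apply: lt_trans pm; exact: expR_gt0.
have hlev := level_small (ltW pm); rewrite -/p in hlev.
have lev0 := level_ge0 c m.
have Qsplit : mean_mass = low_coef finset.set0 + avg high_mass.
  by rewrite -avg_low_mass -avgD; apply: eq_avg => V; rewrite cell_mass_split.
have hf : (avg high_mass) ^+ 2 <= p * high_energy by apply: le_trans (avg_sqr_le _) avg_high_mass_sqr.
have hb : (low_coef finset.set0 - p) ^+ 2 <= (p / 4) ^+ 2.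
  apply: le_trans low_coef0_bound _.
  have he0 : 0 <= eps0.
    apply: le_trans heps0; apply: sumr_ge0 => A _.
    by rewrite exprn_ge0// mulr_ge0 ?ler0n ?sqr_ge0.
  apply: le_trans (ler_wpM2l he0 hlev) _.
  rewrite (_ : (p / 4) ^+ 2 = 16^-1 * p ^+ 2); last by field.
  rewrite mulrA; apply: ler_wpM2r; first exact: sqr_ge0.
  by move: eps0_small; move: (expR 1) => e; rewrite -mulrA [e * _]mulrC; lra.
have hb' : p - p / 4 <= low_coef finset.set0.
  rewrite leNgt; apply/negP => h; move: hb; rewrite leNgt => /negP; apply.
  by move: (low_coef _) h => b h; nra.
have [Qp|Qp] := leP (p / 2) mean_mass.
  have Q0 : 0 < mean_mass by apply: lt_le_trans Qp; rewrite divr_gt0.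
  apply: le_trans (cell_sqr Q0) _; rewrite ler_wpM2l//.
  rewrite ler_pdivrMr//; apply: le_trans cell_mass_var _.
  have v1 := var_low_mass; have v2 := avg_high_mass_sqr.
  set X := avg (fun V => (low_mass V - _) ^+ 2) in v1 *; set Y := avg (fun V => high_mass V ^+ 2) in v2 *.
  have v3 : X <= eps1 * (expR 1 * p ^+ 2).
    by apply: le_trans v1 _; rewrite ler_wpM2l.
  apply: (@le_trans _ _ ((4 * expR 1 * eps1 * p + 8 * high_energy + tiny_mass) * (p / 2))); last first.
    by rewrite ler_wpM2l// !addr_ge0// mulr_ge0.
  have : 0 <= tiny_mass * p by rewrite mulr_ge0.
  have : 0 <= high_energy * p by rewrite mulr_ge0.
  rewrite expr2 in v3.
  nra.
apply: le_trans cell_lin _; rewrite [leLHS]mulrC.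
apply: ler_pM => //; first exact: mean_mass_ge0.
have h1 : p / 4 < - avg high_mass by rewrite Qsplit in Qp; lra.
have h2 : (p / 4) ^+ 2 <= p * high_energy.
  apply: le_trans hf; rewrite -[(avg high_mass) ^+ 2]sqrrN expr2 [leRHS]expr2.
  have p40 : 0 <= p / 4 by apply: divr_ge0.
  by apply: ler_pM => //; exact: ltW.
have h3 : p <= 16 * high_energy.
  rewrite -(ler_pM2l pp).
  have : p * p = 16 * (p / 4) ^+ 2 by field.
  by move=> ->; rewrite [leRHS]mulrCA; apply: ler_wpM2l.
lra.
Qed.

End OneCell.

Let n : R := #|J|%:R.

Lemma sum_key (Kt : finType) (key : X_ -> Kt) (G : X_ -> R) :
  \sum_k avg (fun x => (key x == k)%:R * G x) = avg G.
Proof.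
rewrite -avg_sum; apply: eq_avg => x; rewrite -mulr_suml (bigD1 (key x))//= eqxx.
by rewrite big1 ?addr0 ?mul1r// => k /negbTE; rewrite eq_sym => ->.
Qed.

(** Parseval, and 1 <= 2^(#|A| - D) for the sets of more than D elements. *)
Lemma high_dens_bound V : avg (fun x => high_dens V x ^+ 2) <= 2^-1 ^+ D * expR (2 * (n * tau0 ^+ 2)).
Proof.
pose b (A : {set J}) := if ~~ (#|A| <= D)%N then coef_prod A * chi (par A) V else 0.
have -> : avg (fun x => high_dens V x ^+ 2) = \sum_(A : {set J}) b A ^+ 2.
  rewrite -parseval; apply: eq_avg => x; rewrite /high_dens big_mkcond; congr (_ ^+ 2).
  by apply: eq_bigr => A _; rewrite /b; case: ifP => //; rewrite mul0r.
apply: (@le_trans _ _ (\sum_(A : {set J}) 2^-1 ^+ D * (2 ^+ #|A| * coef_prod A ^+ 2))).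
  apply: ler_sum => A _; rewrite /b; case: ifPn => [AD|_]; last first.
    rewrite expr0n /=; apply: mulr_ge0; first by rewrite exprn_ge0.
    by apply: mulr_ge0; [rewrite exprn_ge0|exact: sqr_ge0].
  rewrite exprMn chi_sqr mulr1 mulrA -[leLHS]mul1r; apply: ler_wpM2r; first exact: sqr_ge0.
  rewrite exprVn mulrC ler_pdivlMr ?exprn_gt0// mul1r ler_eXn2l ?ltr1n//.
  by rewrite ltnW// ltnNge.
rewrite -mulr_sumr; apply: ler_wpM2l; first by rewrite exprn_ge0.
apply: le_trans (prod_1Dsqr_le _) => //.
rewrite le_eqVlt; apply/orP; left; apply/eqP.
transitivity (\prod_j (2 * t j ^+ 2 + 1)); last by apply: eq_bigr => j _; rewrite addrC.
rewrite bigA_distr; apply: eq_bigr => A _.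
by rewrite -big_mkcond /= big_split /= prodr_const prodrXl.
Qed.

(** Summing [cell_bound] over the cells of a message: the masses p add up to 1,
    the high-degree energies to the global one, and only the contribution of
    the tiny cells pays for the size of the alphabet. *)
Lemma cells_bound (Kt : finType) (key : X_ -> Kt) :
  \sum_k avg (fun V => mean_mass (fun x => key x == k) * phi (smoothed_ratio (fun x => key x == k) V)) <=
  phi_const * (4 * expR 1 * eps1 + 8 * (2^-1 ^+ D * expR (2 * (n * tau0 ^+ 2))) + #|Kt|%:R * tiny_mass).
Proof.
apply: le_trans (ler_sum _ (fun k _ => cell_bound (fun x => key x == k))) _.
rewrite -mulr_sumr; apply: ler_wpM2l; first by rewrite addr_ge0// mulr_ge0.
rewrite !big_split /= -!mulr_sumr sumr_const -[tiny_mass *+ _]mulr_natl.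
apply: lerD => //; apply: lerD.
  have -> : \sum_k mass (fun x => key x == k) = 1.
    rewrite -(avg_cst ([ffun=> false] : X_) 1) -(sum_key key).
    by apply: eq_bigr => k _; apply: eq_avg => x; rewrite mulr1.
  by rewrite mulr1.
apply: ler_wpM2l => //.
rewrite /high_energy -avg_sum.
apply: (@le_trans _ _ (avg (fun V : V_ => 2^-1 ^+ D * expR (2 * (n * tau0 ^+ 2))))); last first.
  by rewrite (avg_cst [ffun=> false]).
apply: ler_avg => V; rewrite (sum_key key); exact: high_dens_bound.
Qed.

End Cell.

(** * Parities of words and of families of tuples *)

Section Words.
Variable (I : finType).
Implicit Types (a : I) (w : seq I) (S : {set I}).

Definition parity w : {set I} := [set l | odd (count_mem l w)].

Lemma parity_cons a w : parity (a :: w) = if a \in parity w then parity w :\ a else a |: parity w.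
Proof.
apply/setP => l; rewrite [LHS]inE /= oddD oddb.
case: ifPn; rewrite inE => ha; rewrite !inE eq_sym; case: eqP => [->|_] //=.
by rewrite ha.
Qed.

Definition toggle a S := if a \in S then S :\ a else a |: S.

Lemma toggleK a : involutive (toggle a).
Proof.
move=> S; rewrite /toggle; case: (boolP (a \in S)) => ha; rewrite !inE eqxx /=.
  exact: finset.setD1K.
exact: finset.setU1K.
Qed.

Lemma parity_cons_eq a w S : (parity (a :: w) == S) = (parity w == toggle a S).
Proof. by rewrite parity_cons -/(toggle a _) (can2_eq (toggleK a) (toggleK a)). Qed.

Lemma chi_parity w (V : {ffun I -> bool}) : chi (parity w) V = \prod_(l <- w) sg (V l).
Proof.
elim: w => [|a w IHw].
  by rewrite big_nil /chi big1// => l; rewrite inE.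
rewrite big_cons -IHw parity_cons; case: ifPn => ha.
  by rewrite [in RHS]/chi (big_setD1 a ha) /= mulrA -expr2 sg_sqr mul1r.
by rewrite /chi big_setU1.
Qed.

Lemma parity_size w : (#|parity w| <= size w)%N /\ odd #|parity w| = odd (size w).
Proof.
elim: w => [|a w [IH1 IH2]].
  by rewrite (_ : parity [::] = finset.set0) ?cards0//; apply/setP => l; rewrite !inE.
rewrite parity_cons /= -IH2; case: ifPn => ha.
  move: IH1 IH2; rewrite (cardsD1 a (parity w)) ha /= add1n => IH1 _; split; first lia.
  by rewrite /= negbK.
by rewrite cardsU1 ha /= add1n.
Qed.

Fixpoint words n : seq (seq I) :=
  if n is n'.+1 then flatten [seq [seq a :: w | w <- words n'] | a <- enum I] else [:: [::]].

Lemma mem_words n w : (w \in words n) = (size w == n).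
Proof.
elim: n w => [|n IHn] [|a w] //=.
  by apply/negbTE/negP => /flattenP[s /mapP[b _ ->] /mapP[]].
apply/flattenP/idP => [[s /mapP[b _ ->] /mapP[w' hw' [_ ->]]]|hw].
  by rewrite eqSS -IHn.
exists [seq a :: w | w <- words n]; first by apply/mapP; exists a; rewrite ?mem_enum.
by apply/mapP; exists w; rewrite ?IHn.
Qed.

Definition word_count n S := count (fun w => parity w == S) (words n).

Lemma word_countS n S : word_count n.+1 S = (\sum_(a : I) word_count n (toggle a S))%N.
Proof.
rewrite /word_count /= count_flatten sumnE 2!big_map big_enum /=.
apply: eq_bigr => a _; rewrite count_map; apply: eq_count => w /=.
exact: parity_cons_eq.
Qed.

(** A letter a toggles the membership of a.  The set S arises from S minus a for
    the at most n + 1 elements a of S, and from S with a added for at most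
    |I| = y^2 elements a.  Weighted by y^|S|, the former cost a factor y each
    and the latter 1/y each, so one more letter costs at most (n + 2) y. *)
Lemma word_count_le (y : R) (A0 n : nat) S : 0 < y -> y ^+ 2 = #|I|%:R -> (n < A0)%N ->
  (word_count n S)%:R * y ^+ #|S| <= A0%:R ^+ n * y ^+ n.
Proof.
move=> y0 yd; elim: n S => [|n IHn] S nA.
  rewrite /word_count /= addn0 !expr0 mulr1.
  have -> : parity [::] = finset.set0 by apply/setP => l; rewrite !inE.
  case: eqP => [<-|_]; last by rewrite mul0r.
  by rewrite cards0 expr0 mulr1.
have [Sn|nS] := leqP #|S| n.+1; last first.
  rewrite (_ : word_count n.+1 S = 0%N) ?mul0r ?mulr_ge0 ?exprn_ge0 ?(ltW y0)//.
  apply/eqP; rewrite -leqn0 leqNgt -has_count; apply/hasPn => w.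
  rewrite mem_words => /eqP sw; apply/negP => /eqP prod_law.
  by have [] := parity_size w; rewrite prod_law sw leqNgt nS.
have {}IHn S' := IHn S' (ltnW nA).
set B := A0%:R ^+ n * y ^+ n in IHn *.
have B0 : 0 <= B by rewrite mulr_ge0 ?exprn_ge0 ?(ltW y0).
have yn0 : y != 0 by rewrite gt_eqF.
rewrite word_countS natr_sum mulr_suml (bigID (fun a => a \in S)) /=.
apply: (@le_trans _ _ (\sum_(a | a \in S) B * y + \sum_(a | a \notin S) B / y)).
  apply: lerD; apply: ler_sum => a aS.
    rewrite /toggle aS (cardsD1 a S) aS add1n exprSr mulrA ler_pM2r//; exact: IHn.
  rewrite /toggle (negbTE aS) ler_pdivlMr// -mulrA -exprSr.
  by have := IHn (a |: S); rewrite cardsU1 aS add1n.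
rewrite !sumr_const.
apply: (@le_trans _ _ (B * y *+ #|S| + B * y)).
  rewrite lerD2l.
  apply: (@le_trans _ _ (B / y *+ #|I|)).
    rewrite -[leLHS]mulr_natr -[leRHS]mulr_natr; apply: ler_wpM2l; last by rewrite ler_nat max_card.
    by rewrite divr_ge0// ltW.
  by rewrite -[_ *+ _]mulr_natr -yd expr2 -mulrA mulKf.
rewrite -mulrSr -[leLHS]mulr_natl.
have -> : A0%:R ^+ n.+1 * y ^+ n.+1 = A0%:R * (B * y).
  by rewrite /B; move: (A0%:R : R) => z; rewrite !exprSr; ring.
apply: ler_wpM2r; first by rewrite mulr_ge0// ltW.
by rewrite ler_nat; lia.
Qed.

End Words.

Section TuplePar.
Variables (k d : nat).
Let J := (k.-tuple 'I_d : finType).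

(** The bit of the sign prod_l V_(j_l) of the entry j of the signal. *)
Definition tuple_parity (j : J) (V : {ffun 'I_d -> bool}) : bool := \big[addb/false]_(l <- j) V l.
(** The concatenation of the tuples of A, in the order of the enumeration; the
    parity of A is that of this word, and distinct families have distinct words
    because all tuples have the same positive length. *)
Definition family_word (A : {set J}) : seq 'I_d := flatten [seq tval j | j <- enum A].
Definition family_parity (A : {set J}) : {set 'I_d} := parity (family_word A).

Lemma sg_tuple_parity j V : sg (tuple_parity j V) = \prod_(l <- j) sg (V l).
Proof.
rewrite /tuple_parity; elim: (tval j) => [|a w IHw]; first by rewrite !big_nil /sg expr0.
by rewrite !big_cons -IHw /sg signr_addb.
Qed.

Lemma family_parityE (A : {set J}) V : \prod_(j in A) sg (tuple_parity j V) = chi (family_parity A) V.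
Proof.
rewrite /family_parity chi_parity /family_word big_flatten /= big_map big_enum /=.
by apply: eq_bigr => j _; rewrite sg_tuple_parity.
Qed.

Lemma family_parity0 : family_parity finset.set0 = finset.set0.
Proof. by rewrite /family_parity /family_word enum_set0 /=; apply/setP => l; rewrite !inE. Qed.

Lemma size_family_word A : size (family_word A) = (k * #|A|)%N.
Proof.
rewrite /family_word size_flatten /shape -map_comp cardE.
elim: (enum A) => [|j s IHs]; first by rewrite muln0.
by rewrite /= size_tuple mulnS; congr (_ + _)%N.
Qed.

Lemma family_word_inj : (0 < k)%N -> injective family_word.
Proof.
move=> k0 A B AB.
suff : enum A = enum B by move=> h; apply/setP => j; rewrite -mem_enum h mem_enum.
move: AB; rewrite /family_word; move: (enum A) (enum B) => s.
elim: s => [|j s IHs] [|j' s'] //=.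
- by move/(congr1 size); rewrite size_cat size_tuple /=; lia.
- by move/(congr1 size); rewrite size_cat size_tuple /=; lia.
move/eqP; rewrite eqseq_cat ?size_tuple// => /andP[/eqP jj' /eqP ss'].
by rewrite (IHs _ ss'); congr (_ :: _); apply: val_inj.
Qed.

Lemma card_family_parity (i : nat) (S : {set 'I_d}) : (0 < k)%N ->
  (#|[pred A : {set J} | (#|A| == i) && (family_parity A == S)]| <= word_count (k * i) S)%N.
Proof.
move=> k0; rewrite cardE -(size_map family_word) /word_count -size_filter.
apply: uniq_leq_size; first by rewrite map_inj_uniq ?enum_uniq//; exact: family_word_inj.
move=> w /mapP[A]; rewrite mem_enum inE => /andP[/eqP cA pA] ->.
by rewrite mem_filter pA mem_words size_family_word cA eqxx.
Qed.

(** Grouping the families by their number i of elements, each group is bounded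
    by the number of words of length k i, and a geometric series remains. *)
Lemma family_parity_sum_le (D A0 : nat) (y zeta : R) (S : {set 'I_d}) :
  (0 < k)%N -> 0 < y -> y ^+ 2 = d%:R -> (k * D < A0)%N -> 0 <= zeta ->
  zeta * (A0%:R * y) ^+ k <= 2^-1 ->
  (\sum_(A : {set J} | ((#|A| <= D)%N && (family_parity A == S)) && (A != finset.set0)) zeta ^+ #|A|)
    * y ^+ #|S| <= 2 * (zeta * (A0%:R * y) ^+ k).
Proof.
move=> k0 y0 yd DA z0; set g := zeta * _ => g2.
have g0 : 0 <= g by rewrite mulr_ge0 ?exprn_ge0 ?mulr_ge0 ?(ltW y0).
have geom n : \sum_(i < n) g ^+ i.+1 <= 2 * g - 2 * g * 2^-1 ^+ n.
  elim: n => [|n IHn]; first by rewrite big_ord0 expr0; lra.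
  rewrite big_ord_recr /=; have : g ^+ n.+1 <= g * 2^-1 ^+ n.
    by rewrite exprS ler_wpM2l// lerXn2r ?nnegrE.
  rewrite [2^-1 ^+ n.+1]exprS; move: (2^-1 ^+ n : R) (g ^+ n.+1) (\sum_(i < n) _) IHn => u v s; lra.
apply: (@le_trans _ _ (\sum_(i < D) g ^+ i.+1)); last first.
  by apply: le_trans (geom D) _; rewrite gerBl mulr_ge0 ?exprn_ge0// mulr_ge0.
have part : \sum_(A : {set J} | ((#|A| <= D)%N && (family_parity A == S)) && (A != finset.set0)) zeta ^+ #|A| =
   \sum_(i < D) zeta ^+ i.+1 * #|[pred A : {set J} | (#|A| == i.+1) && (family_parity A == S)]|%:R.
  have [D0|D0] := posnP D.
    rewrite D0 big_ord0 big_pred0// => A; rewrite leqn0 cards_eq0.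
    by case: (A == _) => //; rewrite andbF.
  rewrite (partition_big (fun A : {set J} => insubd (Ordinal D0) (#|A|.-1)) xpredT) //=.
  apply: eq_bigr => i _.
  rewrite (eq_bigl (fun A => A \in [pred A : {set J} | (#|A| == i.+1) && (family_parity A == S)])).
    rewrite (eq_bigr (fun=> zeta ^+ i.+1)) ?sumr_const ?mulr_natr// => A.
    by rewrite inE => /andP[/eqP ->].
  move=> A /=; rewrite [RHS]inE /= -cards_eq0.
  case: (posnP #|A|) => [->|A0p]; first by rewrite andbF.
  rewrite andbT.
  apply/idP/idP => [/andP[/andP[cA ->]] /eqP <-|/andP[/eqP cA pA]].
    have c1 : (#|A|.-1 < D)%N by rewrite prednK.
    by rewrite val_insubd c1 prednK ?eqxx.
  rewrite cA pA ltn_ord /=; apply/eqP/val_inj; rewrite val_insubd ltn_ord//.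
rewrite part mulr_suml; apply: ler_sum => i _.
rewrite /g exprMn -mulrA; apply: ler_wpM2l; first by rewrite exprn_ge0.
rewrite -exprM exprMn.
apply: le_trans (word_count_le S y0 _ _); last 2 first.
- by rewrite card_ord.
- by apply: leq_ltn_trans DA; rewrite leq_mul2l ltn_ord orbT.
by rewrite ler_wpM2r ?exprn_ge0 ?(ltW y0)// ler_nat card_family_parity.
Qed.

Lemma family_parity_odd A : odd #|family_parity A| = odd k && odd #|A|.
Proof. by have [_] := parity_size (family_word A); rewrite size_family_word oddM. Qed.

End TuplePar.

End Hyper.

(** * Transcripts of sequential protocols *)
Lemma ln_prod (R : realType) (I : finType) (f : I -> R) :
  (forall i, 0 < f i) -> ln (\prod_i f i) = \sum_i ln (f i).
Proof.
move=> f0; suff [] : 0 < \prod_i f i /\ ln (\prod_i f i) = \sum_i ln (f i) by [].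
apply: (big_rec2 (fun x y => 0 < x /\ ln x = y)); first by rewrite ltr01 ln1.
by move=> i x y _ [x0 <-]; split; [exact: mulr_gt0|rewrite lnM ?posrE].
Qed.

Section Protocol.
Variable R : realType.
Variables (N : nat) (X K : finType) (Y : {ffun 'I_N -> X} -> {ffun 'I_N -> K}).

Definition upd (x : {ffun 'I_N -> X}) (i : 'I_N) (a : X) : {ffun 'I_N -> X} :=
  [ffun j => if j == i then a else x j].

(* [rect]: the inputs with a given transcript form a product set.  [determ]:
   when all inputs but the i-th are fixed, the own part of player i determines
   the whole transcript. *)
Hypothesis rect : forall (z x0 : {ffun 'I_N -> X}),
  (forall i, exists2 x, Y x = Y x0 & x i = z i) -> Y z = Y x0.
Hypothesis determ : forall i x a b,
  Y (upd x i a) i = Y (upd x i b) i -> Y (upd x i a) = Y (upd x i b).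

Lemma updE x i a : upd x i a i = a.
Proof. by rewrite ffunE eqxx. Qed.

Lemma upd_id x i : upd x i (x i) = x.
Proof. by apply/ffunP => j; rewrite ffunE; case: eqP => [->|]. Qed.

Lemma upd_upd x i a b : upd (upd x i a) i b = upd x i b.
Proof. by apply/ffunP => j; rewrite !ffunE; case: eqP. Qed.

Definition prod_law (nu : 'I_N -> X -> R) (x : {ffun 'I_N -> X}) : R := \prod_i nu i (x i).

Lemma prod_law_ge0 nu x : (forall i a, 0 <= nu i a) -> 0 <= prod_law nu x.
Proof. by move=> nu0; apply: prodr_ge0. Qed.

Lemma sum_prod_law nu : (forall i, \sum_a nu i a = 1) -> \sum_x prod_law nu x = 1.
Proof.
move=> nu1; rewrite /prod_law -(bigA_distr_bigA (fun i a => nu i a)).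
by rewrite big1.
Qed.

(** Invariance of a product law under redrawing one coordinate: exchange the
    old and the new value. *)
Lemma resample nu i (h : {ffun 'I_N -> X} -> R) : \sum_a nu i a = 1 ->
  \sum_x prod_law nu x * h x = \sum_x prod_law nu x * \sum_a nu i a * h (upd x i a).
Proof.
move=> nu1.
have -> : \sum_x prod_law nu x * h x = \sum_(p : {ffun 'I_N -> X} * X) prod_law nu p.1 * nu i p.2 * h p.1.
  rewrite -(pair_bigA _ (fun x a => prod_law nu x * nu i a * h x)) /=.
  apply: eq_bigr => x _; rewrite -[LHS]mulr1 -nu1 mulr_sumr.
  by apply: eq_bigr => a _; rewrite mulrAC.
have -> : \sum_x prod_law nu x * (\sum_a nu i a * h (upd x i a)) =
    \sum_(p : {ffun 'I_N -> X} * X) prod_law nu p.1 * nu i p.2 * h (upd p.1 i p.2).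
  rewrite -(pair_bigA _ (fun x a => prod_law nu x * nu i a * h (upd x i a))) /=.
  by apply: eq_bigr => x _; rewrite mulr_sumr; apply: eq_bigr => a _; rewrite mulrA.
pose sw (p : {ffun 'I_N -> X} * X) := (upd p.1 i p.2, p.1 i).
have swK : involutive sw.
  by move=> [x a]; rewrite /sw /= upd_upd updE upd_id.
rewrite [RHS](reindex_inj (inv_inj swK)) /=; apply: eq_bigr => -[x a] _ /=.
rewrite upd_upd upd_id; congr (_ * _).
rewrite /prod_law (bigD1 i)//= [in RHS](bigD1 i)//= updE.
rewrite [X in _ = _ * X * _](eq_bigr (fun j => nu j (x j))); first by ring.
by move=> j /negbTE ji; rewrite ffunE ji.
Qed.

(** The projection on coordinate i of the product set of inputs with
    transcript y. *)
Definition cell (y : {ffun 'I_N -> K}) (i : 'I_N) (a : X) : bool :=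
  [exists x : {ffun 'I_N -> X}, (Y x == y) && (x i == a)].

Definition block_mass (nu : 'I_N -> X -> R) y i : R := \sum_(a | cell y i a) nu i a.

Definition transcript_law nu y : R := \sum_(x | Y x == y) prod_law nu x.

Lemma transcript_law_prod nu x0 : transcript_law nu (Y x0) = \prod_i block_mass nu (Y x0) i.
Proof.
transitivity (\sum_(z : {ffun 'I_N -> X}) \prod_i (if cell (Y x0) i (z i) then nu i (z i) else 0)).
  rewrite /transcript_law big_mkcond; apply: eq_bigr => z _.
  case: eqP => [zy|zy].
    apply: eq_bigr => i _; rewrite ifT//; apply/existsP; exists z.
    by rewrite zy !eqxx.
  have [i hi] : exists i, ~~ cell (Y x0) i (z i).
    apply/existsP; apply: contra_notT zy; rewrite negb_exists => /forallP h.
    apply: rect => i; have := h i; rewrite negbK => /existsP[x /andP[/eqP ? /eqP ?]].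
    by exists x.
  by rewrite (bigD1 i)//= (negbTE hi) mul0r.
rewrite -(bigA_distr_bigA (fun i a => if cell (Y x0) i a then nu i a else 0)).
by apply: eq_bigr => i _; rewrite /block_mass [RHS]big_mkcond.
Qed.

Lemma cell_upd x i a b : cell (Y (upd x i a)) i b = (Y (upd x i b) i == Y (upd x i a) i).
Proof.
apply/existsP/eqP => [[x' /andP[/eqP yx' /eqP x'b]]|h].
  suff -> : Y (upd x i b) = Y (upd x i a) by [].
  apply: rect => j; case: (eqVneq j i) => [->|ji].
    by exists x'; rewrite // updE.
  by exists (upd x i a); rewrite // !ffunE (negbTE ji).
by exists (upd x i b); rewrite (determ h) updE !eqxx.
Qed.

Definition message_mass (mu : X -> R) (key : X -> K) (k : K) : R := \sum_(a | key a == k) mu a.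

Lemma sum_message_mass (mu : X -> R) (key : X -> K) : \sum_k message_mass mu key k = \sum_a mu a.
Proof. by rewrite [RHS](partition_big key xpredT). Qed.

Lemma block_mass_upd nu x i a :
  block_mass nu (Y (upd x i a)) i = message_mass (nu i) (fun b => Y (upd x i b) i) (Y (upd x i a) i).
Proof. by apply: eq_bigl => b; rewrite cell_upd. Qed.

Section Compare.
Variables (Q nu : 'I_N -> X -> R).
Hypothesis Q_gt0 : forall i a, 0 < Q i a.
Hypothesis nu_gt0 : forall i a, 0 < nu i a.
Hypothesis Q1 : forall i, \sum_a Q i a = 1.
Hypothesis nu1 : forall i, \sum_a nu i a = 1.

Let r i y := block_mass nu y i / block_mass Q y i.

Lemma block_mass_gt0 mu i x : (forall i a, 0 < mu i a) -> 0 < block_mass mu (Y x) i.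
Proof.
move=> mu0; rewrite /block_mass (bigD1 (x i)) /=; last by apply/existsP; exists x; rewrite !eqxx.
by rewrite ltr_pwDl// sumr_ge0// => a _; exact: ltW.
Qed.

(** With the other inputs fixed, the ratio r_i depends on the redrawn sample
    through the message of its owner only, and is the likelihood ratio of that
    message. *)
Lemma resample_ratio i (g : R -> R) :
  \sum_x prod_law Q x * g (r i (Y x)) =
  \sum_x prod_law Q x * \sum_k message_mass (Q i) (fun b => Y (upd x i b) i) k *
     g (message_mass (nu i) (fun b => Y (upd x i b) i) k / message_mass (Q i) (fun b => Y (upd x i b) i) k).
Proof.
rewrite (resample (fun x => g (r i (Y x))) (Q1 i)); apply: eq_bigr => x _; congr (_ * _).
rewrite (partition_big (fun b => Y (upd x i b) i) xpredT)//=; apply: eq_bigr => k _.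
rewrite [X in _ = X * _]/message_mass mulr_suml; apply: eq_bigr => a /eqP <-.
by rewrite /r !block_mass_upd.
Qed.

Lemma sum_ratio i : \sum_x prod_law Q x * (r i (Y x) - 1) = 0.
Proof.
rewrite (resample_ratio i (fun z => z - 1)) big1// => x _.
rewrite (_ : \sum_k _ = 0) ?mulr0//.
pose key := fun b => Y (upd x i b) i; rewrite -/key.
transitivity (\sum_k (message_mass (nu i) key k - message_mass (Q i) key k)).
  apply: eq_bigr => k _.
  have [Qk|Qk] := eqVneq (message_mass (Q i) key k) 0; last by field.
  rewrite Qk mul0r subr0 /message_mass big1// => a ka; exfalso.
  move/eqP: Qk; rewrite /message_mass psumr_eq0 => [/allP/(_ a (mem_index_enum a))|b _]; last exact: ltW.
  by rewrite ka /= gt_eqF.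
by rewrite sumrB !sum_message_mass Q1 nu1 subrr.
Qed.

(** The Hellinger route to Pinsker's inequality: phi z dominates
    (sqrt z - 1)^2, and |z - 1| is |sqrt z - 1| times sqrt z + 1. *)
Lemma abs_le_phi (z a : R) : 0 < z -> 0 < a -> `|z - 1| <= phi z / a + a / 2 * (z + 1).
Proof.
move=> z0 a0; pose s := Num.sqrt z.
have s0 : 0 < s by rewrite sqrtr_gt0.
have zs : z = s ^+ 2 by rewrite sqr_sqrtr// ltW.
have h1 : (s - 1) ^+ 2 <= phi z.
  rewrite /phi zs lnXn// -mulr_natl.
  have : ln s <= s - 1.
    have h : -1 < s - 1 by rewrite ltrBrDr addrC subrr.
    by have := le_ln1Dx h; rewrite addrCA subrr addr0.
  by rewrite expr2; nra.
have h2 : `|z - 1| = `|s - 1| * (s + 1).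
  rewrite -[s + 1]ger0_norm ?addr_ge0 ?(ltW s0)// -normrM zs; congr `|_|; ring.
rewrite h2.
apply: (@le_trans _ _ ((s - 1) ^+ 2 / a + a / 2 * (z + 1))); last first.
  by rewrite lerD2r ler_wpM2r// invr_ge0 ltW.
rewrite zs -(real_normK (num_real (s - 1))) -subr_ge0.
have -> : `|s - 1| ^+ 2 / a + a / 2 * (s ^+ 2 + 1) - `|s - 1| * (s + 1) =
    (`|s - 1| - a * (s + 1) / 2) ^+ 2 / a + a / 4 * (s - 1) ^+ 2.
  by field; rewrite gt_eqF.
by apply: addr_ge0; [apply: divr_ge0|apply: mulr_ge0; first apply: divr_ge0];
   rewrite ?sqr_ge0// ltW.
Qed.

(** The likelihood ratio of the transcript is Z = prod_i r_i, so phi(Z) and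
    sum_i phi(r_i) have the same mean under Q: both differ from minus the sum of
    the logarithms by terms of mean zero. *)
Lemma transcript_tv (a : R) : 0 < a ->
  \sum_y `|transcript_law nu y - transcript_law Q y| <=
  a + a^-1 * \sum_i \sum_x prod_law Q x * phi (r i (Y x)).
Proof.
move=> a0.
pose Z x := \prod_i r i (Y x).
have rpos i x : 0 < r i (Y x) by rewrite divr_gt0// block_mass_gt0.
have Zpos x : 0 < Z x by apply: prodr_gt0.
have PQ0 x : 0 < \prod_i block_mass Q (Y x) i by apply: prodr_gt0 => i _; exact: block_mass_gt0.
have ZE x : transcript_law nu (Y x) = Z x * transcript_law Q (Y x).
  rewrite !transcript_law_prod /Z -big_split /=; apply: eq_bigr => i _.
  by rewrite /r divfK// gt_eqF// block_mass_gt0.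
have push (g : {ffun 'I_N -> K} -> R) : \sum_x prod_law Q x * g (Y x) = \sum_y transcript_law Q y * g y.
  rewrite (partition_big Y xpredT)//=; apply: eq_bigr => y _.
  by rewrite /transcript_law mulr_suml; apply: eq_bigr => x /eqP ->.
have out mu y : (forall x, Y x != y) -> transcript_law mu y = 0.
  by move=> h; rewrite /transcript_law big_pred0// => x; exact/negbTE.
have pQ0 x : 0 <= prod_law Q x by apply: prod_law_ge0 => i b; exact: ltW.
have -> : \sum_y `|transcript_law nu y - transcript_law Q y| = \sum_x prod_law Q x * `|Z x - 1|.
  pose Zy y := transcript_law nu y / transcript_law Q y.
  transitivity (\sum_y transcript_law Q y * `|Zy y - 1|).
    apply: eq_bigr => y _.
    have [x /eqP <-|h] := pickP (fun x => Y x == y); last first.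
      by rewrite !out ?subrr ?normr0 ?mul0r// => x; rewrite h.
    rewrite /Zy ZE !transcript_law_prod mulfK ?gt_eqF//.
    rewrite -[X in _ - X]mul1r -mulrBl normrM mulrC [X in X * _]gtr0_norm//.
  rewrite -push; apply: eq_bigr => x _.
  by rewrite /Zy ZE !transcript_law_prod mulfK ?gt_eqF.
apply: (@le_trans _ _ (\sum_x prod_law Q x * (phi (Z x) / a + a / 2 * (Z x + 1)))).
  by apply: ler_sum => x _; rewrite ler_wpM2l// abs_le_phi.
have sZ : \sum_x prod_law Q x * Z x = 1.
  pose Zy y := transcript_law nu y / transcript_law Q y.
  transitivity (\sum_x prod_law Q x * Zy (Y x)).
    by apply: eq_bigr => x _; rewrite /Zy ZE !transcript_law_prod mulfK ?gt_eqF.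
  rewrite push; transitivity (\sum_y transcript_law nu y).
    apply: eq_bigr => y _.
    have [x /eqP <-|h] := pickP (fun x => Y x == y); last first.
      by rewrite /Zy !out ?mul0r// => x; rewrite h.
    by rewrite /Zy [_ * (_ / _)]mulrC divfK// transcript_law_prod gt_eqF.
  by rewrite -(sum_prod_law nu1) [RHS](partition_big Y xpredT).
have sphi : \sum_x prod_law Q x * phi (Z x) = \sum_i \sum_x prod_law Q x * phi (r i (Y x)).
  transitivity (\sum_x (prod_law Q x * Z x - prod_law Q x - prod_law Q x * ln (Z x))).
    by apply: eq_bigr => x _; rewrite /phi; ring.
  rewrite !sumrB sZ (sum_prod_law Q1) subrr add0r.
  transitivity (- \sum_i \sum_x prod_law Q x * ln (r i (Y x))).
    congr (- _); rewrite exchange_big /=; apply: eq_bigr => x _.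
    by rewrite -mulr_sumr ln_prod.
  rewrite -sumrN; apply: eq_bigr => i _; rewrite -[LHS]add0r -{1}(sum_ratio i) -sumrN -big_split /=.
  by apply: eq_bigr => x _; rewrite /phi; ring.
rewrite -sphi le_eqVlt; apply/orP; left; apply/eqP.
transitivity (\sum_x (a^-1 * (prod_law Q x * phi (Z x)) + a / 2 * (prod_law Q x * Z x + prod_law Q x))).
  by apply: eq_bigr => x _; ring.
rewrite big_split /= -!mulr_sumr big_split /= sZ (sum_prod_law Q1) addrC; congr (_ + _).
by field.
Qed.

End Compare.

(** Mixing each law with a fraction del of Q changes the product law by at most
    N del and bounds the ratios from below.  The divergence is then averaged
    over V sample by sample, each time with the other samples drawn from Q,
    which does not depend on V; so only the divergence of a single message,
    averaged over V, is needed. *)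
Lemma protocol_transfer (Vt : finType) (Q : 'I_N -> X -> R) (nu : Vt -> 'I_N -> X -> R)
    (Tst : Vt -> {ffun 'I_N -> K} -> R) (del a eps : R) (V0 : Vt) :
  0 < del -> del <= 1 -> 0 < a ->
  (forall i b, 0 < Q i b) -> (forall i, \sum_b Q i b = 1) ->
  (forall V i b, 0 <= nu V i b) -> (forall V i, \sum_b nu V i b = 1) ->
  (forall V y, 0 <= Tst V y <= 1) ->
  (forall i (key : X -> K), \sum_k avg (fun V => message_mass (Q i) key k *
      phi ((1 - del) * (message_mass (nu V i) key k / message_mass (Q i) key k) + del)) <= eps) ->
  avg (fun V => \sum_x prod_law (nu V) x * Tst V (Y x)) <=
  avg (fun V => \sum_x prod_law Q x * Tst V (Y x)) + N%:R * del + a + a^-1 * (N%:R * eps).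
Proof.
move=> d0 d1 a0 Q0 Q1 nu0 nu1 T01 heps.
pose nu' V i b := (1 - del) * nu V i b + del * Q i b.
have d1' : 0 <= 1 - del by rewrite subr_ge0.
have nu'0 V i b : 0 < nu' V i b.
  by rewrite /nu' ltr_wpDl ?mulr_gt0// mulr_ge0.
have nu'1 V i : \sum_b nu' V i b = 1.
  by rewrite big_split /= -!mulr_sumr nu1 Q1 !mulr1 subrK.
have push (mu : 'I_N -> X -> R) (g : {ffun 'I_N -> K} -> R) :
    \sum_x prod_law mu x * g (Y x) = \sum_y transcript_law mu y * g y.
  rewrite (partition_big Y xpredT)//=; apply: eq_bigr => y _.
  by rewrite /transcript_law mulr_suml; apply: eq_bigr => x /eqP ->.
have step1 V : \sum_x prod_law (nu V) x * Tst V (Y x) <=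
    \sum_x prod_law (nu' V) x * Tst V (Y x) + N%:R * del.
  have low x : (1 - N%:R * del) * prod_law (nu V) x <= prod_law (nu' V) x.
    apply: (@le_trans _ _ ((1 - del) ^+ N * prod_law (nu V) x)).
      rewrite ler_wpM2r ?prod_law_ge0//.
      elim: {1 2}N => [|n IHn]; first by rewrite mul0r subr0 expr0.
      rewrite exprS; apply: le_trans (ler_wpM2l d1' IHn).
      rewrite -[n.+1%:R]natr1; have : 0 <= n%:R * del ^+ 2 by rewrite mulr_ge0 ?sqr_ge0.
      by rewrite expr2; nra.
    rewrite -[X in _ ^+ X]card_ord -prodr_const -big_split /=.
    apply: ler_prod => i _; rewrite mulr_ge0//=.
    by rewrite lerDl mulr_ge0 ?ltW.
  have eN : N%:R * del = \sum_x N%:R * del * prod_law (nu V) x.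
    by rewrite -mulr_sumr (sum_prod_law (nu1 V)) mulr1.
  rewrite -lerBlDr {1}eN -sumrB.
  apply: ler_sum => x _; have /andP[t0 t1] := T01 V (Y x).
  have p0 : 0 <= prod_law (nu V) x by rewrite prod_law_ge0.
  have Nd : 0 <= N%:R * del by rewrite mulr_ge0// ltW.
  apply: (@le_trans _ _ (((1 - N%:R * del) * prod_law (nu V) x) * Tst V (Y x))); last exact: ler_wpM2r.
  move: (N%:R * del) Nd (prod_law _ _) p0 (Tst _ _) t0 t1 => e e0 q q0 t t0 t1.
  have : 0 <= e * q * (1 - t) by rewrite !mulr_ge0// subr_ge0.
  nra.
pose div V := \sum_i \sum_x prod_law Q x * phi (block_mass (nu' V) (Y x) i / block_mass Q (Y x) i).
have step2 V : \sum_x prod_law (nu' V) x * Tst V (Y x) <=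
    \sum_x prod_law Q x * Tst V (Y x) + (a + a^-1 * div V).
  rewrite !push -lerBlDl -sumrB.
  apply: le_trans (transcript_tv Q0 (nu'0 V) Q1 (nu'1 V) a0).
  apply: ler_sum => y _; rewrite -mulrBl; have /andP[t0 t1] := T01 V y.
  apply: le_trans (ler_norm _) _; rewrite normrM ler_piMr// ger0_norm//.
have step3 : avg div <= N%:R * eps.
  rewrite /div avg_sum -[X in X%:R * _]card_ord mulr_natl -sumr_const.
  apply: ler_sum => i _.
  have -> : eps = \sum_x prod_law Q x * eps by rewrite -mulr_suml (sum_prod_law Q1) mul1r.
  under eq_avg => V do rewrite (@resample_ratio Q (nu' V) Q1 i (@phi R)).
  rewrite avg_sum; apply: ler_sum => x _; rewrite avgZ ler_wpM2l//.
    by rewrite prod_law_ge0// => j b; exact: ltW.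
  rewrite avg_sum; apply: le_trans (heps i (fun b => Y (upd x i b) i)).
  apply: ler_sum => k _; apply: ler_avg => V.
  have [->|Qk] := eqVneq (message_mass (Q i) (fun b => Y (upd x i b) i) k) 0; first by rewrite !mul0r.
  rewrite le_eqVlt; apply/orP; left; apply/eqP; congr (_ * phi _).
  rewrite {1}/message_mass big_split /= -!mulr_sumr -/(message_mass _ _ _) -/(message_mass (Q i) _ _).
  by field.
apply: (@le_trans _ _ (avg (fun V => \sum_x prod_law Q x * Tst V (Y x) +
    (a + N%:R * del + a^-1 * div V)))).
  apply: ler_avg => V; apply: le_trans (step1 V) _.
  by have := step2 V; move: (\sum_x _) (\sum_x _) => u v; lra.
rewrite !avgD !(avg_cst V0) [avg (fun x => a^-1 * div x)]avgZ.
have : a^-1 * avg div <= a^-1 * (N%:R * eps) by rewrite ler_wpM2l// invr_ge0 ltW.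
by move: (a^-1 * avg div) (a^-1 * (N%:R * eps)) (N%:R * del) (avg _) => u v w z; lra.
Qed.

End Protocol.

Section Run.
Variables (N T : nat) (S X : finType) (st0 : S).
Variable (F : 'I_T -> 'I_N -> S -> X -> S).
Let step (x : 'I_N -> X) (st : S) (p : 'I_T * 'I_N) : S := F p.1 p.2 st (x p.2).

(** The passes of the algorithm over finite samples, with the same folds as in
    the definition of the final state of a memory bounded algorithm. *)
Definition machine_pass (x : 'I_N -> X) (st : S) (t : 'I_T) : S :=
  foldl (fun st i => F t i st (x i)) st (enum 'I_N).
Definition machine_final (x : 'I_N -> X) : S := foldl (machine_pass x) st0 (enum 'I_T).

Definition steps : seq ('I_T * 'I_N) := [seq (t, i) | t <- enum 'I_T, i <- enum 'I_N].

Lemma machine_finalE x : machine_final x = foldl (step x) st0 steps.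
Proof.
rewrite /machine_final /steps; elim: (enum 'I_T) st0 => [|t l IHl] st //=.
rewrite IHl foldl_cat; congr foldl.
by rewrite /machine_pass; elim: (enum 'I_N) st => [|i r IHr] st' //=; rewrite IHr.
Qed.

(** The state written by step p in the run of the steps ls from st. *)
Fixpoint after (ls : seq ('I_T * 'I_N)) st x p : S :=
  if ls is q :: l then
    if q == p then step x st q else after l (step x st q) x p
  else st.

(** The state read by a step is the one written by the step before it.  If each
    step of the run on z reads a state that it also reads in the run on x, it
    writes the same state, because its own sample occurs in a run with the same
    transcript. *)
Lemma after_mix ls st (x z : 'I_N -> X) : uniq ls ->
  (forall p, p \in ls -> exists2 x', {in ls, after ls st x' =1 after ls st x} & x' p.2 = z p.2) ->
  {in ls, after ls st z =1 after ls st x} /\ foldl (step z) st ls = foldl (step x) st ls.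
Proof.
elim: ls st => [|q l IHl] st //= /andP[ql ul] h.
have next x' : {in q :: l, (fun p => if q == p then step x' st q else after l (step x' st q) x' p) =1
    (fun p => if q == p then step x st q else after l (step x st q) x p)} ->
    step x' st q = step x st q.
  by move=> /(_ q (mem_head _ _)); rewrite eqxx.
have zq : step z st q = step x st q.
  have [x' hx' xq] := h q (mem_head _ _).
  by rewrite -(next _ hx') /step xq.
have [h1 h2] : {in l, after l (step x st q) z =1 after l (step x st q) x} /\
    foldl (step z) (step x st q) l = foldl (step x) (step x st q) l.
  apply: IHl => // p pl; have [x' hx' xq] := h p (mem_behead (s := q :: l) pl).
  exists x' => // r rl; have := hx' r (mem_behead (s := q :: l) rl).
  rewrite (next _ hx'); case: eqP => // qr; by rewrite qr rl in ql.
rewrite zq; split=> // p; rewrite in_cons => /orP[/eqP ->|pl]; first by rewrite eqxx.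
by case: eqP => // _; exact: h1.
Qed.

(** Steps that do not belong to i act alike in both runs, and those of i agree
    by hypothesis. *)
Lemma after_own ls st (x z : 'I_N -> X) i : uniq ls ->
  (forall j, j != i -> z j = x j) ->
  (forall p, p \in ls -> p.2 = i -> after ls st z p = after ls st x p) ->
  {in ls, after ls st z =1 after ls st x}.
Proof.
move=> + zx; elim: ls st => [|q l IHl] st //= /andP[ql ul] h.
have zq : step z st q = step x st q.
  case: (eqVneq q.2 i) => [qi|qi]; last by rewrite /step zx.
  by have := h q (mem_head _ _) qi; rewrite eqxx.
have h1 : {in l, after l (step x st q) z =1 after l (step x st q) x}.
  apply: IHl => // p pl pi; have := h p (mem_behead (s := q :: l) pl) pi.
  rewrite zq; case: eqP => // qr; by rewrite qr pl in ql.
move=> p; rewrite zq in_cons => /orP[/eqP ->|pl]; first by rewrite eqxx.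
by case: eqP => // _; exact: h1.
Qed.

Lemma uniq_steps : uniq steps.
Proof.
apply: allpairs_uniq; rewrite ?enum_uniq//.
by move=> [a b] [c e] _ _ /= [-> ->].
Qed.

Lemma mem_steps p : p \in steps.
Proof. by case: p => t i; apply/allpairsP; exists (t, i); rewrite !mem_enum. Qed.

Definition transcript (x : {ffun 'I_N -> X}) : {ffun 'I_N -> {ffun 'I_T -> S}} :=
  [ffun i => [ffun t => after steps st0 x (t, i)]].

Lemma transcriptP (x z : {ffun 'I_N -> X}) :
  transcript x = transcript z <-> {in steps, after steps st0 x =1 after steps st0 z}.
Proof.
split=> [h [t i] _|h].
  by have := congr1 (fun f : {ffun 'I_N -> {ffun 'I_T -> S}} => f i t) h; rewrite !ffunE.
by apply/ffunP => i; apply/ffunP => t; rewrite !ffunE; apply: h; exact: mem_steps.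
Qed.

Lemma transcript_rect (z x0 : {ffun 'I_N -> X}) :
  (forall i, exists2 x, transcript x = transcript x0 & x i = z i) ->
  transcript z = transcript x0.
Proof.
move=> h; apply/transcriptP; apply: (after_mix uniq_steps _).1 => p _.
have [x /transcriptP hx xp] := h p.2; by exists x.
Qed.

Lemma transcript_determ i x a b :
  transcript (upd x i a) i = transcript (upd x i b) i ->
  transcript (upd x i a) = transcript (upd x i b).
Proof.
move=> h; apply/transcriptP; apply: (after_own uniq_steps (i := i)).
  by move=> j /negbTE ji; rewrite !ffunE ji.
move=> [t j] _ /= ->.
by have := congr1 (fun f : {ffun 'I_T -> S} => f t) h; rewrite !ffunE.
Qed.

Lemma transcript_final (x z : {ffun 'I_N -> X}) :
  transcript x = transcript z -> machine_final x = machine_final z.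
Proof.
move=> /transcriptP h; rewrite !machine_finalE.
by apply: (after_mix uniq_steps _).2 => p _; exists x.
Qed.

(** The final state is recovered from the transcript; the default value is
    only reached outside the range of [transcript]. *)
Definition decode (y : {ffun 'I_N -> {ffun 'I_T -> S}}) : S :=
  if [pick x | transcript x == y] is Some x then machine_final x else st0.

Lemma decodeP x : decode (transcript x) = machine_final x.
Proof.
rewrite /decode; case: pickP => [x' /eqP hx'|/(_ x)]; last by rewrite eqxx.
exact: transcript_final.
Qed.

End Run.

(** * The finite lower bound *)
Section Discrete.
Variable R : realType.
Variables (k d N T : nat) (S : finType) (st0 : S).
Let J := (k.-tuple 'I_d : finType).
Let X := {ffun J -> bool}.
Let V_ := {ffun 'I_d -> bool}.
Variable (F : 'I_T -> 'I_N -> S -> X -> S).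
Variables (t : 'I_N -> J -> R) (tau0 y ell a g : R) (m D A0 : nat).
Hypothesis k_gt0 : (0 < k)%N.
Hypothesis d_gt0 : (0 < d)%N.
Hypothesis t_lt1 : forall i j, `|t i j| < 1.
Hypothesis t_le : forall i j, `|t i j| <= tau0.
Hypothesis tau0_ge0 : 0 <= tau0.
Hypothesis y_def : y = Num.sqrt d%:R.
Hypothesis DA : (k * D < A0)%N.
Hypothesis g_def : (m.+1.*2.-1)%:R * tau0 ^+ 2 * (A0%:R * y) ^+ k <= g.
Hypothesis g_small : 32 * expR 1 * g <= 1.
Hypothesis ell_ge0 : 0 <= ell.
Hypothesis a_gt0 : 0 < a.

Definition nu (V : V_) (i : 'I_N) (x : X) : R := dens (@tuple_parity k d) (t i) V x / #|X|%:R.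

(** The bound of [cells_bound] for messages of T states, with eps1 = 2g/y when
    k is odd and 2g/y^2 when k is even. *)
Definition message_divergence : R :=
  (2 + 4 * ell) * (8 * expR 1 * g / y ^+ (if odd k then 1 else 2) +
    8 * (2^-1 ^+ D * expR (2 * (#|J|%:R * tau0 ^+ 2))) +
    (#|S| ^ T)%:R * expR ((#|J|%:R * tau0 ^+ 2 - m.+1%:R) / 2)).

(** [protocol_transfer] with Q the average over V of the laws nu V, the
    divergence of one message being given by [cells_bound]; under Q the final
    state is independent of V and the test passes with probability at most B. *)
Lemma discrete_bound (Tst : V_ -> S -> R) (B : R) :
  (forall V z, 0 <= Tst V z <= 1) ->
  (forall z, avg (fun V => Tst V z) <= B) ->
  avg (fun V => \sum_x prod_law (nu V) x * Tst V (machine_final st0 F x)) <=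
  B + N%:R * expR (- ell) + a + a^-1 * (N%:R * message_divergence).
Proof.
move=> T01 TB.
have y0 : 0 < y by rewrite y_def sqrtr_gt0 ltr0n.
have y2 : y ^+ 2 = d%:R by rewrite y_def sqr_sqrtr// ler0n.
have y1 : 1 <= y by rewrite y_def -[leLHS]sqrtr1 ler_wsqrtr// ler1n.
pose V0 : V_ := [ffun=> false].
pose x0 : X := [ffun=> false].
pose Q i x := avg (fun V => nu V i x).
have cX : 0 < #|X|%:R :> R by rewrite ltr0n; apply/card_gt0P; exists x0.
have nu_pos V i x : 0 < nu V i x.
  rewrite divr_gt0// /dens; apply: prodr_gt0 => j _.
  have := t_lt1 i j; rewrite ltr_norml => /andP[h1 h2].
  by rewrite /sg; case: (tuple_parity j V); case: (x j); rewrite ?expr1 ?expr0; lra.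
have t1 i j : `|t i j| <= 1 by apply: ltW.
have nu_sum V i : \sum_x nu V i x = 1.
  rewrite /nu -mulr_suml -/(avg _).
  under eq_avg => x do rewrite (densE _ (@family_parityE R k d)).
  rewrite avg_sum (bigD1 finset.set0)//= big1 => [|A A0'].
    under eq_avg => x do rewrite /coef_prod /chi family_parity0 !big_set0 !mul1r.
    by rewrite (avg_cst x0) addr0.
  by rewrite avgZ avg_chiI (negbTE A0') mulr0.
have Q_pos i x : 0 < Q i x.
  rewrite /Q /avg divr_gt0//; last by rewrite ltr0n; apply/card_gt0P; exists V0.
  by rewrite (bigD1 V0)//= ltr_pwDl// sumr_ge0// => V _; exact: ltW.
have Q_sum i : \sum_x Q i x = 1.
  by rewrite /Q -avg_sum; under eq_avg => V do rewrite nu_sum; rewrite (avg_cst V0).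
have g0 : 0 <= g.
  apply: le_trans g_def; apply: mulr_ge0; last by rewrite exprn_ge0// mulr_ge0 ?ler0n ?(ltW y0).
  by apply: mulr_ge0; [rewrite ler0n|exact: sqr_ge0].
have e1 : 1 <= expR 1 :> R by rewrite -[leLHS]expR0 ler_expR.
pose zeta : R := (m.+1.*2.-1)%:R * tau0 ^+ 2.
have z0 : 0 <= zeta by apply: mulr_ge0; [rewrite ler0n|exact: sqr_ge0].
have gz : zeta * (A0%:R * y) ^+ k <= g := g_def.
have gs : zeta * (A0%:R * y) ^+ k <= 2^-1.
  by apply: le_trans gz _; move: (expR 1) e1 g_small => e e1' ge; nra.
pose rk := if odd k then 1%N else 2%N.
pose eps1 := 2 * g / y ^+ rk.
have eps1_ge0 : 0 <= eps1.
  by apply: divr_ge0; [rewrite mulr_ge0|rewrite exprn_ge0// ltW].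
have h1 (S' : {set 'I_d}) : S' != finset.set0 ->
    \sum_(A : {set J} | (#|A| <= D)%N && (family_parity A == S')) zeta ^+ #|A| <= eps1.
  move=> S0.
  have [A1 /andP[_ /eqP A1S]|noA] := pickP (fun A : {set J} => (#|A| <= D)%N && (family_parity A == S')); last first.
    by rewrite big_pred0.
  (* A parity set has the parity of k times the number of tuples, so for even k
     a nonempty one has at least two elements. *)
  have rkS : (rk <= #|S'|)%N.
    rewrite -cards_eq0 -A1S in S0; have := family_parity_odd A1; rewrite A1S /rk.
    case: (odd k) => /=; rewrite -A1S; first by rewrite lt0n.
    by case: #|family_parity A1| S0 => [|[|]].
  apply: (@le_trans _ _ (2 * g / y ^+ #|S'|)).
    rewrite ler_pdivlMr ?exprn_gt0//.
    apply: (@le_trans _ _ (2 * (zeta * (A0%:R * y) ^+ k))); last by rewrite ler_wpM2l.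
    apply: le_trans (family_parity_sum_le S' k_gt0 y0 y2 DA z0 gs).
    rewrite le_eqVlt; apply/orP; left; apply/eqP; congr (_ * _); apply: eq_bigl => A.
    case: eqP => [AS|]; last by rewrite !andbF.
    case: eqP => [A0'|_] /=; last by rewrite !andbT.
    by move: S0; rewrite -AS A0' family_parity0 eqxx.
  apply: ler_wpM2l; first by rewrite mulr_ge0.
  by rewrite lef_pV2 ?posrE ?exprn_gt0// ler_weXn2l.
have h0 : \sum_(A : {set J} | ((#|A| <= D)%N && (family_parity A == finset.set0)) && (A != finset.set0))
    zeta ^+ #|A| <= 2 * g.
  have := family_parity_sum_le finset.set0 k_gt0 y0 y2 DA z0 gs.
  rewrite cards0 expr0 mulr1 => /le_trans; apply; by rewrite ler_wpM2l.
have g16 : 16 * expR 1 * (2 * g) <= 1 by apply: le_trans g_small; rewrite le_eqVlt; apply/orP; left; apply/eqP; ring.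
have heps i (ky : X -> {ffun 'I_T -> S}) := cells_bound (@family_parityE R k d) (family_parity0 k d) tau0_ge0 (t_le i) (t1 i)
   h1 h0 eps1_ge0 g16 ell_ge0 ky.
have massE V i (ky : X -> {ffun 'I_T -> S}) kk :
    message_mass (nu V i) ky kk = cell_mass (@tuple_parity k d) (t i) (fun x => ky x == kk) V.
  rewrite /message_mass /nu -mulr_suml /cell_mass /avg big_mkcond; congr (_ / _).
  by apply: eq_bigr => x _; case: eqP; rewrite ?mul1r ?mul0r.
have massQ i (ky : X -> {ffun 'I_T -> S}) kk :
    message_mass (Q i) ky kk = mean_mass (@tuple_parity k d) (t i) (fun x => ky x == kk).
  rewrite /message_mass /Q -avg_sum; apply: eq_avg => V; rewrite -massE//.
have e0 : expR (- ell) <= 1 by rewrite expR_le1 oppr_le0.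
have hmain := @protocol_transfer R N X _ (transcript st0 F) (@transcript_rect _ _ _ _ st0 F)
  (@transcript_determ _ _ _ _ st0 F) _ Q nu (fun V yy => Tst V (decode st0 F yy)) (expR (- ell)) a message_divergence V0
  (expR_gt0 _) e0 a_gt0 Q_pos Q_sum (fun V i x => ltW (nu_pos V i x)) nu_sum (fun V yy => T01 V _).
apply: (@le_trans _ _ (avg (fun V => \sum_x prod_law (nu V) x * Tst V (decode st0 F (transcript st0 F x))))).
  by apply: ler_avg => V; apply: ler_sum => x _; rewrite decodeP.
apply: le_trans (hmain _) _.
  move=> i ky.
  under eq_bigr => kk _ do under eq_avg => V do rewrite massQ massE.
  apply: le_trans (heps i ky) _.
  rewrite /phi_const /message_divergence /tiny_mass card_ffun card_ord; apply: ler_wpM2l; first by rewrite addr_ge0// mulr_ge0.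
  by rewrite !lerD2r /eps1 le_eqVlt; apply/orP; left; apply/eqP; rewrite -/rk; ring.
rewrite !lerD2r avg_sum.
apply: (@le_trans _ _ (\sum_x prod_law Q x * B)).
  apply: ler_sum => x _; rewrite avgZ ler_wpM2l//.
  by apply: prod_law_ge0 => i b; exact: ltW.
by rewrite -mulr_suml sum_prod_law// mul1r.
Qed.

End Discrete.

(** * Weighted laws and invariance of the Lebesgue measure *)

Section WeightedLaw.
Context d d' (T : measurableType d) (S : measurableType d') (R : realType).
Variables (mu : {measure set T -> \bar R}) (h : T -> R) (X : T -> S).
Hypotheses (mh : measurable_fun setT h) (h0 : forall x, 0 <= h x).
Hypothesis (mX : measurable_fun setT X).
Local Open Scope ereal_scope.

(** The law of X under the measure of density h with respect to mu.  The
    measurability and sign hypotheses are arguments so that a measure structure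
    can be attached to the applied constant. *)
Definition wlaw of measurable_fun setT h & (forall x, 0 <= h x)%R & measurable_fun setT X :=
  fun B : set S => \int[mu]_(x in X @^-1` B) (h x)%:E.

Local Notation m := (wlaw mh h0 mX).

Let mpre B : measurable B -> measurable (X @^-1` B).
Proof. by move=> mB; rewrite -[X in measurable X]setTI; exact: mX. Qed.

Let wlaw0 : m set0 = 0. Proof. by rewrite /wlaw preimage_set0 integral_set0. Qed.

Let wlaw_ge0 A : 0 <= m A.
Proof. by apply: integral_ge0 => x _; rewrite lee_fin. Qed.

Let wlaw_sigma_additive : semi_sigma_additive m.
Proof.
move=> F mF tF mUF; rewrite /wlaw preimage_bigcup ge0_integral_bigcup//.
- by apply: is_cvg_ereal_nneg_natsum_cond => n _ _; exact: wlaw_ge0.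
- by move=> n; exact: mpre.
- exact/measurable_EFinP/measurable_funTS.
- by move=> x _; rewrite lee_fin.
- apply/trivIsetP => /= i j _ _ ij; rewrite -preimage_setI.
  by move/trivIsetP : tF => /(_ _ _ _ _ ij) ->//; rewrite preimage_set0.
Qed.

HB.instance Definition _ := isMeasure.Build _ _ _ m wlaw0 wlaw_ge0 wlaw_sigma_additive.

Import HBNNSimple.

Let integral_wlaw_nnsfun (f : {nnsfun S >-> R}) :
  \int[m]_x (f x)%:E = \int[mu]_x ((f (X x))%:E * (h x)%:E).
Proof.
rewrite integralT_nnsfun sintegralE.
under [RHS]eq_integral.
  move=> x _; rewrite fimfunE -fsumEFin// ge0_mule_fsuml; last first.
    by move=> r; rewrite EFinM nnfun_muleindic_ge0.
  over.
rewrite ge0_integral_fsum//; last 2 first.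
- move=> r; apply: emeasurable_funM; last exact/measurable_EFinP.
  apply/measurable_EFinP; apply: measurable_funM => //.
  exact: measurableT_comp.
- by move=> r x _; apply: mule_ge0; [rewrite EFinM nnfun_muleindic_ge0|rewrite lee_fin].
apply: eq_fsbigr => r /[!inE] -[x _ fx].
under eq_integral do rewrite EFinM -muleA.
rewrite ge0_integralZl//.
- congr (_ * _); rewrite /m /= /wlaw integral_mkcond/=; apply: eq_integral => y _.
  rewrite patchE indicE.
  have -> : (y \in X @^-1` (f @^-1` [set r])) = (X y \in f @^-1` [set r]).
    by apply/idP/idP; rewrite !inE.
  by case: ifPn => _; rewrite ?mul1e ?mul0e.
- apply: emeasurable_funM; apply/measurable_EFinP => //.
  exact: measurableT_comp.
- by move=> y _; apply: mule_ge0; rewrite lee_fin.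
- by rewrite lee_fin -fx.
Qed.

Lemma integral_wlaw (f : S -> \bar R) : measurable_fun setT f -> (forall x, 0 <= f x) ->
  \int[m]_x f x = \int[mu]_x (f (X x) * (h x)%:E).
Proof.
move=> mf f0.
pose f_ := nnsfun_approx measurableT mf.
have f_nd x : {homo (fun n => (f_ n x)%:E) : n m / (n <= m)%N >-> n <= m}.
  by move=> a b ab; rewrite lee_fin; exact/lefP/nd_nnsfun_approx.
have f_cvg x : (f_ n x)%:E @[n --> \oo] --> f x by exact: cvg_nnsfun_approx.
transitivity (lim (\int[m]_x (f_ n x)%:E @[n --> \oo])).
  rewrite -monotone_convergence//=.
  - by apply: eq_integral => x _; apply/esym/cvg_lim.
  - by move=> n; exact/measurable_EFinP.
  - by move=> n x _; rewrite lee_fin.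
transitivity (lim (\int[mu]_x ((f_ n (X x))%:E * (h x)%:E) @[n --> \oo])).
  by apply: congr_lim; apply/funext => n /=; exact: integral_wlaw_nnsfun.
rewrite -monotone_convergence//=.
- apply: eq_integral => x _; apply/cvg_lim => //.
  by apply: cvgeZr => //; exact: f_cvg.
- move=> n; apply: emeasurable_funM; apply/measurable_EFinP => //.
  exact: measurableT_comp.
- by move=> n x _; apply: mule_ge0; rewrite lee_fin.
- by move=> x _ a b ab; apply: lee_wpmul2r; rewrite ?lee_fin//; exact: f_nd.
Qed.

End WeightedLaw.

Lemma wlaw_transfer d1 d2 d' (T1 : measurableType d1) (T2 : measurableType d2)
    (S : measurableType d') (R : realType)
    (mu1 : {measure set T1 -> \bar R}) (mu2 : {measure set T2 -> \bar R})
    (h1 : T1 -> R) (h2 : T2 -> R) (X1 : T1 -> S) (X2 : T2 -> S) (f : S -> \bar R) :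
  measurable_fun setT h1 -> measurable_fun setT h2 ->
  (forall x, 0 <= h1 x) -> (forall x, 0 <= h2 x) ->
  measurable_fun setT X1 -> measurable_fun setT X2 ->
  (forall B, measurable B -> (\int[mu1]_(x in X1 @^-1` B) (h1 x)%:E =
     \int[mu2]_(x in X2 @^-1` B) (h2 x)%:E)%E) ->
  measurable_fun setT f -> (forall x, (0 <= f x)%E) ->
  (\int[mu1]_x (f (X1 x) * (h1 x)%:E) = \int[mu2]_x (f (X2 x) * (h2 x)%:E))%E.
Proof.
move=> mh1 mh2 h10 h20 mX1 mX2 h12 mf f0.
rewrite -(integral_wlaw mu1 mh1 h10 mX1 mf f0) -(integral_wlaw mu2 mh2 h20 mX2 mf f0).
by apply: eq_measure_integral => A mA _; exact: h12.
Qed.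

Lemma integral_one d (T : measurableType d) (R : realType)
    (mu : {measure set T -> \bar R}) (D : set T) : measurable D ->
  (\int[mu]_(x in D) ((cst 1 : T -> R) x)%:E = mu D)%E.
Proof. by move=> mD; rewrite -[RHS]mul1e -integral_cst. Qed.

Section LebesgueInvariance.
Variable R : realType.
Local Notation lambda := (@lebesgue_measure R).

Let invariance (f : R -> R) (mf : measurable_fun setT f) :
  (forall a b, a < b -> lambda (f @^-1` `]a, b]%classic) = (b - a)%:E) ->
  forall A : set R, measurable A -> lambda (f @^-1` A) = lambda A.
Proof.
move=> h A mA.
have mc : @measurable_fun _ _ (measurableTypeR R) R setT (cst (1 : R)) by exact: measurable_cst.
pose mu : {measure set (measurableTypeR R) -> \bar R} :=
  @wlaw _ _ (measurableTypeR R) (measurableTypeR R) R lambda (cst 1) f mc (fun=> ler01) mf.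
have muE (X : set R) : measurable X -> mu X = lambda (f @^-1` X).
  move=> mX; have mfX : measurable (f @^-1` X).
    by rewrite -[X in measurable X]setTI; exact: (mf measurableT).
  exact: integral_one.
have hX : forall X : set R, ocitv X -> lambda X = mu X; last first.
  by rewrite -muE//; apply/esym; exact: (@lebesgue_measure_unique R mu hX A mA).
move=> X.
move=> /ocitvP [->|[[a b] /= ab ->]]; first by rewrite !measure0.
by rewrite muE// h// lebesgue_measure_itv/= lte_fin ab EFinB.
Qed.

Lemma lebesgue_measure_shift (u : R) (A : set R) : measurable A ->
  lambda ((fun x => x + u) @^-1` A) = lambda A.
Proof.
apply: invariance; first exact: measurable_funD.
move=> a b ab.
have -> : (fun x => x + u) @^-1` `]a, b]%classic = `]a - u, b - u]%classic.
  by apply/seteqP; split => x /=; rewrite !in_itv/=; lra.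
rewrite lebesgue_measure_itv/= lte_fin ltrD2r ab -EFinB; congr EFin; ring.
Qed.

Lemma lebesgue_measure_opp (A : set R) : measurable A ->
  lambda (-%R @^-1` A) = lambda A.
Proof.
apply: invariance; first exact: oppr_measurable.
move=> a b ab.
have -> : -%R @^-1` `]a, b]%classic = `[- b, - a[%classic.
  by apply/seteqP; split => x /=; rewrite !in_itv/=; lra.
rewrite lebesgue_measure_itv/= lte_fin ltrN2 ab -EFinB; congr EFin; ring.
Qed.

End LebesgueInvariance.

(** * Randomising the signs of a Gaussian *)
Section Tanh.
Variable R : realType.

Definition tanh (x : R) : R := (expR x - expR (- x)) / (expR x + expR (- x)).

Lemma tanh_lt1 x : `|tanh x| < 1.
Proof.
have a0 : 0 < expR x := expR_gt0 x; have b0 : 0 < expR (- x) := expR_gt0 _.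
have ab0 : 0 < expR x + expR (- x) by rewrite addr_gt0.
rewrite ltr_norml /tanh; apply/andP; split.
  by rewrite ltr_pdivlMr//; move: (expR x) (expR (- x)) a0 b0 => a b; lra.
by rewrite ltr_pdivrMr//; move: (expR x) (expR (- x)) a0 b0 => a b; lra.
Qed.

Lemma tanhN x : tanh (- x) = - tanh x.
Proof. by rewrite /tanh opprK -mulNr opprB [expR x + _]addrC. Qed.

Lemma tanh_le x : `|tanh x| <= 2 * `|x|.
Proof.
wlog x0 : x / 0 <= x.
  move=> h; have [|/ltW x0] := leP 0 x; first exact: h.
  by rewrite -normrN -tanhN -[`|x|]normrN; apply: h; rewrite oppr_ge0.
have a0 : 0 < expR x := expR_gt0 x; have b0 : 0 < expR (- x) := expR_gt0 _.
have ab0 : 0 < expR x + expR (- x) by rewrite addr_gt0.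
have ba : expR (- x) = expR x * expR (- (2 * x)).
  by rewrite -expRD; congr expR; ring.
have h : 1 - 2 * x <= expR (- (2 * x)) by apply: le_trans (expR_ge1Dx _); lra.
have h1 : expR (- (2 * x)) <= 1 by rewrite expR_le1 oppr_le0 mulr_ge0.
have h2 : expR (- x) <= expR x.
  by rewrite ba -[leRHS]mulr1; apply: ler_wpM2l => //; exact: ltW.
have h3 : expR x * (1 - 2 * x) <= expR (- x).
  by rewrite ba; apply: ler_wpM2l => //; exact: ltW.
have xb : 0 <= x * expR (- x) by rewrite mulr_ge0// ltW.
rewrite [`|x|]ger0_norm// ger0_norm; last by apply: divr_ge0; rewrite ?subr_ge0// ltW.
rewrite /tanh ler_pdivrMr//.
move: (expR x) (expR (- x)) a0 b0 h2 h3 xb => a b; nra.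
Qed.

Lemma measurable_tanh : measurable_fun setT tanh.
Proof.
have mN : measurable_fun setT (fun x : R => expR (- x)).
  by apply: measurableT_comp => //; exact: measurable_expR.
have -> : tanh = (fun x => (expR x - expR (- x)) * expR (- ln (expR x + expR (- x)))).
  by apply/funext => x; rewrite /tanh [expR (- ln _)]expRN lnK// posrE addr_gt0 ?expR_gt0.
apply: measurable_funM; first exact: measurable_funB.
apply: (@measurableT_comp _ _ _ _ _ _ (@expR R)) => //.
apply: (@measurableT_comp _ _ _ _ _ _ (-%R : R -> R)) => //.
apply: measurableT_comp; first exact: measurable_ln.
exact: measurable_funD.
Qed.

(** Conditional probability that a Gaussian of mean u * sg c takes the value
    sg b * x, given that it takes one of the values x and -x. *)
Definition flip_weight (u : R) (c b : bool) (x : R) : R := (1 + sg R c * sg R b * tanh (u * x)) / 2.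

Lemma sg_cases b : sg R b = 1 \/ sg R b = -1.
Proof. by rewrite /sg; case: b; rewrite ?expr1 ?expr0; [right|left]. Qed.

Lemma flip_weight_ge0 u c b x : 0 <= flip_weight u c b x.
Proof.
have := tanh_lt1 (u * x); rewrite ltr_norml /flip_weight => /andP[h1 h2]; rewrite divr_ge0//.
by case: (sg_cases c) => ->; case: (sg_cases b) => ->; lra.
Qed.

Lemma flip_weight_sum u c x : flip_weight u c true x + flip_weight u c false x = 1.
Proof. by rewrite /flip_weight /sg expr1 expr0; field. Qed.

Lemma measurable_flip_weight u c b : measurable_fun setT (flip_weight u c b).
Proof.
apply: measurable_funM => //; apply: measurable_funD => //; apply: measurable_funM => //.
apply: measurableT_comp; first exact: measurable_tanh.
exact: measurable_funM.
Qed.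

Definition gpdf : R -> R := normal_pdf 0 1.

Lemma gpdfE x : gpdf x = gpdf 0 * expR (- (x ^+ 2 / 2)).
Proof.
rewrite /gpdf /normal_pdf oner_eq0 /normal_fun !subr0 expr1n.
by rewrite expr0n /= oppr0 mul0r expR0 mulr1 mulNr.
Qed.

(** The densities at y of the Gaussians of means u and -u have ratio
    exp(2 u y), which is (1 + tanh) / (1 - tanh) at u y. *)
Lemma gpdf_mix u c y :
  flip_weight u c false y * gpdf (y - u) + flip_weight u c true (- y) * gpdf (- y - u) = gpdf (y - u * sg R c).
Proof.
have e1 : gpdf (y - u) = gpdf 0 * expR (- (y ^+ 2 / 2) - u ^+ 2 / 2) * expR (u * y).
  by rewrite [LHS]gpdfE -mulrA -expRD; congr (_ * expR _); field.
have e2 : gpdf (- y - u) = gpdf 0 * expR (- (y ^+ 2 / 2) - u ^+ 2 / 2) * expR (- (u * y)).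
  by rewrite [LHS]gpdfE -mulrA -expRD; congr (_ * expR _); field.
have e3 : gpdf (y - u * sg R c) = gpdf 0 * expR (- (y ^+ 2 / 2) - u ^+ 2 / 2) * expR (sg R c * (u * y)).
  rewrite [LHS]gpdfE -mulrA -expRD; congr (_ * expR _).
  by case: (sg_cases c) => ->; field.
rewrite e1 e2 e3 /flip_weight [u * - y]mulrN tanhN /tanh.
have s1 : sg R false = 1 by rewrite /sg expr0.
have s2 : sg R true = -1 by rewrite /sg expr1.
have a0 : 0 < expR (u * y) := expR_gt0 _; have b0 : 0 < expR (- (u * y)) := expR_gt0 _.
rewrite s1 s2; case: (sg_cases c) => ->; rewrite ?[1 * (u * y)]mul1r ?[-1 * (u * y)]mulN1r.
  by move: (expR (u * y)) (expR (- (u * y))) a0 b0 => a b a0 b0; field; rewrite gt_eqF// addr_gt0.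
by move: (expR (u * y)) (expR (- (u * y))) a0 b0 => a b a0 b0; field; rewrite gt_eqF// addr_gt0.
Qed.

Local Notation lambda := (@lebesgue_measure R).

Lemma integral_shift (u : R) (f : R -> \bar R) : measurable_fun setT f -> (forall x, 0 <= f x)%E ->
  (\int[lambda]_x f (x + u)%R = \int[lambda]_x f x)%E.
Proof.
move=> mf f0.
transitivity (\int[lambda]_x (f (x + u)%R * ((cst 1 : R -> R) x)%:E))%E.
  by apply: eq_integral => x _; rewrite mule1.
transitivity (\int[lambda]_x (f (idfun x) * ((cst 1 : R -> R) x)%:E))%E; last first.
  by apply: eq_integral => x _; rewrite mule1.
apply: (@wlaw_transfer _ _ _ (measurableTypeR R) (measurableTypeR R) R R lambda lambda (cst 1) (cst 1) (fun x : R => x + u) idfun f) => //.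
- exact: measurable_funD.
- exact: measurable_id.
move=> B mB.
have mB' : measurable ((fun x : R => x + u) @^-1` B).
  by rewrite -[X in measurable X]setTI; apply: measurable_funD.
rewrite preimage_id; transitivity (lambda ((fun x : R => x + u) @^-1` B)).
  exact: integral_one.
by rewrite lebesgue_measure_shift//; apply/esym; exact: integral_one.
Qed.

Lemma integral_opp (f : R -> \bar R) : measurable_fun setT f -> (forall x, 0 <= f x)%E ->
  (\int[lambda]_x f (- x)%R = \int[lambda]_x f x)%E.
Proof.
move=> mf f0.
transitivity (\int[lambda]_x (f (- x)%R * ((cst 1 : R -> R) x)%:E))%E.
  by apply: eq_integral => x _; rewrite mule1.
transitivity (\int[lambda]_x (f (idfun x) * ((cst 1 : R -> R) x)%:E))%E; last first.
  by apply: eq_integral => x _; rewrite mule1.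
apply: (@wlaw_transfer _ _ _ (measurableTypeR R) (measurableTypeR R) R R lambda lambda (cst 1) (cst 1) (-%R : R -> R) idfun f) => //.
- exact: measurable_id.
move=> B mB.
have mB' : measurable ((-%R : R -> R) @^-1` B).
  by rewrite -[X in measurable X]setTI; apply: oppr_measurable.
rewrite preimage_id; transitivity (lambda ((-%R : R -> R) @^-1` B)).
  exact: integral_one.
by rewrite lebesgue_measure_opp//; apply/esym; exact: integral_one.
Qed.

Lemma measurable_gpdf : measurable_fun setT gpdf.
Proof. exact: measurable_normal_pdf. Qed.

Lemma gpdf_ge0 x : 0 <= gpdf x. Proof. exact: normal_pdf_ge0. Qed.

Section Gaussian.
Context d (Omega : measurableType d) (P : probability Omega R) (W : {RV P >-> R}).
Hypothesis gW : standard_gaussian W.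

Lemma integral_gauss (f : R -> \bar R) : measurable_fun setT f -> (forall x, 0 <= f x)%E ->
  (\int[P]_w f (W w) = \int[lambda]_x (f x * (gpdf x)%:E))%E.
Proof.
move=> mf f0.
transitivity (\int[P]_w (f (W w) * ((cst 1 : Omega -> R) w)%:E))%E.
  by apply: eq_integral => x _; rewrite mule1.
apply: (@wlaw_transfer _ _ _ Omega (measurableTypeR R) R R P lambda (cst 1) gpdf W idfun f) => //.
- exact: measurable_gpdf.
- exact: gpdf_ge0.
- exact: measurable_id.
move=> B mB.
rewrite preimage_id integral_one; last first.
  by rewrite -[X in measurable X]setTI; exact: measurable_funP.
exact: (gW mB).
Qed.

Lemma integral_gauss_shift (u : R) (f : R -> \bar R) : measurable_fun setT f -> (forall x, 0 <= f x)%E ->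
  (\int[P]_w f (u + W w)%R = \int[lambda]_x (f x * (gpdf (x - u)%R)%:E))%E.
Proof.
move=> mf f0.
have mfu : measurable_fun setT (fun x : R => f (u + x)%R).
  by apply: measurableT_comp => //; exact: measurable_funD.
have fu0 x : (0 <= f (u + x)%R)%E by exact: f0.
have := integral_gauss mfu fu0 => /= ->.
have mp : measurable_fun setT (fun x : R => (gpdf x)%:E).
  by apply/measurable_EFinP; exact: measurable_gpdf.
have mg : measurable_fun setT (fun x : R => f (u + x)%R * (gpdf x)%:E)%E.
  exact: emeasurable_funM.
have g0 x : (0 <= f (u + x)%R * (gpdf x)%:E)%E by rewrite mule_ge0// lee_fin gpdf_ge0.
have := integral_shift (- u) mg g0 => /= <-.
by apply: eq_integral => x _; rewrite addrCA subrr addr0.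
Qed.

(** The law of u + W does not involve c: the sign c of the mean only enters
    through the weights of the random sign attached to u + W. *)
Lemma gauss_flip (u : R) (c : bool) (f : R -> \bar R) : measurable_fun setT f -> (forall x, 0 <= f x)%E ->
  (\int[P]_w f (u * sg R c + W w)%R =
   \int[P]_w (f (u + W w)%R * (flip_weight u c false (u + W w))%:E +
               f (- (u + W w))%R * (flip_weight u c true (u + W w))%:E))%E.
Proof.
move=> mf f0.
have mfN : measurable_fun setT (fun x : R => f (- x)%R).
  by apply: measurableT_comp => //; exact: oppr_measurable.
have mh b : measurable_fun setT (fun x : R => (flip_weight u c b x)%:E).
  by apply/measurable_EFinP; exact: measurable_flip_weight.
have mg (v : R) : measurable_fun setT (fun x : R => (gpdf (x - v))%:E).
  apply/measurable_EFinP; apply: measurableT_comp; first exact: measurable_gpdf.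
  exact: measurable_funB.
have h0 b x : (0 <= (flip_weight u c b x)%:E)%E by rewrite lee_fin flip_weight_ge0.
have g0 x : (0 <= (gpdf x)%:E)%E by rewrite lee_fin gpdf_ge0.
rewrite integral_gauss_shift//.
have mF : measurable_fun setT (fun x : R => f x * (flip_weight u c false x)%:E + f (- x)%R * (flip_weight u c true x)%:E)%E.
  by apply: emeasurable_funD; apply: emeasurable_funM.
have F0 x : (0 <= f x * (flip_weight u c false x)%:E + f (- x)%R * (flip_weight u c true x)%:E)%E.
  by rewrite adde_ge0// mule_ge0.
have := integral_gauss_shift u mF F0 => /= ->.
transitivity (\int[lambda]_x (f x * (flip_weight u c false x)%:E * (gpdf (x - u))%:E +
     f (- x)%R * (flip_weight u c true x)%:E * (gpdf (x - u))%:E))%E; last first.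
  by apply: eq_integral => x _; rewrite ge0_muleDl// mule_ge0.
have mA : measurable_fun setT (fun x : R => f x * (flip_weight u c false x)%:E * (gpdf (x - u))%:E)%E.
  by do 2 apply: emeasurable_funM => //.
have mG : measurable_fun setT (fun x : R => f (- x)%R * (flip_weight u c true x)%:E * (gpdf (x - u))%:E)%E.
  by do 2 apply: emeasurable_funM => //.
have mGN : measurable_fun setT (fun x : R => f (- - x)%R * (flip_weight u c true (- x))%:E * (gpdf (- x - u))%:E)%E.
  by apply: (measurableT_comp mG); exact: oppr_measurable.
have A0 x : (0 <= f x * (flip_weight u c false x)%:E * (gpdf (x - u))%:E)%E by rewrite !mule_ge0.
have G0 x : (0 <= f (- x)%R * (flip_weight u c true x)%:E * (gpdf (x - u))%:E)%E by rewrite !mule_ge0.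
rewrite ge0_integralD//=.
have := integral_opp mG G0 => /= <-.
rewrite -ge0_integralD//=.
apply: eq_integral => x _; rewrite opprK -!muleA -ge0_muleDr ?mule_ge0//.
by rewrite -!EFinM -EFinD gpdf_mix.
Qed.

End Gaussian.

End Tanh.

(** * Independent coordinates *)
Section CoordinateSpace.
Variables (R : realType) (I : finType).
Notation cspace := (g_sigma_algebraType (@coord_sets I R)).

Lemma measurable_coord (e : I) : measurable_fun [set: cspace] (fun x : cspace => x e).
Proof.
move=> _ B mB; rewrite setTI; apply: sub_sigma_algebra.
by exists e => //; exists B => //; rewrite setTI.
Qed.

Lemma measurable_into d (T : measurableType d) (f : T -> cspace) :
  (forall e, measurable_fun setT (fun t => f t e)) -> measurable_fun setT f.
Proof.
move=> h; apply: (@measurability _ _ _ _ _ f (@coord_sets I R)) => //.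
move=> _ [_ [e _ [B mB <-]] <-]; rewrite !setTI.
by rewrite -[X in measurable X]setTI; exact: (h e).
Qed.

Definition rect (B : I -> set R) : set cspace := [set x | forall e, B e (x e)].

Lemma measurable_rect B : (forall e, measurable (B e)) -> measurable (rect B).
Proof.
move=> mB; have h (s : seq I) : measurable [set x : cspace | forall e, e \in s -> B e (x e)].
  elim: s => [|e s IHs].
    by rewrite (_ : [set _ | _] = setT)//; apply/seteqP; split.
  rewrite (_ : [set _ | _] = ((fun x : cspace => x e) @^-1` B e) `&` [set x : cspace | forall e, e \in s -> B e (x e)]).
    apply: measurableI => //; rewrite -[X in measurable X]setTI.
    exact: measurable_coord.
  apply/seteqP; split=> x /= hx.
    split; first by apply: hx; rewrite mem_head.
    by move=> e' es; apply: hx; rewrite in_cons es orbT.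
  by case: hx => h1 h2 e'; rewrite in_cons => /orP[/eqP ->//|]; exact: h2.
rewrite (_ : rect B = [set x : cspace | forall e, e \in enum I -> B e (x e)]); first exact: h.
by apply/seteqP; split => x /= hx e; [move=> _; exact: hx|apply: hx; rewrite mem_enum].
Qed.

(** Rectangles are stable under intersection and generate the product
    sigma-algebra. *)
Lemma rect_unique (m1 m2 : {measure set cspace -> \bar R}) :
  (m1 setT < +oo)%E ->
  (forall B, (forall e, measurable (B e)) -> m1 (rect B) = m2 (rect B)) ->
  forall A, measurable A -> m1 A = m2 A.
Proof.
move=> m1oo h A mA.
pose G : set (set cspace) := [set X | exists2 B, (forall e, measurable (B e)) & X = rect B].
have GT : G setT by exists (fun=> setT) => //; apply/seteqP; split.
apply: (measure_unique G (fun=> setT)) => //.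
- apply/seteqP; split; last first.
    by apply: smallest_sub; [exact: sigma_algebra_measurable|move=> _ [B mB ->]; exact: measurable_rect].
  apply: smallest_sub; first exact: smallest_sigma_algebra.
  move=> _ [e _ [C mC <-]]; apply: sub_sigma_algebra.
  exists (fun e' => if e' == e then C else setT); first by move=> e'; case: ifP.
  rewrite setTI; apply/seteqP; split => x /= hx.
    by move=> e'; case: eqP => [->|].
  by have := hx e; rewrite eqxx.
- move=> _ _ [B mB ->] [C mC ->]; exists (fun e => B e `&` C e); first by move=> e; exact: measurableI.
  apply/seteqP; split => x /=; first by case=> h1 h2 e; split.
  by move=> hx; split=> e; have [] := hx e.
- by apply/seteqP; split => // x _; exists 0%N.
- by move=> _ [B mB ->]; exact: h.
Qed.

End CoordinateSpace.

Section Independence.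
Context d (Omega : measurableType d) (R : realType) (P : probability Omega R).
Variables (I : finType) (W : I -> {RV P >-> R}).
Hypothesis indW : mutually_independent W.

Let E (g : R -> R) (i : I) : R := fine (\int[P]_w (g (W i w))%:E).

Let inte (g : R -> R) i : measurable_fun setT g -> (forall x, 0 <= g x <= 1) ->
  (\int[P]_w (g (W i w))%:E = (E g i)%:E)%E.
Proof.
move=> mg g01; rewrite /E fineK// ge0_fin_numE; last first.
  by apply: integral_ge0 => x _; rewrite lee_fin; have /andP[] := g01 (W i x).
apply: (@le_lt_trans _ _ (\int[P]_w (cst 1%E w))%E); last first.
  rewrite integral_cst// mul1e; apply: le_lt_trans (probability_le1 P measurableT) _.
  exact: ltry.
apply: ge0_le_integral => //.
- by move=> x _; rewrite lee_fin; have /andP[] := g01 (W i x).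
- by apply/measurable_EFinP; exact: measurableT_comp.
- by move=> x _; rewrite lee_fin; have /andP[] := g01 (W i x).
Qed.

(** The indicators of the events are replaced one at a time by functions: for a
    fixed product of the other factors, both sides are integrals of the factor
    of index j against two weighted laws of W j, which agree on measurable sets
    by the previous step. *)
Lemma indep_prod (g : I -> R -> R) :
  (forall i, measurable_fun setT (g i)) -> (forall i x, 0 <= g i x <= 1) ->
  (\int[P]_w (\prod_i g i (W i w))%:E = (\prod_i fine (\int[P]_w (g i (W i w))%:E))%:E)%E.
Proof.
move=> mg g01.
pose good (S : {set I}) := forall g : I -> R -> R,
  (forall i, measurable_fun setT (g i)) -> (forall i x, 0 <= g i x <= 1) ->
  (forall i, i \notin S -> exists2 B : set R, measurable B & g i = \1_B) ->
  (\int[P]_w (\prod_i g i (W i w))%:E = (\prod_i E (g i) i)%:E)%E.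
suff h : good finset.setT by apply: h => // i; rewrite !inE.
move=> {g mg g01}; move: (finset.setT : {set I}) => S.
elim: {S}#|S| {-2}S (erefl #|S|) => [|n IHn] S cS g mg g01 gS.
  have {cS} S0 : S = finset.set0 by apply/eqP; rewrite -cards_eq0 cS.
  have hB i : {B : set R | measurable B /\ g i = \1_B}.
    apply: cid; have [|B mB gB] := gS i; first by rewrite S0 inE.
    by exists B.
  pose B i := sval (hB i).
  have mB i : measurable (B i) by exact: (svalP (hB i)).1.
  have gB i : g i = \1_(B i) by exact: (svalP (hB i)).2.
  have mWB i : measurable (W i @^-1` B i).
    by rewrite -[X in measurable X]setTI; exact: measurable_funP.
  have mI : measurable [set w | forall i, i \in (finset.setT : {set I}) -> B i (W i w)].
    have -> : [set w | forall i, i \in (finset.setT : {set I}) -> B i (W i w)] =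
        (fun w => (fun i => W i w) : g_sigma_algebraType (@coord_sets I R)) @^-1` rect B.
      by apply/seteqP; split => w /= hw i; [apply: hw; rewrite inE|move=> _; exact: hw].
    rewrite -[X in measurable X]setTI.
    apply: (@measurable_into R I _ _ (fun w i => W i w) _ measurableT); last exact: measurable_rect.
    by move=> e; exact: measurable_funP.
  have EB i : (P (W i @^-1` B i) = (E (g i) i)%:E)%E.
    rewrite -inte// -[LHS](integral_one P (mWB i)) integral_mkcond; apply: eq_integral => w _.
    rewrite patchE gB indicE; have -> : (w \in W i @^-1` B i) = (W i w \in B i).
      by apply/idP/idP; rewrite !inE.
    by case: ifPn.
  have prE : (\prod_(i in (finset.setT : {set I})) P (W i @^-1` B i) = (\prod_i E (g i) i)%:E)%E.
    transitivity (\prod_i (E (g i) i)%:E)%E.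
      by apply: eq_big => i; [rewrite finset.in_setT|rewrite EB].
    by apply/esym; apply: (big_morph EFin EFinM).
  rewrite -prE -(indW _ mB) -[RHS](integral_one P mI) [RHS]integral_mkcond.
  apply: eq_integral => w _; rewrite patchE; case: ifPn => [|hw].
    rewrite inE /= => hw; congr EFin; rewrite big1// => i _.
    by rewrite gB indicE mem_set//; apply: hw; rewrite inE.
  have [i hi] : exists i, ~ B i (W i w).
    apply: contrapT => h; move/negP: hw; apply; rewrite inE /= => i _.
    by apply: contrapT => hi; apply: h; exists i.
  by congr EFin; rewrite (bigD1 i)//= gB indicE memNset// mul0r.
have /card_gt0P[j jS] : (0 < #|S|)%N by rewrite cS.
pose h1 w := \prod_(i | i != j) g i (W i w).
pose c := \prod_(i | i != j) E (g i) i.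
have h1_ge0 w : 0 <= h1 w by apply: prodr_ge0 => i _; have /andP[] := g01 i (W i w).
have mh1 : measurable_fun setT h1.
  have -> : h1 = (fun w => \prod_(i <- [seq i <- index_enum I | i != j]) g i (W i w)).
    by apply/funext => w; rewrite big_filter.
  by apply: measurable_prod => i _; apply: measurableT_comp => //; exact: mg.
have c0 : 0 <= c.
  apply: prodr_ge0 => i _; apply: fine_ge0; apply: integral_ge0 => w _.
  by rewrite lee_fin; have /andP[] := g01 i (W i w).
transitivity (\int[P]_w ((g j (W j w))%:E * (h1 w)%:E))%E.
  by apply: eq_integral => w _; rewrite -EFinM (bigD1 j).
transitivity (\int[P]_w ((g j (W j w))%:E * ((cst c : Omega -> R) w)%:E))%E; last first.
  transitivity (\int[P]_w ((g j (W j w))%:E * c%:E))%E => //.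
  rewrite ge0_integralZr//.
  - by rewrite /= inte// -EFinM [in RHS](bigD1 j).
  - by apply/measurable_EFinP; apply: measurableT_comp => //; exact: mg.
  - by move=> w _; rewrite lee_fin; have /andP[] := g01 j (W j w).
apply: (@wlaw_transfer _ _ _ Omega Omega R R P P h1 (cst c) (W j) (W j) (fun x => (g j x)%:E)) => //; last first.
- by move=> x; rewrite lee_fin; have /andP[] := g01 j x.
- by apply/measurable_EFinP; exact: mg.
move=> B mB.
pose g' i := if i == j then \1_B else g i : R -> R.
have mg' i : measurable_fun setT (g' i) by rewrite /g'; case: ifP.
have g'01 i x : 0 <= g' i x <= 1.
  by rewrite /g'; case: ifP => // _; rewrite indicE; case: (_ \in _); rewrite lexx ler01.
have cS' : #|S :\ j| = n by move: cS; rewrite (cardsD1 j S) jS => -[].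
have h := IHn (S :\ j) cS' g' mg' g'01.
have {h} h : (\int[P]_w (\prod_i g' i (W i w))%:E = (\prod_i E (g' i) i)%:E)%E.
  apply: h => i; rewrite !inE negb_and negbK /g'; case: eqP => [_ _|_ /= iS]; first by exists B.
  exact: gS.
have mWB : measurable (W j @^-1` B).
  by rewrite -[X in measurable X]setTI; exact: measurable_funP.
transitivity (\int[P]_w (\prod_i g' i (W i w))%:E)%E.
  rewrite integral_mkcond; apply: eq_integral => w _; rewrite patchE.
  rewrite (bigD1 j)//= {1}/g' eqxx indicE.
  have -> : \prod_(i | i != j) g' i (W i w) = h1 w.
    by apply: eq_bigr => i /negbTE ij; rewrite /g' ij.
  have -> : (w \in W j @^-1` B) = (W j w \in B) by apply/idP/idP; rewrite !inE.
  by case: ifPn => _; rewrite ?mul1r ?mul0r.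
rewrite h (bigD1 j)//=.
have -> : \prod_(i | i != j) E (g' i) i = c.
  by apply: eq_bigr => i /negbTE ij; rewrite /g' ij.
rewrite EFinM -inte// {1}/g' eqxx.
transitivity (\int[P]_(w in W j @^-1` B) (cst c%:E w))%E => //.
rewrite integral_cst// muleC; congr (_ * _)%E.
rewrite -[RHS](integral_one P mWB) [RHS]integral_mkcond; apply: eq_integral => w _.
rewrite patchE indicE.
have -> : (w \in W j @^-1` B) = (W j w \in B) by apply/idP/idP; rewrite !inE.
by case: ifPn.
Qed.

End Independence.

Section Mixture.
Context d (Omega : measurableType d) (R : realType) (P : probability Omega R).
Variables (I : finType) (W : I -> {RV P >-> R}) (u : R) (c : I -> bool).
Hypothesis indW : mutually_independent W.
Hypothesis gW : forall i, standard_gaussian (W i).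
Notation cspace := (g_sigma_algebraType (@coord_sets I R)).

Let Xv (w : Omega) : cspace := fun e => u * sg R (c e) + W e w.
Let Xe (eta : {ffun I -> bool}) (w : Omega) : cspace := fun e => sg R (eta e) * (u + W e w).
Let flip_prod (eta : {ffun I -> bool}) (w : Omega) : R := \prod_e flip_weight u (c e) (eta e) (u + W e w).

Let mXv : measurable_fun setT Xv.
Proof. by apply: measurable_into => e; apply: measurable_funD. Qed.

Let mXe eta : measurable_fun setT (Xe eta).
Proof.
apply: measurable_into => e; apply: measurable_funM => //.
exact: measurable_funD.
Qed.

Let measurable_flip_prod eta : measurable_fun setT (flip_prod eta).
Proof.
apply: measurable_prod => e _.
apply: (measurableT_comp (measurable_flip_weight u (c e) (eta e))).
exact: measurable_funD.
Qed.

Let flip_prod_ge0 eta w : 0 <= flip_prod eta w.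
Proof. by apply: prodr_ge0 => e _; exact: flip_weight_ge0. Qed.

Let m1 : {measure set cspace -> \bar R} :=
  wlaw P (@measurable_cst _ _ Omega R setT 1) (fun=> ler01) mXv.

Let eta0 : {ffun I -> bool} := [ffun=> false].
Let nE := size (enum {ffun I -> bool}).
Let etk (k : nat) : {ffun I -> bool} := nth eta0 (enum {ffun I -> bool}) k.
Let mk (k : nat) : {measure set cspace -> \bar R} :=
  wlaw P (measurable_flip_prod (etk k)) (flip_prod_ge0 (etk k)) (mXe (etk k)).
Let m2 : {measure set cspace -> \bar R} := msum mk nE.

Let m2E A : (m2 A = \sum_(eta : {ffun I -> bool}) \int[P]_(w in Xe eta @^-1` A) (flip_prod eta w)%:E)%E.
Proof.
rewrite /m2 /= /msum /mk /=.
rewrite -(big_mkord xpredT (fun k => wlaw P (measurable_flip_prod (etk k)) (flip_prod_ge0 (etk k)) (mXe (etk k)) A)).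
rewrite /nE -(big_nth eta0 xpredT (fun eta => wlaw P (measurable_flip_prod eta) (flip_prod_ge0 eta) (mXe eta) A)).
by rewrite big_enum.
Qed.

Let preX (X : Omega -> cspace) (A : set cspace) : measurable_fun setT X -> measurable A ->
  measurable (X @^-1` A).
Proof. by move=> mX mA; rewrite -[X in measurable X]setTI; exact: mX. Qed.

Let restrict_int (X : Omega -> cspace) (h : Omega -> R) (B : I -> set R) :
  (\int[P]_(w in X @^-1` rect B) (h w)%:E = \int[P]_w ((\prod_e \1_(B e) (X w e)) * h w)%:E)%E.
Proof.
rewrite integral_mkcond; apply: eq_integral => w _; rewrite patchE; case: ifPn => [|hw].
  rewrite inE /= => hw; congr EFin; rewrite big1 ?mul1r// => e _.
  by rewrite indicE mem_set.
have [e he] : exists e, ~ B e (X w e).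
  apply: contrapT => h'; move/negP: hw; apply; rewrite inE /= => e.
  by apply: contrapT => he; apply: h'; exists e.
by congr EFin; rewrite (bigD1 e)//= indicE memNset// !mul0r.
Qed.

Let gsum (B : I -> set R) (e : I) (x : R) : R :=
  \1_(B e) (u + x) * flip_weight u (c e) false (u + x) + \1_(B e) (- (u + x)) * flip_weight u (c e) true (u + x).

Let indic01 (B : set R) (x : R) : (0 <= (\1_B x : R) <= 1).
Proof. by rewrite indicE; case: (_ \in _); rewrite lexx ler01. Qed.

(** Both sides are finite measures in A; on rectangles they factorise over the
    coordinates and [gauss_flip] applies to each factor. *)
Lemma mixture_law (A : set cspace) : measurable A ->
  P (Xv @^-1` A) =
  (\int[P]_w (\sum_(eta : {ffun I -> bool}) flip_prod eta w * \1_A (Xe eta w))%:E)%E.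
Proof.
move=> mA.
have m1E X : measurable X -> m1 X = P (Xv @^-1` X).
  by move=> mX; apply: integral_one; exact: preX.
have -> : P (Xv @^-1` A) = m2 A.
  rewrite -m1E//; apply: rect_unique => //.
    by rewrite m1E//; apply: le_lt_trans (probability_le1 P _) _; [exact: preX|exact: ltry].
  move=> B mB; rewrite m2E.
  transitivity (\int[P]_w (\prod_e \1_(B e) (u * sg R (c e) + W e w))%:E)%E.
    have := restrict_int Xv (cst 1) B; rewrite /m1 /= /wlaw => ->.
    by apply: eq_integral => w _; rewrite mulr1.
  rewrite (indep_prod indW (g := fun e x => \1_(B e) (u * sg R (c e) + x))); last 2 first.
  - move=> e; apply: measurableT_comp; first exact: measurable_indic.
    exact: measurable_funD.
  - by move=> e x; exact: indic01.
  transitivity (\int[P]_w (\prod_e gsum B e (W e w))%:E)%E; last first.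
    rewrite (eq_integral (fun w => \sum_(eta : {ffun I -> bool})
        ((\prod_e \1_(B e) (Xe eta w e)) * flip_prod eta w)%:E)%E); last first.
      move=> w _; rewrite sumEFin; congr EFin.
      under [RHS]eq_bigr => eta _ do rewrite /flip_prod -big_split /=.
      rewrite -(bigA_distr_bigA (fun e b => \1_(B e) (sg R b * (u + W e w)) * flip_weight u (c e) b (u + W e w))).
      apply: eq_bigr => e _; rewrite big_bool /= /gsum /sg expr1 expr0 mulN1r mul1r.
      by rewrite addrC.
    rewrite ge0_integral_sum//.
    - by apply: eq_bigr => eta _; rewrite restrict_int.
    - move=> eta; apply/measurable_EFinP; apply: measurable_funM => //.
      apply: measurable_prod => e _; apply: (measurableT_comp (measurable_indic (mB e))).
      by apply: measurable_funM => //; exact: measurable_funD.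
    - move=> eta w _; rewrite lee_fin; apply: mulr_ge0 => //.
      by apply: prodr_ge0 => e _; have /andP[] := indic01 (B e) (Xe eta w e).
  rewrite (indep_prod indW (g := gsum B)).
  - congr EFin; apply: eq_bigr => e _; congr fine.
    have mf : measurable_fun setT (fun x : R => (\1_(B e) x : R)%:E).
      by apply/measurable_EFinP; exact: measurable_indic.
    have f0 x : (0 <= (\1_(B e) x : R)%:E)%E by rewrite lee_fin; have /andP[] := indic01 (B e) x.
    have := gauss_flip (gW e) u (c e) mf f0 => /= ->.
    by apply: eq_integral => w _; rewrite -!EFinM -EFinD.
  - move=> e; rewrite /gsum; apply: measurable_funD; apply: measurable_funM.
    + by apply: measurableT_comp; [exact: measurable_indic|exact: measurable_funD].
    + by apply: (measurableT_comp (measurable_flip_weight _ _ _)); exact: measurable_funD.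
    + apply: measurableT_comp; first exact: measurable_indic.
      by apply: measurableT_comp; [exact: oppr_measurable|exact: measurable_funD].
    + by apply: (measurableT_comp (measurable_flip_weight _ _ _)); exact: measurable_funD.
  - move=> e x; rewrite /gsum.
    have h1 := flip_weight_ge0 u (c e) true (u + x); have h2 := flip_weight_ge0 u (c e) false (u + x).
    have h3 := flip_weight_sum u (c e) (u + x).
    have /andP[i1 i2] := indic01 (B e) (u + x); have /andP[i3 i4] := indic01 (B e) (- (u + x)).
    move: (flip_weight _ _ _ _) (flip_weight _ _ _ _) h1 h2 h3 => p q h1 h2 h3.
    move: (\1_(B e) _) (\1_(B e) _) i1 i2 i3 i4 => a b i1 i2 i3 i4.
    by apply/andP; split; nra.
rewrite m2E.
transitivity (\sum_(eta : {ffun I -> bool}) \int[P]_w (flip_prod eta w * \1_A (Xe eta w))%:E)%E.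
  apply: eq_bigr => eta _; rewrite integral_mkcond; apply: eq_integral => w _.
  rewrite patchE indicE; have -> : (w \in Xe eta @^-1` A) = (Xe eta w \in A).
    by apply/idP/idP; rewrite !inE.
  by case: ifPn => _; rewrite ?mulr1 ?mulr0.
rewrite -ge0_integral_sum//.
- by apply: eq_integral => w _; rewrite sumEFin.
- move=> eta; apply/measurable_EFinP; apply: measurable_funM => //.
  by apply: (measurableT_comp (measurable_indic mA)); exact: mXe.
- by move=> eta w _; rewrite lee_fin mulr_ge0// indicE.
Qed.

End Mixture.

(** * Transfer to Gaussian samples *)
Section Tail.
Context d (Omega : measurableType d) (R : realType) (P : probability Omega R) (W : {RV P >-> R}).
Hypothesis gW : standard_gaussian W.
Local Notation lambda := (@lebesgue_measure R).

Let integral_gpdf (v : R) : (\int[lambda]_x (gpdf (x - v))%:E = 1)%E.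
Proof.
have m1 : measurable_fun setT (fun _ : R => 1%E : \bar R) by exact: measurable_cst.
have := integral_gauss_shift gW v m1 (fun=> lee01) => /= h.
transitivity (\int[P]_w (cst 1%E w))%E; last first.
  by rewrite integral_cst// mul1e; exact: probability_setT.
by rewrite h; apply: eq_integral => x _; rewrite mul1e.
Qed.

(** Chernoff's bound at parameter 1. *)
Lemma gauss_tail (u ell : R) : `|u| <= 1 ->
  (P [set w | (ell < `|u + W w|)%R] <= (2 * expR (2 - ell))%:E)%E.
Proof.
move=> u1; pose f (x : R) : \bar R := (expR (- ell) * (expR x + expR (- x)))%:E.
have mN : measurable_fun setT (fun x : R => expR (- x)).
  by apply: measurableT_comp => //; exact: measurable_expR.
have mf : measurable_fun setT f.
  apply/measurable_EFinP; apply: measurable_funM => //; exact: measurable_funD.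
have f0 x : (0 <= f x)%E by rewrite lee_fin mulr_ge0 ?addr_ge0 ?expR_ge0.
have mE : measurable [set w | (ell < `|u + W w|)%R].
  have mg : measurable_fun setT (fun w => `|u + W w|).
    by apply: measurableT_comp => //; exact: measurable_funD.
  rewrite -[X in measurable X]setTI.
  have -> : [set w | (ell < `|u + W w|)%R] = (fun w => `|u + W w|) @^-1` `]ell, +oo[%classic.
    by apply/seteqP; split => w /=; rewrite in_itv/= andbT.
  exact: mg.
apply: (@le_trans _ _ (\int[P]_w f (u + W w)%R)%E).
  have -> : P [set w | (ell < `|u + W w|)%R] = (\int[P]_w (\1_[set w | (ell < `|u + W w|)%R] w)%:E)%E.
    by rewrite integral_indic// setIT.
  apply: ge0_le_integral => //.
  - by apply/measurable_EFinP; exact: measurable_indic.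
  - by apply: (measurableT_comp mf); exact: measurable_funD.
  - move=> w _; rewrite indicE; case: (boolP (w \in _)) => [|_]; last exact: f0.
    rewrite inE /= => hw; rewrite lee_fin mulrDr -!expRD.
    have h (y : R) : 1 <= expR y \/ y < 0.
      by have [y0|y0] := leP 0 y; [left; rewrite -[leLHS]expR0 ler_expR|right].
    have e1 := expR_ge0 (- ell + (u + W w)); have e2 := expR_ge0 (- ell + - (u + W w)).
    move: hw; rewrite real_ltr_normr ?num_real// => /orP[hw|hw].
      by case: (h (- ell + (u + W w))) => ?; lra.
    by case: (h (- ell + - (u + W w))) => ?; lra.
rewrite (integral_gauss_shift gW u mf f0).
have gsh (s x : R) : s ^+ 2 = 1 -> expR (s * x) * gpdf (x - u) = expR (s * u + 2^-1) * gpdf (x - (u + s)).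
  move=> s1; rewrite [gpdf (x - u)]gpdfE [gpdf (x - (u + s))]gpdfE mulrCA -expRD [RHS]mulrCA -expRD.
  congr (_ * expR _).
  have -> : (x - (u + s)) ^+ 2 = (x - u) ^+ 2 - 2 * (x - u) * s + s ^+ 2 by ring.
  by rewrite s1; field.
have mg v c : measurable_fun setT (fun x : R => (c * gpdf (x - v))%:E).
  apply/measurable_EFinP; apply: measurable_funM => //.
  apply: measurableT_comp; first exact: measurable_gpdf.
  exact: measurable_funB.
have fE x : (f x * (gpdf (x - u))%:E = (expR (- ell + (u + 2^-1)) * gpdf (x - (u + 1)))%:E +
   (expR (- ell + (- u + 2^-1)) * gpdf (x - (u - 1)))%:E)%E.
  rewrite /f -EFinM -EFinD; congr EFin.
  have g1 := gsh 1 x (expr1n _ 2); have g2 := gsh (-1) x (sqrr_sign R true).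
  rewrite !mul1r in g1; rewrite !mulN1r in g2.
  by rewrite !(expRD (- ell)) -!mulrA -mulrDr -g1 -g2 -mulrDl.
have int1 v c : (0 <= c)%R -> (\int[lambda]_x (c * gpdf (x - v))%:E = c%:E)%E.
  move=> c0; under eq_integral do rewrite EFinM.
  rewrite ge0_integralZl//.
  - by rewrite integral_gpdf mule1.
  - apply/measurable_EFinP; apply: measurableT_comp; first exact: measurable_gpdf.
    exact: measurable_funB.
  - by move=> x _; rewrite lee_fin gpdf_ge0.
have -> : (\int[lambda]_x (f x * (gpdf (x - u))%:E) = \int[lambda]_x
  ((expR (- ell + (u + 2^-1)) * gpdf (x - (u + 1)))%:E +
   (expR (- ell + (- u + 2^-1)) * gpdf (x - (u - 1)))%:E))%E.
  by apply: eq_integral => x _; exact: fE.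
rewrite ge0_integralD//=; last 4 first.
- by move=> x _; rewrite lee_fin mulr_ge0 ?expR_ge0 ?gpdf_ge0.
- exact: mg.
- by move=> x _; rewrite lee_fin mulr_ge0 ?expR_ge0 ?gpdf_ge0.
- exact: mg.
rewrite !int1 ?expR_ge0// -EFinD lee_fin.
have := u1; rewrite ler_norml => /andP[ua ub].
have a1 : expR (- ell + (u + 2^-1)) <= expR (2 - ell) by rewrite ler_expR; lra.
have a2 : expR (- ell + (- u + 2^-1)) <= expR (2 - ell) by rewrite ler_expR; lra.
lra.
Qed.

End Tail.

Section StateMeasurable.
Context disp (X : measurableType disp) (Y : Type) (N T s : nat).
Variable alg : mem_algorithm X Y N T s.
Context dd (Om : measurableType dd) (D : Om -> 'I_N -> X).
Hypothesis mD : forall i, measurable_fun setT (fun w => D w i).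

Let good (f : Om -> s.-tuple bool) := forall z, measurable (f @^-1` [set z]).

Let measurable_point (z : s.-tuple bool) : measurable [set z].
Proof.
have h (l : seq 'I_s) : measurable [set t : s.-tuple bool | forall i, i \in l -> tnth t i = tnth z i].
  elim: l => [|i l IHl].
    by rewrite (_ : [set _ | _] = setT)//; apply/seteqP; split.
  rewrite (_ : [set _ | _] = ((fun t : s.-tuple bool => tnth t i) @^-1` [set tnth z i]) `&`
       [set t : s.-tuple bool | forall i, i \in l -> tnth t i = tnth z i]).
    apply: measurableI => //; rewrite -[X in measurable X]setTI.
    by apply: measurable_tnth.
  apply/seteqP; split=> x /= hx.
    split; first by apply: hx; rewrite mem_head.
    by move=> e' es; apply: hx; rewrite in_cons es orbT.
  by case: hx => h1 h2 e'; rewrite in_cons => /orP[/eqP ->//|]; exact: h2.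
rewrite (_ : [set z] = [set t : s.-tuple bool | forall i, i \in enum 'I_s -> tnth t i = tnth z i]); first exact: h.
apply/seteqP; split => t /=; first by move=> ->.
by move=> ht; apply: eq_from_tnth => i; apply: ht; rewrite mem_enum.
Qed.

Let good_step f t i : good f -> good (fun w => update alg t i (f w) (D w i)).
Proof.
move=> gf z.
have -> : (fun w => update alg t i (f w) (D w i)) @^-1` [set z] =
   \big[setU/set0]_(z0 : s.-tuple bool) ((f @^-1` [set z0]) `&`
      ((fun w => update alg t i z0 (D w i)) @^-1` [set z])).
  apply/seteqP; split => w /=.
    move=> hw; rewrite -bigcup_seq; exists (f w) => //=; exact: mem_index_enum.
  by rewrite -bigcup_seq => -[z0 _ /= [-> ]].
apply: bigsetU_measurable => z0 _; apply: measurableI; first exact: gf.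
rewrite -[X in measurable X]setTI.
have := measurableT_comp (measurable_update alg t i z0) (mD i).
by apply.
Qed.

Let good_pass f t : good f -> good (fun w => run_pass alg (D w) (f w) t).
Proof.
rewrite /run_pass; elim: (enum 'I_N) f => [|i l IHl] f gf //=.
exact: (IHl _ (good_step t i gf)).
Qed.

Lemma measurable_final_state z : measurable ((fun w => final_state alg (D w)) @^-1` [set z]).
Proof.
have g0 : good (fun _ : Om => [tuple of nseq s false]).
  move=> z'; have [<-|zz] := eqVneq [tuple of nseq s false] z'.
    by rewrite (_ : _ @^-1` _ = setT)//; apply/seteqP; split.
  rewrite (_ : _ @^-1` _ = set0)//; apply/seteqP; split => w //= h.
  by rewrite h eqxx in zz.
have h (l : seq 'I_T) f : good f ->
    measurable ((fun w => foldl (run_pass alg (D w)) (f w) l) @^-1` [set z]).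
  elim: l f => [|t l IHl] f gf; first exact: gf.
  exact: (IHl _ (good_pass t gf)).
exact: (h _ _ g0).
Qed.

End StateMeasurable.

Section Transfer.
Variable R : realType.
Variables (k d N T s : nat).
Let J := (k.-tuple 'I_d : finType).
Let I := ('I_N * J)%type : finType.
Let V_ := {ffun 'I_d -> bool}.
Context disp (Omega : measurableType disp) (P : probability Omega R).
Variables (W : 'I_N * k.-tuple 'I_d -> {RV P >-> R}) (lam : R).
Variable (alg : mem_algorithm (tensor R d k) 'rV[R]_d N T s).
Hypothesis hW : gaussian_noise W.
Hypothesis k_gt0 : (0 < k)%N.
Hypothesis d_gt0 : (0 < d)%N.
Hypothesis lam_ge0 : 0 <= lam.
Variable Tst : V_ -> s.-tuple bool -> bool.

Definition sign_vector (V : V_) : 'rV[R]_d := \row_i sg R (V i).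

Lemma sign_vector_param V : param_space (sign_vector V).
Proof.
rewrite /param_space /= /norm2; congr Num.sqrt; rewrite /dotv.
under eq_bigr do rewrite !mxE -expr2 sg_sqr.
by rewrite sumr_const card_ord.
Qed.

Lemma tensor_power_sign V (j : k.-tuple 'I_d) :
  tensor_power (sign_vector V) j = sg R (tuple_parity j V).
Proof.
rewrite /tensor_power sg_tuple_parity big_tuple.
by apply: eq_bigr => l _; rewrite mxE.
Qed.

(** The modulus of the entries of the signal tensor of a sign vector. *)
Definition snr : R := lam / Num.sqrt (d%:R ^+ k).
Let u := snr.
Hypothesis u_le1 : u <= 1.

Let u_ge0 : 0 <= u. Proof. by rewrite divr_ge0// sqrtr_ge0. Qed.

Notation cspace := (g_sigma_algebraType (@coord_sets ('I_N * k.-tuple 'I_d)%type R)).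

Let unflat (D : cspace) : 'I_N -> tensor R d k := fun i j => D (i, j).

Let AV V : set cspace := [set D | Tst V (final_state alg (unflat D))].

Let mAV V : measurable (AV V).
Proof.
have -> : AV V = \big[setU/set0]_(z <- [seq z <- index_enum (s.-tuple bool) | Tst V z])
    ((fun D : cspace => final_state alg (unflat D)) @^-1` [set z]).
  rewrite -bigcup_seq; apply/seteqP; split => D /=.
    by move=> hD; exists (final_state alg (unflat D)) => //=; rewrite mem_filter hD mem_index_enum.
  by move=> [z /=]; rewrite mem_filter => /andP[hz _] hD; rewrite /AV /= hD.
apply: bigsetU_measurable => z _; apply: measurable_final_state => i.
by apply: measurable_into => j; exact: measurable_coord.
Qed.

Let ev V : set Omega := [set w | Tst V (final_state alg (tpca_data W lam (sign_vector V) w))].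

Let cV (V : V_) (e : 'I_N * k.-tuple 'I_d) : bool := tuple_parity e.2 V.

Let Phi V w : R := \sum_(eta : {ffun I -> bool})
  (\prod_e flip_weight u (cV V e) (eta e) (u + W e w)) * \1_(AV V) ((fun e => sg R (eta e) * (u + W e w)) : cspace).

Let evE V : P (ev V) = (\int[P]_w (Phi V w)%:E)%E.
Proof.
have [indW gW] := hW.
rewrite -(mixture_law u (cV V) indW gW (mAV V)); congr (P _).
apply/seteqP; split => w /=; rewrite /ev /AV /=.
  have -> // : tpca_data W lam (sign_vector V) w = unflat (fun e => u * sg R (cV V e) + W e w).
  apply/funext => i; apply/funext => j; rewrite /tpca_data /unflat tensor_power_sign /u /snr /cV /=.
  by congr (_ + _); rewrite mulrAC.
have -> // : tpca_data W lam (sign_vector V) w = unflat (fun e => u * sg R (cV V e) + W e w).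
apply/funext => i; apply/funext => j; rewrite /tpca_data /unflat tensor_power_sign /u /snr /cV /=.
by congr (_ + _); rewrite mulrAC.
Qed.

Let tw w (i : 'I_N) (j : J) : R := tanh (u * (u + W (i, j) w)).
Let Fw w (t : 'I_T) (i : 'I_N) (st : s.-tuple bool) (x : {ffun J -> bool}) : s.-tuple bool :=
  update alg t i st (fun j => sg R (x j) * (u + W (i, j) w)).
Let st0 : s.-tuple bool := [tuple of nseq s false].

Let PhiE V w : Phi V w =
  \sum_(x : {ffun 'I_N -> {ffun J -> bool}}) prod_law (nu (tw w) V) x * (Tst V (machine_final st0 (Fw w) x))%:R.
Proof.
pose un (x : {ffun 'I_N -> {ffun J -> bool}}) : {ffun I -> bool} := [ffun e => x e.1 e.2].
pose cu (eta : {ffun I -> bool}) : {ffun 'I_N -> {ffun J -> bool}} := [ffun i => [ffun j => eta (i, j)]].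
have unK : cancel un cu by move=> x; apply/ffunP => i; apply/ffunP => j; rewrite !ffunE.
have cuK : cancel cu un by move=> eta; apply/ffunP => -[i j]; rewrite !ffunE.
rewrite /Phi (reindex un) /=; last by exists cu => x _; [exact: unK|exact: cuK].
apply: eq_bigr => x _; congr (_ * _).
  transitivity (\prod_(e : 'I_N * J) flip_weight u (tuple_parity e.2 V) (x e.1 e.2) (u + W (e.1, e.2) w)).
    by apply: eq_bigr => -[i j] _; rewrite ffunE.
  rewrite /prod_law -(pair_bigA _ (fun i j => flip_weight u (tuple_parity j V) (x i j) (u + W (i, j) w))) /=.
  apply: eq_bigr => i _; rewrite /nu /dens.
  rewrite card_ffun card_bool natrX -prodr_const -prodf_div.
  by apply: eq_bigr => j _; rewrite /flip_weight /tw; congr ((1 + _) / 2); ring.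
rewrite indicE; congr (_%:R); congr nat_of_bool.
have h : final_state alg (unflat (fun e => sg R (un x e) * (u + W e w))) = machine_final st0 (Fw w) x.
  rewrite /final_state /machine_final; congr foldl; apply/funext => st; apply/funext => t.
  rewrite /run_pass /machine_pass; congr foldl; apply/funext => st'; apply/funext => i.
  by rewrite /Fw; congr update; apply/funext => j; rewrite /unflat ffunE.
by apply/idP/idP; rewrite inE /AV /= h.
Qed.

Variables (ell a g B : R) (m D A0 : nat).
Hypothesis ell_ge0 : 0 <= ell.
Hypothesis a_gt0 : 0 < a.
Hypothesis DA : (k * D < A0)%N.
Let tau0 : R := 2 * u * ell.
Hypothesis g_def : (m.+1.*2.-1)%:R * tau0 ^+ 2 * (A0%:R * Num.sqrt d%:R) ^+ k <= g.
Hypothesis g_small : 32 * expR 1 * g <= 1.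
Hypothesis B_ge0 : 0 <= B.
Hypothesis TB : forall z, avg (fun V => (Tst V z)%:R) <= B.

(** The excess over B in [discrete_bound]. *)
Definition protocol_loss : R := N%:R * expR (- ell) + a +
  a^-1 * (N%:R * message_divergence k d T (s.-tuple bool) tau0 (Num.sqrt d%:R) ell g m D).

Let nu_sum V w i : \sum_x nu (tw w) V i x = 1.
Proof.
rewrite /nu -mulr_suml -/(avg _).
under eq_avg => x do rewrite (densE _ (@family_parityE R k d)).
rewrite avg_sum (bigD1 finset.set0)//= big1 => [|A A0'].
  under eq_avg => x do rewrite /coef_prod /chi family_parity0 !big_set0 !mul1r.
  by rewrite (avg_cst [ffun=> false]) addr0.
by rewrite avgZ avg_chiI (negbTE A0') mulr0.
Qed.

Let nu_ge0 V w i x : 0 <= nu (tw w) V i x.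
Proof. by apply: divr_ge0 => //; apply: dens_ge0 => j; apply: ltW; exact: tanh_lt1. Qed.

Let Phi01 V w : 0 <= Phi V w <= 1.
Proof.
have p0 (x : {ffun 'I_N -> {ffun J -> bool}}) : 0 <= prod_law (nu (tw w) V) x by apply: prod_law_ge0 => i b; exact: nu_ge0.
rewrite PhiE; apply/andP; split; first by apply: sumr_ge0 => x _; rewrite mulr_ge0.
apply: le_trans (_ : \sum_x prod_law (nu (tw w) V) x <= 1); last by rewrite (sum_prod_law (nu_sum V w)).
by apply: ler_sum => x _; rewrite ler_piMr//; case: (Tst _ _); rewrite ?ler01.
Qed.

Let bad (e : 'I_N * k.-tuple 'I_d) : set Omega := [set w | ell < `|u + W e w|].

Let mbad e : measurable (bad e).
Proof.
have mg : measurable_fun setT (fun w => `|u + W e w|).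
  by apply: measurableT_comp => //; exact: measurable_funD.
rewrite -[X in measurable X]setTI.
have -> : bad e = (fun w => `|u + W e w|) @^-1` `]ell, +oo[%classic.
  by apply/seteqP; split => w /=; rewrite in_itv/= andbT.
exact: mg.
Qed.

Let tau0_ge0 : 0 <= tau0.
Proof. by rewrite /tau0; apply: mulr_ge0 => //; apply: mulr_ge0. Qed.

Let protocol_loss_ge0 : 0 <= protocol_loss.
Proof.
have g0 : 0 <= g.
  apply: le_trans g_def; apply: mulr_ge0; last by rewrite exprn_ge0// mulr_ge0 ?ler0n ?sqrtr_ge0.
  by apply: mulr_ge0; [rewrite ler0n|exact: sqr_ge0].
rewrite /protocol_loss; apply: addr_ge0; first by rewrite addr_ge0 ?(ltW a_gt0)// mulr_ge0 ?ler0n ?expR_ge0.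
apply: mulr_ge0; first by rewrite invr_ge0 ltW.
apply: mulr_ge0; first by rewrite ler0n.
rewrite /message_divergence; apply: mulr_ge0; first by rewrite addr_ge0// mulr_ge0.
apply: addr_ge0; last by rewrite mulr_ge0 ?ler0n ?expR_ge0.
apply: addr_ge0.
  by rewrite divr_ge0 ?exprn_ge0 ?sqrtr_ge0// !mulr_ge0 ?expR_ge0.
by apply: mulr_ge0 => //; rewrite mulr_ge0 ?expR_ge0 ?exprn_ge0.
Qed.

Let Phi_bound w : avg (fun V => Phi V w) <= B + protocol_loss + \sum_e \1_(bad e) w.
Proof.
have s0 : 0 <= \sum_e (\1_(bad e) w : R) by apply: sumr_ge0 => e _; rewrite indicE.
have [/existsP[e he]|/existsPn nb] := boolP [exists e, ell < `|u + W e w|].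
  apply: (@le_trans _ _ 1).
    rewrite -(avg_cst (T := V_) [ffun=> false] 1); apply: ler_avg => V.
    by have /andP[] := Phi01 V w.
  have : 1 <= \sum_e (\1_(bad e) w : R).
    by rewrite (bigD1 e)//= indicE mem_set// lerDl sumr_ge0// => e' _; rewrite indicE.
  by have := addr_ge0 B_ge0 protocol_loss_ge0; lra.
under eq_avg => V do rewrite PhiE.
have := @discrete_bound R k d N T _ st0 (Fw w) (tw w) tau0 _ ell a g m D A0 k_gt0 d_gt0
  (fun i j => tanh_lt1 _) _ tau0_ge0 erefl DA g_def g_small ell_ge0 a_gt0
  (fun V z => (Tst V z)%:R) B _ TB.
rewrite -!addrA -/protocol_loss => h.
rewrite !addrA; apply: le_trans (h _ _) _.
- move=> i j; apply: le_trans (tanh_le _) _; rewrite normrM (ger0_norm u_ge0) mulrA /tau0.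
  by apply: ler_wpM2l; [rewrite mulr_ge0|rewrite leNgt nb].
- by move=> V z; case: (Tst V z); rewrite !lexx ler01.
- by rewrite /protocol_loss !addrA lerDl.
Qed.

Let mPhi V : measurable_fun setT (fun w => (Phi V w)%:E).
Proof.
apply/measurable_EFinP; apply: measurable_sum => eta; apply: measurable_funM.
  apply: measurable_prod => e _.
  by apply: (measurableT_comp (measurable_flip_weight u (cV V e) (eta e))); exact: measurable_funD.
apply: (measurableT_comp (measurable_indic (mAV V))).
by apply: measurable_into => e; apply: measurable_funM => //; exact: measurable_funD.
Qed.

(** By [mixture_law] and [discrete_bound], averaging over V conditionally on
    the moduli |u + W|; the last term is a union bound over the entries whose
    modulus exceeds ell.  A parameter at most as favourable as the average
    exists. *)
Lemma hard_parameter : exists V : V_,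
  (P [set w | Tst V (final_state alg (tpca_data W lam (sign_vector V) w))] <=
    (B + protocol_loss + (N * #|J|)%:R * (2 * expR (2 - ell)))%:E)%E.
Proof.
pose bd := B + protocol_loss + (N * #|J|)%:R * (2 * expR (2 - ell)).
pose q V : \bar R := (\int[P]_w (Phi V w)%:E)%E.
have PhiE0 V w : (0 <= (Phi V w)%:E)%E by rewrite lee_fin; have /andP[] := Phi01 V w.
have q_fin V : q V \is a fin_num.
  rewrite ge0_fin_numE; last exact: integral_ge0.
  apply: (@le_lt_trans _ _ (\int[P]_w 1)%E); last first.
    by rewrite integral_cst// mul1e; apply: le_lt_trans (probability_le1 P measurableT) _; exact: ltry.
  by apply: ge0_le_integral => // w _; rewrite lee_fin; have /andP[] := Phi01 V w.
have cV0 : 0 < #|V_|%:R :> R by rewrite ltr0n; apply/card_gt0P; exists [ffun=> false].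
have h1 : (\sum_V q V <= (#|V_|%:R * bd)%:E)%E.
  rewrite /q -ge0_integral_sum//.
  apply: (@le_trans _ _ (\int[P]_w ((#|V_|%:R * (B + protocol_loss))%:E +
      \sum_e (#|V_|%:R * \1_(bad e) w)%:E))%E).
    have me e : measurable_fun setT (fun w => (#|V_|%:R * (\1_(bad e) w : R))%:E).
      by apply/measurable_EFinP; apply: measurable_funM => //; exact: measurable_indic.
    apply: ge0_le_integral => //.
    - by move=> w _; apply: sume_ge0.
    - by apply: emeasurable_sum => V; exact: mPhi.
    - by apply: emeasurable_funD => //; apply: emeasurable_sum => e; exact: me.
    - move=> w _; rewrite !sumEFin -EFinD lee_fin -mulr_sumr -mulrDr.
      have := Phi_bound w; rewrite /avg ler_pdivrMr// => /le_trans; apply.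
      by rewrite mulrC.
  have me e : measurable_fun setT (fun w => (#|V_|%:R * (\1_(bad e) w : R))%:E).
    by apply/measurable_EFinP; apply: measurable_funM => //; exact: measurable_indic.
  have e0 e w : (0 <= (#|V_|%:R * (\1_(bad e) w : R))%:E)%E.
    by rewrite lee_fin mulr_ge0// indicE.
  rewrite ge0_integralD//; last 3 first.
  - by move=> w _; rewrite lee_fin mulr_ge0// addr_ge0.
  - by move=> w _; apply: sume_ge0.
  - by apply: emeasurable_sum => e; exact: me.
  rewrite integral_cst// ge0_integral_sum//.
  have -> : (#|V_|%:R * bd)%:E = ((#|V_|%:R * (B + protocol_loss))%:E +
      \sum_(e : I) (#|V_|%:R * (2 * expR (2 - ell)))%:E)%E.
    rewrite sumEFin sumr_const card_prod card_ord -EFinD; congr EFin.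
    by rewrite -[_ *+ (N * _)]mulr_natr /bd; ring.
  apply: leeD.
    rewrite -[leRHS]mule1; apply: lee_wpmul2l; first by rewrite lee_fin mulr_ge0// addr_ge0.
    exact: (probability_le1 P measurableT).
  apply: lee_sum => e _.
  under eq_integral do rewrite EFinM.
  rewrite ge0_integralZl//; last by apply/measurable_EFinP; exact: measurable_indic.
  rewrite integral_indic// setIT EFinM; apply: lee_wpmul2l; first by rewrite lee_fin.
  by apply: gauss_tail; [exact: hW.2|rewrite ger0_norm].
have [//|nV] := pselect (exists V : V_, (P (ev V) <= bd%:E)%E).
have hV V : bd < fine (q V).
  rewrite -lte_fin fineK// /q -evE ltNge; apply/negP => h; apply: nV; by exists V.
move: h1; rewrite (eq_bigr (fun V => (fine (q V))%:E)) => [|V _]; last by rewrite fineK.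
rewrite sumEFin lee_fin => h1.
have : \sum_(V : V_) bd < \sum_(V : V_) fine (q V).
  apply: ltr_sum => //; apply/hasP; exists [ffun=> false] => //; exact: mem_index_enum.
rewrite sumr_const -[X in X < _]mulr_natl => /lt_le_trans /(_ h1).
by rewrite ltxx.
Qed.

End Transfer.

(** * Hoeffding's inequality for sign vectors *)
Section Hoeffding.
Variable R : realType.

(** Comparison of the power series, using 2^n n! <= (2n)!. *)
Lemma cosh_le (x : R) : expR x + expR (- x) <= 2 * expR (x ^+ 2 / 2).
Proof.
pose v n := series (exp_coeff x) n + series (exp_coeff (- x)) n.
have cx := is_cvg_series_exp_coeff x; have cN := is_cvg_series_exp_coeff (- x).
have vS n : v n.+1 = v n + (x ^+ n + (- x) ^+ n) / n`!%:R.
  by rewrite /v /series/= !big_nat_recr//= /exp_coeff /=; ring.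
have v2 n : v n.*2 <= 2 * series (exp_coeff (x ^+ 2 / 2)) n.
  elim: n => [|n IHn]; first by rewrite /v /series/= !big_geq// addr0 mulr0.
  rewrite doubleS !vS /series/= big_nat_recr//= -/(series _ n) mulrDr.
  have o1 : x ^+ n.*2.+1 + (- x) ^+ n.*2.+1 = 0.
    by rewrite [(- x) ^+ _]exprNn -signr_odd /= odd_double /= expr1 mulN1r subrr.
  rewrite o1 mul0r addr0 lerD// /exp_coeff /= [(- x) ^+ _]exprNn -signr_odd odd_double expr0 mul1r.
  have fle : (2 ^ n * n`! <= n.*2`!)%N.
    elim: (n) => // j IHj; rewrite doubleS !factS expnS; nia.
  have -> : x ^+ n.*2 = (x ^+ 2) ^+ n by rewrite -mul2n exprM.
  rewrite expr_div_n; have p0 : 0 <= (x ^+ 2) ^+ n by rewrite exprn_ge0// sqr_ge0.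
  have -> : ((x ^+ 2) ^+ n + (x ^+ 2) ^+ n) / n.*2`!%:R = 2 * ((x ^+ 2) ^+ n * (n.*2`!%:R)^-1).
    by rewrite mulrDl [RHS]mulr_natl mulr2n.
  rewrite ler_wpM2l// -mulrA ler_wpM2l// -invfM lef_pV2 ?posrE ?mulr_gt0 ?exprn_gt0 ?ltr0n ?fact_gt0//.
  by rewrite -natrX -natrM ler_nat.
have vmono n : v n <= v n.*2.
  have -> : n.*2 = (n + n)%N by rewrite addnn.
  elim: {3}n => [|j IHj]; first by rewrite addn0.
  rewrite addnS vS; apply: le_trans IHj _; rewrite lerDl divr_ge0//.
  rewrite [(- x) ^+ _]exprNn -signr_odd; have [ho|/negbTE ho] := boolP (odd (n + j)).
    by rewrite expr1 mulN1r subrr.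
  rewrite expr0 mul1r; have := odd_double_half (n + j); rewrite ho add0n => <-.
  by rewrite -mul2n exprM addr_ge0// exprn_ge0// sqr_ge0.
have -> : expR x + expR (- x) = limn v.
  by rewrite /expR -limD.
apply: limr_le; first exact: is_cvgD.
near=> n; apply: le_trans (vmono n) _; apply: le_trans (v2 n) _; rewrite ler_wpM2l//.
rewrite /expR; apply: nondecreasing_cvgn_le; last exact: is_cvg_series_exp_coeff.
apply/nondecreasing_seqP => j; rewrite /series/= big_nat_recr//= lerDl.
by rewrite exp_coeff_ge0// divr_ge0// sqr_ge0.
Unshelve. all: by end_near. Qed.

Variable d : nat.
Local Notation V_ := {ffun 'I_d -> bool}.

Lemma mgf_le (c : R) (a : 'I_d -> R) :
  avg (fun V : V_ => expR (c * \sum_i sg R (V i) * a i)) <= expR (c ^+ 2 * (\sum_i a i ^+ 2) / 2).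
Proof.
rewrite /avg.
have -> : \sum_(V : V_) expR (c * \sum_i sg R (V i) * a i) =
    \prod_i (expR (c * a i) + expR (- (c * a i))).
  transitivity (\sum_(V : V_) \prod_i expR (c * (sg R (V i) * a i))).
    by apply: eq_bigr => V _; rewrite mulr_sumr expR_sum.
  rewrite -(bigA_distr_bigA (fun i b => expR (c * (sg R b * a i)))).
  apply: eq_bigr => i _; rewrite big_bool /= /sg expr1 expr0 mulN1r mul1r mulrN; exact: addrC.
rewrite card_ffun card_bool card_ord ler_pdivrMr ?ltr0n ?expn_gt0//.
rewrite mulr_sumr mulr_suml expR_sum natrX -[X in _ <= _ * 2%:R ^+ X]card_ord -prodr_const -big_split /=.
apply: ler_prod => i _; rewrite addr_ge0 ?expR_ge0//= [leRHS]mulrC -exprMn; exact: cosh_le.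
Qed.

(** Chernoff's bound at parameters t and -t, after normalising U; U = 0 has
    correlation 0 and is harmless unless t = 0, when the bound exceeds 1. *)
Lemma sign_correlation_tail (d_gt0 : (0 < d)%N) (t : R) (U : 'rV[R]_d) :
  avg (fun V : V_ => (t ^+ 2 / d%:R <= sq_corr (sign_vector R V) U)%R%:R) <=
  2 * expR (- (t ^+ 2 / 2)) :> R.
Proof.
have d0 : 0 < d%:R :> R by rewrite ltr0n.
have U0 : 0 <= dotv U U by apply: sumr_ge0 => i _; rewrite -expr2 sqr_ge0.
have nV (V : V_) : norm2 (sign_vector R V) ^+ 2 = d%:R.
  by rewrite (sign_vector_param R V) sqr_sqrtr// ler0n.
have nU : norm2 U ^+ 2 = dotv U U by rewrite /norm2 sqr_sqrtr.
have [->|t0] := eqVneq t 0.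
  rewrite expr0n/= !mul0r oppr0 expR0 mulr1.
  apply: le_trans (_ : 1 <= 2); last by rewrite ler1n.
  rewrite -[leRHS](avg_cst (T := V_) [ffun=> false] 1); apply: ler_avg => V.
  by case: (0 <= sq_corr _ _); rewrite ?ler01.
have [U00|Un0] := eqVneq (dotv U U) 0.
  rewrite /avg big1 ?mul0r ?mulr_ge0 ?expR_ge0// => V _.
  rewrite /sq_corr nU U00 mulr0 invr0 mulr0 leNgt divr_gt0//.
  by rewrite exprn_even_gt0.
have Up : 0 < dotv U U by rewrite lt_neqAle eq_sym Un0.
pose r := norm2 U; have r0 : 0 < r by rewrite /r /norm2 sqrtr_gt0.
pose a i := U 0 i / r.
have a1 : \sum_i a i ^+ 2 = 1.
  under eq_bigr => i _ do rewrite /a expr_div_n.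
  rewrite -mulr_suml nU (eq_bigr (fun i => U 0 i * U 0 i)) ?divff// => i _; exact: expr2.
pose X (V : V_) := \sum_i sg R (V i) * a i.
have XE (V : V_) : dotv (sign_vector R V) U = r * X V.
  rewrite /X mulr_sumr; apply: eq_bigr => i _; rewrite mxE /a mulrCA; congr (_ * _).
  by rewrite mulrCA divff ?mulr1// gt_eqF.
have scE (V : V_) : sq_corr (sign_vector R V) U = X V ^+ 2 / d%:R.
  rewrite /sq_corr nV -/r XE normrM exprMn real_normK ?num_real// real_normK ?num_real//.
  by field; rewrite !gt_eqF.
apply: (@le_trans _ _ (avg (fun V => expR (- t ^+ 2) * (expR (t * X V) + expR (- t * X V))))).
  apply: ler_avg => V; have [h|_] := leP (t ^+ 2 / d%:R) (sq_corr (sign_vector R V) U); last by rewrite mulr_ge0 ?addr_ge0 ?expR_ge0.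
  have {}h : t ^+ 2 <= X V ^+ 2 by move: h; rewrite scE ler_pM2r ?invr_gt0.
  rewrite mulrDr -!expRD.
  have hdich : t ^+ 2 <= t * X V \/ t ^+ 2 <= - t * X V.
    have [tX|tX] := leP 0 (t * X V); [left|right]; nra.
  have e1 := expR_ge0 (- t ^+ 2 + t * X V); have e2 := expR_ge0 (- t ^+ 2 + - t * X V).
  have e3 (y : R) : 0 <= y -> 1 <= expR y by move=> y0; rewrite -[leLHS]expR0 ler_expR.
  have -> : true%:R = 1 :> R by [].
  case: hdich => hdich.
    have : 1 <= expR (- t ^+ 2 + t * X V) by apply: e3; lra.
    by lra.
  have : 1 <= expR (- t ^+ 2 + - t * X V) by apply: e3; lra.
  by lra.
rewrite avgZ avgD.
have m1 := mgf_le t a; have m2 := mgf_le (- t) a.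
rewrite a1 !mulr1 in m1 m2; rewrite sqrrN in m2.
have -> : expR (- (t ^+ 2 / 2)) = expR (- t ^+ 2) * expR (t ^+ 2 / 2) by rewrite -expRD; congr expR; field.
rewrite mulrCA ler_wpM2l ?expR_ge0// mulr2n mulrDl !mul1r; exact: lerD.
Qed.

End Hoeffding.

(** * Orders of growth *)
Section Growth.
Variable R : realType.
Implicit Types (f g : nat -> R) (p q : R).

(** Absolute values make the class stable under products. *)
Definition growth p f :=
  exists2 C : R, 0 <= C & \forall d \near \oo, `|f d| <= C * d%:R `^ p.

Let natp_gt0 p d : (0 < d)%N -> 0 < (d%:R : R) `^ p.
Proof. by move=> d0; rewrite powR_gt0// ltr0n. Qed.

Lemma growth_le p q f : p <= q -> growth p f -> growth q f.
Proof.
move=> pq [C C0 hC]; exists C => //; near=> d.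
have d0 : (0 < d)%N by near: d; exact: nbhs_infty_gt.
have hd : `|f d| <= C * d%:R `^ p by near: d.
by apply: le_trans hd _; rewrite ler_wpM2l// ler_powR// ler1n.
Unshelve. all: by end_near. Qed.

Lemma growth_fle p f g : (\forall d \near \oo, `|f d| <= `|g d|) -> growth p g -> growth p f.
Proof.
move=> fg [C C0 hC]; exists C => //; near=> d.
have h1 : `|f d| <= `|g d| by near: d.
by apply: le_trans h1 _; near: d.
Unshelve. all: by end_near. Qed.

Lemma growthM p q f g : growth p f -> growth q g -> growth (p + q) (fun d => f d * g d).
Proof.
move=> [C C0 hC] [D D0 hD]; exists (C * D); first exact: mulr_ge0.
near=> d.
have d0 : (0 < d)%N by near: d; exact: nbhs_infty_gt.
have h1 : `|f d| <= C * d%:R `^ p by near: d.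
have h2 : `|g d| <= D * d%:R `^ q by near: d.
rewrite normrM powRD; last by apply/implyP => _; rewrite pnatr_eq0 -lt0n.
by rewrite mulrACA; apply: ler_pM.
Unshelve. all: by end_near. Qed.

Lemma growthD p f g : growth p f -> growth p g -> growth p (fun d => f d + g d).
Proof.
move=> [C C0 hC] [D D0 hD]; exists (C + D); first exact: addr_ge0.
near=> d.
have h1 : `|f d| <= C * d%:R `^ p by near: d.
have h2 : `|g d| <= D * d%:R `^ p by near: d.
by rewrite mulrDl; apply: le_trans (ler_normD _ _) _; exact: lerD.
Unshelve. all: by end_near. Qed.

Lemma growth_cst (c : R) : growth 0 (fun=> c).
Proof. by exists `|c| => //; near=> d; rewrite powRr0 mulr1. Unshelve. all: by end_near. Qed.

Lemma growth_powR p : growth p (fun d => d%:R `^ p).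
Proof. by exists 1 => //; near=> d; rewrite mul1r ger0_norm// powR_ge0. Unshelve. all: by end_near. Qed.

Lemma growthX p f n : growth p f -> growth (n%:R * p) (fun d => f d ^+ n).
Proof.
move=> pf; elim: n => [|n IHn]; first by rewrite mul0r; under eq_fun do rewrite expr0; exact: growth_cst.
have := growthM pf IHn; rewrite (_ : p + n%:R * p = n.+1%:R * p); last by rewrite -natr1; ring.
by under eq_fun do rewrite -exprS.
Qed.

Lemma growthZ p (c : R) f : growth p f -> growth p (fun d => c * f d).
Proof. by move=> /(growthM (growth_cst c)); rewrite add0r. Qed.

Lemma growth_small p f (a : R) : p < 0 -> growth p f -> 0 < a -> \forall d \near \oo, `|f d| <= a.
Proof.
move=> p0 [C C0 hC] a0; near=> d.
have d0 : (0 < d)%N by near: d; exact: nbhs_infty_gt.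
have hd : `|f d| <= C * d%:R `^ p by near: d.
apply: le_trans hd _.
have q0 : 0 < - p by rewrite oppr_gt0.
rewrite -[p]opprK powRN ler_pdivrMr ?natp_gt0// mulrC -ler_pdivrMr//.
have y0 : 0 <= C / a by rewrite divr_ge0// ltW.
have -> : C / a = ((C / a) `^ (- p)^-1) `^ (- p).
  by rewrite -powRrM mulVf ?gt_eqF// powRr1.
apply: ge0_ler_powR; rewrite ?nnegrE ?powR_ge0 ?ler0n ?(ltW q0)//.
by near: d; exact: nbhs_infty_ger.
Unshelve. all: by end_near. Qed.

(** From exp y = exp (y/n)^n >= (y/n)^n with y = d^e and e n >= - p. *)
Lemma growth_exp (e p : R) : 0 < e -> growth p (fun d => expR (- d%:R `^ e)).
Proof.
move=> e0; pose n := (Num.truncn (- p / e)).+1.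
have nP : - p <= e * n%:R.
  by rewrite mulrC -ler_pdivrMr//; apply/ltW/truncnS_gt.
apply: (@growth_le (- (e * n%:R))); first by rewrite lerNl.
exists (n%:R ^+ n) => //; near=> d.
have d0 : (0 < d)%N by near: d; exact: nbhs_infty_gt.
rewrite ger0_norm ?expR_ge0// expRN powRN powRrM powR_mulrn ?powR_ge0//.
set y := d%:R `^ e; have y0 : 0 < y by rewrite natp_gt0.
rewrite -[leLHS]div1r ler_pdivrMr ?expR_gt0//.
have h : (y / n%:R) ^+ n <= expR y.
  have -> : expR y = expR (y / n%:R) ^+ n by rewrite -expRM_natl mulrC divfK// pnatr_eq0.
  rewrite lerXn2r ?nnegrE ?expR_ge0 ?divr_ge0 ?(ltW y0)//.
  by apply: le_trans (expR_ge1Dx _); rewrite lerDr.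
rewrite mulrAC ler_pdivlMr ?exprn_gt0// mul1r.
rewrite -ler_pdivrMl ?exprn_gt0 ?ltr0n// mulrC; by rewrite -expr_div_n.
Unshelve. all: by end_near. Qed.

(** Positivity of b excludes the infinite quotients. *)
Lemma asymp_le_bound f (b : nat -> R) :
  (\forall d \near \oo, 0 < b d) -> asymp_le f b ->
  exists2 C : R, 0 <= C & \forall d \near \oo, f d <= C * b d.
Proof.
move=> b0; rewrite /asymp_le /limn_esup /limf_esup => /ereal_inf_lt [_ [A Aoo <-] sA].
have [C hC] : exists C : R, (ereal_sup ((fun d => (f d)%:E / (b d)%:E) @` A) <= C%:E)%E.
  case: (ereal_sup _) sA => [r _|//|_]; first by exists r.
  by exists 0; rewrite leNye.
exists `|C| => //; near=> d.
have bd : 0 < b d by near: d.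
have Ad : A d by near: d.
have : ((f d)%:E / (b d)%:E <= C%:E)%E.
  by apply: le_trans hC; apply: ereal_sup_ubound; exists d.
rewrite inver gt_eqF// -EFinM lee_fin ler_pdivrMr// => /le_trans; apply.
by rewrite ler_wpM2r ?(ltW bd)// ler_norm.
Unshelve. all: by end_near. Qed.

Lemma asymp_le_growth p f (b : nat -> R) :
  (\forall d \near \oo, 0 < b d) -> (forall d, 0 <= f d) -> growth p b -> asymp_le f b -> growth p f.
Proof.
move=> b0 f0 gb /(asymp_le_bound b0)[C C0 hC].
apply: growth_fle (growthZ C gb); near=> d.
have hd : f d <= C * b d by near: d.
by rewrite (ger0_norm (f0 d)); apply: le_trans hd (ler_norm _).
Unshelve. all: by end_near. Qed.

Lemma growth_truncn p f : 0 <= p -> growth p f -> growth p (fun d => (Num.truncn (f d)).+1%:R).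
Proof.
move=> p0 gf; apply: (@growth_fle _ _ (fun d => `|f d| + 1)).
  near=> d; rewrite [leRHS]ger0_norm ?addr_ge0// [leLHS]ger0_norm// -natr1 lerD2r.
  have [f0|f0] := leP 0 (f d); first by rewrite ger0_norm// truncn_le.
  by rewrite truncn_floor [0 <= f d]leNgt f0.
apply: growthD; last exact: growth_le (growth_cst 1).
by apply: growth_fle gf; near=> d; rewrite normr_id.
Unshelve. all: by end_near. Qed.

Lemma limn_esup_le (u : nat -> \bar R) (c : R) :
  (forall a : R, 0 < a -> \forall d \near \oo, (u d <= (c + a)%:E)%E) -> (limn_esup u <= c%:E)%E.
Proof.
move=> h; apply/lee_addgt0Pr => a a0; rewrite -EFinD.
rewrite /limn_esup /limf_esup; apply: ge_ereal_inf; exists (ereal_sup (u @` [set d | (u d <= (c + a)%:E)%E])).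
  by exists [set d | (u d <= (c + a)%:E)%E] => //; exact: h.
by apply: ub_ereal_sup => _ [d /= hd <-].
Qed.

End Growth.

(** * Choice of the parameters *)
Section Final.
Variable R : realType.
Variables (k : nat) (lambda : nat -> R) (N T s : nat -> nat) (eta tau mu : R).
Hypothesis hk : (2 <= k)%N.
Hypothesis hlambda_gt0 : forall d, 0 < lambda d.
Hypothesis hlambda : asymp_eq lambda (fun=> 1).
Hypothesis heta : 1 <= eta.
Hypothesis htau : 0 <= tau.
Hypothesis hmu : 0 <= mu.
Hypothesis hN : asymp_eq (fun d => (N d)%:R) (fun d => d%:R `^ eta / lambda d ^+ 2).
Hypothesis hT : asymp_eq (fun d => (T d)%:R) (fun d => d%:R `^ tau).
Hypothesis hs : asymp_eq (fun d => (s d)%:R) (fun d => d%:R `^ mu).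
Hypothesis hresource : eta + tau + mu < (Num.ceil ((k%:R + 1) / 2 : R))%:~R.

Let rk : nat := if odd k then 1 else 2.
Let gap : R := (k + rk)%:R / 2 - (eta + tau + mu).

(* For both parities of k, (k + rk)/2 is the ceiling of (k + 1)/2. *)
Let gap_gt0 : 0 < gap.
Proof.
rewrite subr_gt0; apply: lt_le_trans hresource _.
have kE : (k + rk = (k./2).+1 * 2)%N.
  by rewrite /rk; have := odd_double_half k; case: (odd k) => /=; lia.
rewrite kE natrM mulfK// -[leRHS]/(((k./2).+1%:Z)%:~R) ler_int ceil_le_int.
rewrite ler_pdivrMr// -natrM -kE natrD lerD2l /rk; by case: (odd k); rewrite ?ler1n.
Qed.

(* The losses multiply the divergence by at most d^((5+2k)e), that is by the
   square root of the gained factor d^gap. *)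
Let e : R := gap / (2 * (5 + 2 * k%:R)).

Let e_gt0 : 0 < e.
Proof. by rewrite divr_gt0// mulr_gt0// addr_gt0// ltr_pwDl// mulr_ge0. Qed.

Let eE : (5 + 2 * k%:R) * e = gap / 2.
Proof. by rewrite /e; field; rewrite gt_eqF// ltr_pwDl// mulr_ge0. Qed.

(** Instances of the parameters of [hard_parameter] at dimension d: cutoff
    for ell, bias for tau0, degree for D, moment for m, word_cap for A0 and gain
    for g.  The constants in degree and moment are those that make [D_spec] and
    [m_spec] true. *)
Definition cutoff (d : nat) : R := d%:R `^ e.
Definition bias d : R := 2 * snr k d (lambda d) * cutoff d.
Definition energy d : R := #|{: k.-tuple 'I_d}|%:R * bias d ^+ 2.
Definition degree d : nat := (Num.truncn (2 * (2 * energy d + cutoff d))).+1.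
Definition moment d : nat := (Num.truncn (2 * ((s d)%:R * (T d)%:R) + energy d + 2 * cutoff d)).+1.
Definition word_cap d : nat := (k * degree d).+1.
Definition gain d : R :=
  (moment d).+1.*2.-1%:R * bias d ^+ 2 * ((word_cap d)%:R * Num.sqrt d%:R) ^+ k.
Definition divergence d : R :=
  message_divergence k d (T d) ((s d).-tuple bool) (bias d) (Num.sqrt d%:R) (cutoff d) (gain d) (moment d) (degree d).

Let grow_lambda : growth 0 lambda.
Proof.
apply: (asymp_le_growth _ _ (growth_cst (1 : R)) hlambda.1); last by move=> d; exact: ltW.
by near=> d; rewrite ltr01.
Unshelve. all: by end_near. Qed.

Let grow_lambdaV : growth 0 (fun d => (lambda d)^-1).
Proof.
have [|C C0 hC] := asymp_le_bound _ hlambda.2; first by near=> d; exact: hlambda_gt0.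
exists C => //; near=> d; rewrite powRr0 mulr1.
rewrite ger0_norm ?invr_ge0 ?(ltW (hlambda_gt0 d))// -[leLHS]mul1r ler_pdivrMr//.
by near: d.
Unshelve. all: by end_near. Qed.

Let grow_N : growth eta (fun d => (N d)%:R).
Proof.
have h := growthM (growth_powR eta) (growthX 2 grow_lambdaV).
rewrite mulr0 addr0 in h.
apply: (asymp_le_growth _ _ _ hN.1).
- near=> d; rewrite divr_gt0 ?exprn_gt0// powR_gt0// ltr0n; near: d; exact: nbhs_infty_gt.
- by move=> d; rewrite ler0n.
- by apply: growth_fle h; near=> d; rewrite exprVn.
Unshelve. all: by end_near. Qed.

Let grow_T : growth tau (fun d => (T d)%:R).
Proof.
apply: (asymp_le_growth _ _ (growth_powR tau) hT.1); last by move=> d; rewrite ler0n.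
by near=> d; rewrite powR_gt0// ltr0n; near: d; exact: nbhs_infty_gt.
Unshelve. all: by end_near. Qed.

Let grow_s : growth mu (fun d => (s d)%:R).
Proof.
apply: (asymp_le_growth _ _ (growth_powR mu) hs.1); last by move=> d; rewrite ler0n.
by near=> d; rewrite powR_gt0// ltr0n; near: d; exact: nbhs_infty_gt.
Unshelve. all: by end_near. Qed.

Let grow_ell : growth e cutoff. Proof. exact: growth_powR. Qed.

Let grow_sqrt : growth 2^-1 (fun d => Num.sqrt d%:R : R).
Proof.
apply: growth_fle (growth_powR 2^-1); near=> d; by rewrite powR12_sqrt// ler0n.
Unshelve. all: by end_near. Qed.

Let grow_sqrtV n : growth (- (n%:R / 2)) (fun d => (Num.sqrt d%:R ^+ n)^-1 : R).
Proof.
apply: growth_fle (growth_powR _); near=> d.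
by rewrite powRN [n%:R / 2]mulrC powRrM powR12_sqrt ?ler0n// powR_mulrn// sqrtr_ge0.
Unshelve. all: by end_near. Qed.

Let grow_snr : growth (- (k%:R / 2)) (fun d => snr k d (lambda d)).
Proof.
have := growthM grow_lambda (grow_sqrtV k); rewrite add0r.
apply: growth_fle; near=> d; rewrite /snr.
suff -> : Num.sqrt (d%:R ^+ k) = Num.sqrt d%:R ^+ k :> R by [].
elim: k => [|n IHn]; first by rewrite !expr0 sqrtr1.
by rewrite !exprS sqrtrM ?ler0n// IHn.
Unshelve. all: by end_near. Qed.

Let grow_tau : growth (- (k%:R / 2) + e) bias.
Proof. by apply: growthM grow_ell; exact: growthZ. Qed.

Let grow_card : growth k%:R (fun d => #|{: k.-tuple 'I_d}|%:R : R).
Proof.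
apply: growth_fle (growth_powR _); near=> d.
by rewrite card_tuple card_ord powR_mulrn ?ler0n// natrX.
Unshelve. all: by end_near. Qed.

Let grow_energy : growth (2 * e) energy.
Proof.
have := growthM grow_card (growthX 2 grow_tau); apply: growth_le; lra.
Qed.

Let grow_D : growth (2 * e) (fun d => (degree d)%:R).
Proof.
have e0 := e_gt0.
apply: growth_truncn; first by lra.
apply: growthZ; apply: growthD; first exact: growthZ.
by apply: growth_le grow_ell; lra.
Qed.

Let grow_m : growth (tau + mu + 2 * e) (fun d => (moment d)%:R).
Proof.
have e0 := e_gt0; have t0 := htau; have m0 := hmu.
apply: growth_truncn; first by lra.
apply: growthD; last by apply: growthZ; apply: growth_le grow_ell; lra.
apply: growthD; last by apply: growth_le grow_energy; lra.
apply: growthZ; have := growthM grow_s grow_T; apply: growth_le; lra.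
Qed.

Let grow_A : growth (2 * e) (fun d => (word_cap d)%:R).
Proof.
have h : growth (2 * e) (fun d => k%:R * (degree d)%:R + 1).
  apply: growthD; first exact: growthZ.
  by apply: growth_le (growth_cst 1); rewrite mulr_ge0// ltW.
by apply: growth_fle h; near=> d; rewrite /word_cap -natr1 natrM.
Unshelve. all: by end_near. Qed.

Let grow_g : growth (tau + mu - k%:R / 2 + (4 + 2 * k%:R) * e) gain.
Proof.
have h2 : growth (tau + mu + 2 * e) (fun d => (moment d).+1.*2.-1%:R).
  have h : growth (tau + mu + 2 * e) (fun d => 2 * (moment d)%:R + 1).
    apply: growthD; first exact: growthZ.
    by apply: growth_le (growth_cst 1); have := e_gt0; have := htau; have := hmu; lra.
  by apply: growth_fle h; near=> d; rewrite doubleS /= -natr1 -muln2 natrM [_ * 2]mulrC.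
have := growthM (growthM h2 (growthX 2 grow_tau)) (growthX k (growthM grow_A grow_sqrt)).
apply: growth_le; lra.
Unshelve. all: by end_near. Qed.

Let ell_ge0 d : 0 <= cutoff d.
Proof. exact: powR_ge0. Qed.

Let gain_ge0 d : 0 <= gain d.
Proof.
apply: mulr_ge0; last by rewrite exprn_ge0// mulr_ge0 ?ler0n ?sqrtr_ge0.
by apply: mulr_ge0; [rewrite ler0n|exact: sqr_ge0].
Qed.

Let le_2_e : 2 <= expR 1 :> R.
Proof. by have := expR_ge1Dx (1 : R); rewrite -[1 + 1]/(2 : R). Qed.

Let D_spec d : 2^-1 ^+ degree d * expR (2 * energy d) <= expR (- cutoff d).
Proof.
have h : 2^-1 <= expR (- 2^-1) :> R.
  by have := expR_ge1Dx (- 2^-1 : R); lra.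
apply: (@le_trans _ _ (expR (- 2^-1) ^+ degree d * expR (2 * energy d))).
  by rewrite ler_wpM2r ?expR_ge0// lerXn2r ?nnegrE ?expR_ge0.
rewrite -expRM_natl -expRD ler_expR.
have : 2 * (2 * energy d + cutoff d) <= (degree d)%:R by apply/ltW/truncnS_gt.
lra.
Qed.

Let m_spec d : (#|{: (s d).-tuple bool}| ^ T d)%:R * expR ((energy d - (moment d).+1%:R) / 2) <= expR (- cutoff d).
Proof.
rewrite card_tuple card_bool -expnM natrX.
apply: (@le_trans _ _ (expR 1 ^+ (s d * T d) * expR ((energy d - (moment d).+1%:R) / 2))).
  by rewrite ler_wpM2r ?expR_ge0// lerXn2r ?nnegrE ?expR_ge0.
rewrite -expRM_natl mulr1 -expRD ler_expR natrM.
have : 2 * ((s d)%:R * (T d)%:R) + energy d + 2 * cutoff d <= (moment d)%:R by apply/ltW/truncnS_gt.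
rewrite -[(moment d).+1%:R]natr1.
move: ((s d)%:R * (T d)%:R) (energy d) (cutoff d) ((moment d)%:R) => a b c m'; lra.
Qed.

Let grow_eps : growth (- (gap / 2)) (fun d => (N d)%:R * divergence d).
Proof.
have e0 := e_gt0; have ee := eE; have t0 := htau; have m0 := hmu; have k0 : 0 <= k%:R :> R by rewrite ler0n.
pose p := tau + mu - k%:R / 2 + (4 + 2 * k%:R) * e - rk%:R / 2.
have h1 : growth p (fun d => 8 * expR 1 * gain d / Num.sqrt d%:R ^+ rk + 9 * expR (- cutoff d)).
  apply: growthD; last by apply: growthZ; exact: growth_exp.
  by apply: growthM => //; exact: growthZ.
have h2 : growth e (fun d => 2 + 4 * cutoff d).
  by apply: growthD; [apply: growth_le (growth_cst 2); exact: ltW|exact: growthZ].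
have h := growthM grow_N (growthM h2 h1).
have : growth (eta + (e + p)) (fun d => (N d)%:R * divergence d).
  apply: growth_fle h; near=> d.
  have x0 : 0 <= (2 + 4 * cutoff d) by rewrite addr_ge0// mulr_ge0.
  have y0 : 0 <= 8 * expR 1 * gain d / Num.sqrt d%:R ^+ rk.
    apply: divr_ge0; last by rewrite exprn_ge0 ?sqrtr_ge0.
    by apply: mulr_ge0 (gain_ge0 d); rewrite mulr_ge0 ?expR_ge0.
  have z0 : 0 <= 2^-1 ^+ degree d * expR (2 * energy d) by rewrite mulr_ge0 ?expR_ge0 ?exprn_ge0.
  have w0 : 0 <= (#|{: (s d).-tuple bool}| ^ T d)%:R * expR ((energy d - (moment d).+1%:R) / 2).
    by rewrite mulr_ge0 ?expR_ge0 ?ler0n.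
  have hD := D_spec d; have hm := m_spec d.
  rewrite !normrM ler_wpM2l// /divergence /message_divergence -/rk -/(energy d).
  move: y0 z0 w0 hD hm; set y := _ / _ ^+ rk; set z := _ * expR (2 * _); set q := _ * expR (_ / 2).
  set E := expR (- cutoff d) => y0 z0 w0 hD hm.
  rewrite ler_wpM2l// !ger0_norm; lra.
apply: growth_le; move: ee; rewrite /p /gap natrD; lra.
Unshelve. all: by end_near. Qed.

Let grow_N_exp p : growth p (fun d => (N d)%:R * expR (- cutoff d)).
Proof.
have := growthM grow_N (growth_exp (p - eta) e_gt0); by rewrite addrC subrK.
Qed.

Let grow_N_card_exp : growth (-1) (fun d => (N d * #|{: k.-tuple 'I_d}|)%:R * (2 * expR (2 - cutoff d))).
Proof.
have := growthM grow_card (growthZ (2 * expR 2) (grow_N_exp (-1 - k%:R))).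
rewrite addrC subrK; apply: growth_fle; near=> d.
rewrite expRD natrM le_eqVlt; apply/orP; left; apply/eqP; congr `|_|.
by rewrite /cutoff; ring.
Unshelve. all: by end_near. Qed.

Lemma eventually_admissible (b : R) : 0 < b -> \forall d \near \oo,
  [/\ (0 < d)%N, snr k d (lambda d) <= 1, 32 * expR 1 * gain d <= 1,
   protocol_loss k d (N d) (T d) (s d) (lambda d) (cutoff d) b (gain d) (moment d) (degree d) <= b + b + b &
   (N d * #|{: k.-tuple 'I_d}|)%:R * (2 * expR (2 - cutoff d)) <= b].
Proof.
move=> b0.
have e0 := e_gt0; have ee := eE; have t0 := htau; have m0 := hmu; have n0 := heta; have p0 := gap_gt0.
have k2 : 2 <= k%:R :> R by rewrite ler_nat.
have c0 : 0 < (32 * expR 1)^-1 :> R by rewrite invr_gt0 mulr_gt0 ?expR_gt0.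
have s1 : - (k%:R / 2) < 0 :> R by lra.
have rk2 : rk%:R <= 2 :> R by rewrite /rk ler_nat; case: (odd k).
have s2 : tau + mu - k%:R / 2 + (4 + 2 * k%:R) * e < 0.
  by move: ee p0; rewrite /gap natrD; lra.
have s3 : - (gap / 2) < 0 by lra.
have bb : 0 < b * b by rewrite mulr_gt0.
near=> d; split.
- by near: d; exact: nbhs_infty_gt.
- apply: le_trans (ler_norm _) _; near: d.
  exact: (growth_small s1 grow_snr ltr01).
- rewrite mulrC -ler_pdivlMr ?mulr_gt0 ?expR_gt0// div1r.
  apply: le_trans (ler_norm _) _; near: d; exact: (growth_small s2 grow_g c0).
- rewrite /protocol_loss; apply: lerD.
    rewrite lerD2r; apply: le_trans (ler_norm _) _; near: d.
    exact: (growth_small (ltrN10 R) (grow_N_exp (-1)) b0).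
  rewrite mulrC ler_pdivrMr//.
  apply: le_trans (ler_norm _) _; near: d; exact: (growth_small s3 grow_eps bb).
- apply: le_trans (ler_norm _) _; near: d; exact: (growth_small (ltrN10 R) grow_N_card_exp b0).
Unshelve. all: by end_near. Qed.

End Final.

Theorem theorem1 (R : realType) (k : nat) (lambda : nat -> R)
  (N T s : nat -> nat) (eta tau mu : R)
  (disp : nat -> measure_display)
  (Omega : forall d : nat, measurableType (disp d))
  (P : forall d : nat, probability (Omega d) R)
  (W : forall d : nat, 'I_(N d) * k.-tuple 'I_d -> {RV (P d) >-> R})
  (Vhat : forall d : nat, ('I_(N d) -> tensor R d k) -> 'rV[R]_d)
  (hk : (2 <= k)%N)
  (hlambda_gt0 : forall d, 0 < lambda d)
  (hlambda : asymp_eq lambda (fun=> 1))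
  (heta : 1 <= eta) (htau : 0 <= tau) (hmu : 0 <= mu)
  (hN : asymp_eq (fun d => (N d)%:R) (fun d => d%:R `^ eta / lambda d ^+ 2))
  (hT : asymp_eq (fun d => (T d)%:R) (fun d => d%:R `^ tau))
  (hs : asymp_eq (fun d => (s d)%:R) (fun d => d%:R `^ mu))
  (hW : forall d, gaussian_noise (W d))
  (hVhat : forall d, memory_bounded (T d) (s d) (Vhat d))
  (hresource : eta + tau + mu < (Num.ceil ((k%:R + 1) / 2 : R))%:~R)
  (t : R) :
  (limn_esup (fun d => ereal_inf
     [set P d [set w | (t ^+ 2 / d%:R <=
          sq_corr V (Vhat d (tpca_data (W d) (lambda d) V w)))%R]
       | V in @param_space R d])
   <= (2 * expR (- (t ^+ 2 / 2)))%:E)%E.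
Proof.
apply: limn_esup_le => a a0.
have b0 : 0 < a / 4 by rewrite divr_gt0.
have hadm := eventually_admissible hk hlambda_gt0 hlambda heta htau hmu hN hT hs hresource b0.
near=> d.
have [d0 u1 g1 hrest htail] : [/\ (0 < d)%N, snr k d (lambda d) <= 1, 32 * expR 1 * gain k lambda T s eta tau mu d <= 1,
   protocol_loss k d (N d) (T d) (s d) (lambda d) (cutoff k eta tau mu d) (a / 4) (gain k lambda T s eta tau mu d) (moment k lambda T s eta tau mu d) (degree k lambda eta tau mu d) <= a / 4 + a / 4 + a / 4 &
   (N d * #|{: k.-tuple 'I_d}|)%:R * (2 * expR (2 - cutoff k eta tau mu d)) <= a / 4].
  by near: d; exact: hadm.
have [alg halg] := hVhat d.
have [V hV] := @hard_parameter R k d (N d) (T d) (s d) _ _ (P d) (W d) (lambda d) alg (hW d)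
  (ltn_trans (ltn0Sn 0) hk) d0 (ltW (hlambda_gt0 d))
  (fun V z => (t ^+ 2 / d%:R <= sq_corr (sign_vector R V) (estimate alg z))%R) u1
  (cutoff k eta tau mu d) (a / 4) _ (2 * expR (- (t ^+ 2 / 2))) _ _ _ (powR_ge0 _ _) b0 (ltnSn _) (lexx _) g1
  (mulr_ge0 (ler0n _ 2) (expR_ge0 _)) (fun z => sign_correlation_tail d0 t _).
apply: (@le_trans _ _ (P d [set w | (t ^+ 2 / d%:R <=
   sq_corr (sign_vector R V) (Vhat d (tpca_data (W d) (lambda d) (sign_vector R V) w)))%R])).
  by apply: ereal_inf_lbound; exists (sign_vector R V) => //; exact: sign_vector_param.
have -> : [set w | (t ^+ 2 / d%:R <= sq_corr (sign_vector R V)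
    (Vhat d (tpca_data (W d) (lambda d) (sign_vector R V) w)))%R] =
  [set w | (t ^+ 2 / d%:R <= sq_corr (sign_vector R V)
    (estimate alg (final_state alg (tpca_data (W d) (lambda d) (sign_vector R V) w))))%R].
  by apply/seteqP; split => w /=; rewrite halg.
apply: le_trans hV _; rewrite lee_fin; lra.
Unshelve. all: by end_near. Qed.
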